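(* Let $(\mathbf{X}_i,Y_i)_{i\ge 1}$ be i.i.d. with $\mathbf{X}_i\in\mathcal{X}\subset\mathbb{R}^p$, $Y_i\in\mathbb{R}$ and $\mathbb{E}[Y\mid \mathbf{X}=\mathbf{x}]=f_0(\mathbf{x})$, where $f_0:\mathcal{X}\to\mathbb{R}$ is convex, and let $M\ge 1$ be a fixed integer. For $m=1,\dots,M$ let $Y^{(m)}_i=Y_i+\xi^{(m)}_i$, where the $\xi^{(m)}_i\sim N(0,B)$ are i.i.d. for some $B<\infty$ and independent of the data. Let $\hat f(\,\cdot\mid \mathbf{x}_{1:n},\mathbf{y}^{(m)}_{1:n})$ be the CAP estimator (defined in the context) trained on $(\mathbf{x}_i,y^{(m)}_i)_{i=1}^n$, with final partition $\{A^{(m)}_k\}_{k=1}^{K^{(m)}_n}$ and index subsets $C^{(m)}_k=\{i:\mathbf{x}_i\in A^{(m)}_k\}$. Assume: A1. $\mathcal{X}$ is compact, and $f_0$ is Lipschitz continuous (with Lipschitz parameter $\zeta$) and continuously differentiable on $\mathcal{X}$. A2. There is $a>0$ such that $\mathbb{E}\left[e^{a|Y-f_0(\mathbf{x})|}\mid \mathbf{X}=\mathbf{x}\right]$ is bounded on $\mathcal{X}$. A3. For $m=1,\dots,M$, $\max_k d^{(m)}_{nk}\to 0$ in probability as $n\to\infty$. A4. Let $\lambda^{(m)}_k$ be the smallest eigenvalue of $|C^{(m)}_k|^{-1}G^{(m)}_k$ and $\lambda^{(m)}_n=\min_k\lambda^{(m)}_k$. For $m=1,\dots,M$, $\lambda^{(m)}_n$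 remains bounded away from $0$ in probability as $n\to\infty$. A5. For $m=1,\dots,M$, $\min_{k=1,\dots,K^{(m)}_n} \big(d^{(m)}_{nk}\big)^2|C^{(m)}_k|/\log(n)\to\infty$ in probability as $n\to\infty$. (The quantities $d^{(m)}_{nk}$ and $G^{(m)}_k$ are defined in the context.) Then $$\sup_{\mathbf{x}\in\mathcal{X}}\left|\frac1M\sum_{m=1}^M\hat f(\mathbf{x}\mid \mathbf{x}_{1:n},\mathbf{y}^{(m)}_{1:n})-f_0(\mathbf{x})\right|\to 0$$ in probability as $n\to\infty$.
   Context: Convexity of $f_0$ on $\mathcal{X}$: $\lambda f_0(\mathbf{x}_1)+(1-\lambda)f_0(\mathbf{x}_2)\ge f_0(\lambda\mathbf{x}_1+(1-\lambda)\mathbf{x}_2)$ for all $\mathbf{x}_1,\mathbf{x}_2\in\mathcal{X}$, $\lambda\in(0,1)$ (so $\mathcal{X}$ is convex). CAP (Convex Adaptive Partitioning) estimator. Input: data $(\mathbf{x}_i,y_i)_{i=1}^n$. Fix $L\ge1$, evenly spaced knots $0<a_1<\dots<a_L<1$, a constant $D>0$, and minimum subset size $n_{\min}=\max\{n/(D\log n),\,2(p+1)\}$. A model of size $K$ consists of a partition $A_1,\dots,A_K$ of $\mathcal{X}$, index subsets $C_k=\{i:\mathbf{x}_i\in A_k\}$, and for each $k$ a least squares hyperplane $(\alpha_k,\beta_k)\in\arg\min_{\alpha\in\mathbb{R},\beta\in\mathbb{R}^p}\sum_{i\in C_k}(y_i-\alpha-\beta^T\mathbf{x}_i)^2$; it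 defines the function $\mathbf{x}\mapsto\max_{k}\{\alpha_k+\beta_k^T\mathbf{x}\}$. 1. Start with $K=1$, $A_1=\mathcal{X}$. 2. Split: for each subset $k$, each cardinal direction $j=1,\dots,p$ and each knot $a_\ell$, form the candidate model obtained by splitting $A_k$ into $\{\mathbf{x}\in A_k: x_j\le b\}$ and $\{\mathbf{x}\in A_k:x_j>b\}$, where $b=a_\ell\min_{i\in C_k}x_{ij}+(1-a_\ell)\max_{i\in C_k}x_{ij}$, and refitting the hyperplanes. Among candidates with all $|C_k|\ge n_{\min}$, keep the one minimizing the training mean squared error of its max-of-hyperplanes function; increase $K$ by one. 3. Refit: consider the partition induced by the hyperplanes of the current model, with cells where $\alpha_k+\beta_k^T\mathbf{x}$ attains the maximum (ties broken by a fixed rule), and refit hyperplanes by least squares on it; replace the current model by this one if all its subsets have at least $n_{\min}$ observations. The resulting model is $\mathcal{M}_K$. 4. Stop when every subset has fewer than $2n_{\min}$ observations; otherwise return to step 2. 5. Select the size $K_n$ among the models $\mathcal{M}_1,\mathcal{M}_2,\dots$ by a data-dependent model-size criterion (generalized cross-validation). The CAP estimator is $\hat f(\mathbf{x})=\max_{k=1,\dots,K_n}\{\alpha_k+\beta_k^T\mathbf{x}\}$ for the selected model; its partition $\{A_k\}$ and subsets $C_k$ are those of the selected model. Quantities attached to a partition (a superscript $(m)$ indicates they are computed for the $m$-th estimator from its training set): diameter $d_{nk}=\sup_{\mathbf{x}_1,\mathbf{x}_2\in A_k}\|\mathbf{x}_1-\mathbf{x}_2\|_2$; empirical mean $\bar{\mathbf{x}}_k=|C_k|^{-1}\sum_{i\in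 C_k}\mathbf{x}_i$; for $i\in C_k$, $\Gamma_i=\begin{bmatrix}1\\ d_{nk}^{-1}(\mathbf{x}_i-\bar{\mathbf{x}}_k)\end{bmatrix}\in\mathbb{R}^{p+1}$; and $G_k=\sum_{i\in C_k}\Gamma_i\Gamma_i^T$. ''Bounded away from $0$ in probability'' means there is $c>0$ with $\Pr(\lambda^{(m)}_n\ge c)\to1$. ''$Z_n\to\infty$ in probability'' means $\Pr(Z_n>t)\to1$ for every $t$. *)

(* Defs.v *)
From HB Require Import structures.
From mathcomp Require Import all_boot all_order all_algebra.
From mathcomp Require Import all_classical all_reals all_analysis.

Set Implicit Arguments.
Unset Strict Implicit.
Unset Printing Implicit Defensive.

Import Order.TTheory GRing.Theory Num.Theory.
Import numFieldNormedType.Exports.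

Local Open Scope classical_set_scope.
Local Open Scope ring_scope.

(* The library's norm on ['rV_p] is the sup norm, hence the explicit
   Euclidean one. *)
Definition dot (R : realType) (p : nat) (u v : 'rV[R]_p) : R :=
  \sum_(j < p) u 0 j * v 0 j.

Definition enorm (R : realType) (p : nat) (v : 'rV[R]_p) : R :=
  Num.sqrt (\sum_(j < p) v 0 j ^+ 2).

Definition diam (R : realType) (p : nat) (A : set 'rV[R]_p) : R :=
  sup [set enorm (u - v) | u in A & v in A].

Definition max_ord (R : realType) (K : nat) (F : 'I_K.+1 -> R) : R :=
  \big[Order.max/F ord0]_(k < K.+1) F k.

Definition min_ord (R : realType) (K : nat) (F : 'I_K.+1 -> R) : R :=
  \big[Order.min/F ord0]_(k < K.+1) F k.

Definition elipschitz_on (R : realType) (p : nat) (zeta : R)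
    (X : set 'rV[R]_p) (f : 'rV[R]_p -> R) : Prop :=
  forall u v, X u -> X v -> `|f u - f v| <= zeta * enorm (u - v).

(* [f] is only meaningful on [X], so differentiability is relative to [X]: a
   first-order expansion at every point of [X], along points of [X], with a
   gradient that is continuous on [X]. *)
Definition continuously_differentiable_on (R : realType) (p : nat)
    (X : set 'rV[R]_p) (f : 'rV[R]_p -> R) : Prop :=
  exists grad : 'rV[R]_p -> 'rV[R]_p,
    {within X, continuous grad} /\
    forall x, X x -> forall e, 0 < e ->
      \forall y \near within X (nbhs x),
        `|f y - f x - dot (grad x) (y - x)| <= e * enorm (y - x).

(* ['rV_p] with its Borel sigma-algebra *)
Definition borelV (R : realType) (p : nat) :=
  g_sigma_algebraType (@open 'rV[R]_p).

(* Quantities computed from an estimator need not be measurable, since the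
   estimator is an arbitrary function of the data; [inner_prob P A] agrees with
   [P A] when [A] is measurable ([inner_probE]). *)
Definition inner_prob (d : measure_display) (T : measurableType d)
    (R : realType) (P : probability T R) (A : set T) : \bar R :=
  ereal_sup [set P F | F in [set F | measurable F /\ F `<=` A]].

Lemma inner_probE (d : measure_display) (T : measurableType d)
    (R : realType) (P : probability T R) (A : set T) :
  measurable A -> inner_prob P A = P A.
Proof.
move=> mA; apply/eqP; rewrite eq_le; apply/andP; split.
- apply: ge_ereal_sup => _ [F [mF FA] <-].
  by apply: le_measure => //; rewrite inE.
- by apply: ereal_sup_ubound; exists A => //; split.
Qed.

Definition with_prob_to_one (d : measure_display) (T : measurableType d)
    (R : realType) (P : probability T R) (E : nat -> set T) : Prop :=
  inner_prob P (E n) @[n --> \oo] --> 1%E.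

Definition cvg0_in_prob (d : measure_display) (T : measurableType d)
    (R : realType) (P : probability T R) (Z : nat -> T -> R) : Prop :=
  forall e, 0 < e -> with_prob_to_one P (fun n => [set w | `|Z n w| <= e]).

Definition cvg_infty_in_prob (d : measure_display) (T : measurableType d)
    (R : realType) (P : probability T R) (Z : nat -> T -> R) : Prop :=
  forall t, with_prob_to_one P (fun n => [set w | t < Z n w]).

Definition bounded_away0_in_prob (d : measure_display) (T : measurableType d)
    (R : realType) (P : probability T R) (Z : nat -> T -> R) : Prop :=
  exists2 c, 0 < c & with_prob_to_one P (fun n => [set w | c <= Z n w]).

Definition mutually_independent (d : measure_display) (T : measurableType d)
    (R : realType) (P : probability T R) (I : eqType)
    (F : I -> set_system T) : Prop :=
  forall (s : seq I) (E : I -> set T), uniq s ->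
    (forall i, i \in s -> F i (E i)) ->
    P (\bigcap_(i in [set` s]) E i) = (\prod_(i <- s) P (E i))%E.

Definition identically_distributed (d d' : measure_display)
    (T : measurableType d) (U : measurableType d') (R : realType)
    (P : probability T R) (I : Type) (Z : I -> T -> U) : Prop :=
  forall i j (B : set U), measurable B -> P (Z i @^-1` B) = P (Z j @^-1` B).

Definition iid (d d' : measure_display) (T : measurableType d)
    (U : measurableType d') (R : realType) (P : probability T R)
    (I : eqType) (Z : I -> T -> U) : Prop :=
  mutually_independent P (fun i => g_sigma_algebra_preimage (Z i)) /\
  identically_distributed P Z.

Definition sigma_family (d d' : measure_display) (T : measurableType d)
    (U : measurableType d') (I : Type) (Z : I -> T -> U) : set_system T :=
  <<s \bigcup_i g_sigma_algebra_preimage (Z i) >>.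

Definition independent_families (d d1 d2 : measure_display)
    (T : measurableType d) (U1 : measurableType d1) (U2 : measurableType d2)
    (R : realType) (P : probability T R) (I1 I2 : Type)
    (Z1 : I1 -> T -> U1) (Z2 : I2 -> T -> U2) : Prop :=
  forall E F : set T, sigma_family Z1 E -> sigma_family Z2 F ->
    P (E `&` F) = (P E * P F)%E.

(* [h] is a version, on [D], of x |-> E[Z | X = x], where [X] takes its values
   in [D]. *)
Definition is_cond_expectation (d : measure_display) (T : measurableType d)
    (R : realType) (P : probability T R) (p : nat) (D : set 'rV[R]_p)
    (X : T -> borelV R p) (Z : T -> R) (h : 'rV[R]_p -> R) : Prop :=
  [/\ P.-integrable setT (EFin \o Z),
      measurable_fun (D : set (borelV R p)) (h : borelV R p -> R),
      P.-integrable setT (fun w => (h (X w))%:E)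
    & forall B : set (borelV R p), measurable B ->
        (\int[P]_(w in X @^-1` B) (Z w)%:E
         = \int[P]_(w in X @^-1` B) (h (X w))%:E)%E].

(* [normal_prob] takes a standard deviation, and its density is a junk value
   when that is 0. *)
Definition normal_law (R : realType) (variance : R) (B : set R) : \bar R :=
  if variance == 0 then \d_(0 : R) B
  else normal_prob 0 (Num.sqrt variance) B.

(* A model of size [msize.+1]; its cells are listed in a fixed order. *)
Record model (R : realType) (p : nat) := Model {
  msize : nat;
  cell : 'I_msize.+1 -> set 'rV[R]_p;
  icpt : 'I_msize.+1 -> R;
  slope : 'I_msize.+1 -> 'rV[R]_p }.

Definition hyperplane (R : realType) (p : nat) (M : model R p)
    (k : 'I_(msize M).+1) (v : 'rV[R]_p) : R :=
  icpt k + dot (slope k) v.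

Definition max_affine (R : realType) (p : nat) (M : model R p)
    (v : 'rV[R]_p) : R :=
  max_ord (fun k : 'I_(msize M).+1 => hyperplane k v).

Definition obs_in (R : realType) (p n : nat) (x : 'I_n -> 'rV[R]_p)
    (A : set 'rV[R]_p) : {set 'I_n} :=
  [set i | x i \in A]%SET.

Definition least_squares (R : realType) (p n : nat) (x : 'I_n -> 'rV[R]_p)
    (y : 'I_n -> R) (C : {set 'I_n}) (alpha : R) (beta : 'rV[R]_p) : Prop :=
  forall (alpha' : R) (beta' : 'rV[R]_p),
    \sum_(i in C) (y i - alpha - dot beta (x i)) ^+ 2
    <= \sum_(i in C) (y i - alpha' - dot beta' (x i)) ^+ 2.

Definition fitted (R : realType) (p n : nat) (x : 'I_n -> 'rV[R]_p)
    (y : 'I_n -> R) (M : model R p) : Prop :=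
  forall k : 'I_(msize M).+1,
    least_squares x y (obs_in x (cell k)) (icpt k) (slope k).

Definition training_mse (R : realType) (p n : nat) (x : 'I_n -> 'rV[R]_p)
    (y : 'I_n -> R) (M : model R p) : R :=
  n%:R^-1 * \sum_(i < n) (y i - max_affine M (x i)) ^+ 2.

Definition n_min (R : realType) (D : R) (p n : nat) : R :=
  Num.max (n%:R / (D * ln n%:R)) (2 * p.+1)%N%:R.

Definition admissible (R : realType) (p n : nat) (D : R)
    (x : 'I_n -> 'rV[R]_p) (M : model R p) : Prop :=
  forall k : 'I_(msize M).+1, n_min D p n <= #|obs_in x (cell k)|%:R.

(* [inf] and [sup] of a finite set: its minimum and maximum. *)
Definition split_point (R : realType) (p n : nat) (x : 'I_n -> 'rV[R]_p)
    (A : set 'rV[R]_p) (j : 'I_p) (a : R) : R :=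
  a * inf [set x i 0 j | i in [set` obs_in x A]]
  + (1 - a) * sup [set x i 0 j | i in [set` obs_in x A]].

(* The lower part replaces cell [k]; the upper part is listed last. *)
Definition split_cells (R : realType) (p K : nat)
    (A : 'I_K.+1 -> set 'rV[R]_p) (k : 'I_K.+1) (j : 'I_p) (b : R)
    (i : 'I_K.+2) : set 'rV[R]_p :=
  if unlift ord_max i is Some i' then
    if i' == k then A k `&` [set v | v 0 j <= b] else A i'
  else A k `&` [set v | b < v 0 j].

Definition is_candidate (R : realType) (p n L : nat) (a : 'I_L -> R)
    (x : 'I_n -> 'rV[R]_p) (y : 'I_n -> R) (M : model R p)
    (k : 'I_(msize M).+1) (j : 'I_p) (l : 'I_L) (M' : model R p) : Prop :=
  (exists alpha beta,
     M' = Model (split_cells (@cell R p M) k j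
                   (split_point x (cell k) j (a l))) alpha beta)
  /\ fitted x y M'.

(* Least squares hyperplanes need not be unique, so that the candidate attached
   to each split is a choice [cand]. *)
Definition split_step (R : realType) (p n L : nat) (D : R) (a : 'I_L -> R)
    (x : 'I_n -> 'rV[R]_p) (y : 'I_n -> R) (M M' : model R p) : Prop :=
  exists cand : 'I_(msize M).+1 -> 'I_p -> 'I_L -> model R p,
    [/\ forall k j l, is_candidate a x y k j l (cand k j l),
        exists k j l, M' = cand k j l,
        admissible D x M'
      & forall k j l, admissible D x (cand k j l) ->
          training_mse x y M' <= training_mse x y (cand k j l)].

Definition maximizers (R : realType) (p : nat) (M : model R p)
    (v : 'rV[R]_p) : {set 'I_(msize M).+1} :=
  [set k | hyperplane k v == max_affine M v]%SET.

(* [tie] picks an index in a set of tied indices. *)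
Definition tie_rule (tie : forall K, {set 'I_K.+1} -> 'I_K.+1) : Prop :=
  forall K (S : {set 'I_K.+1}), S != finset.set0 -> tie K S \in S.

Definition is_induced (R : realType) (p n : nat) (X : set 'rV[R]_p)
    (tie : forall K, {set 'I_K.+1} -> 'I_K.+1) (x : 'I_n -> 'rV[R]_p)
    (y : 'I_n -> R) (M M' : model R p) : Prop :=
  (exists alpha beta,
     M' = Model (fun k : 'I_(msize M).+1 =>
                   [set v | X v /\ tie _ (maximizers M v) = k]) alpha beta)
  /\ fitted x y M'.

Definition refit_step (R : realType) (p n : nat) (X : set 'rV[R]_p) (D : R)
    (tie : forall K, {set 'I_K.+1} -> 'I_K.+1) (x : 'I_n -> 'rV[R]_p)
    (y : 'I_n -> R) (M M'' : model R p) : Prop :=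
  exists M', is_induced X tie x y M M' /\
    (admissible D x M' /\ M'' = M' \/ ~ admissible D x M' /\ M'' = M).

Definition is_initial (R : realType) (p n : nat) (X : set 'rV[R]_p)
    (x : 'I_n -> 'rV[R]_p) (y : 'I_n -> R) (M : model R p) : Prop :=
  (exists alpha beta, M = Model (fun _ : 'I_1 => X) alpha beta)
  /\ fitted x y M.

Definition all_small (R : realType) (p n : nat) (D : R)
    (x : 'I_n -> 'rV[R]_p) (M : model R p) : Prop :=
  forall k : 'I_(msize M).+1, #|obs_in x (cell k)|%:R < 2 * n_min D p n.

(* [Ms 0], ..., [Ms N] are the successive models, [Ms K] having size [K.+1].
   The run ends when all subsets are small, and also when no split is
   admissible (which may happen earlier, e.g. with repeated covariates); in the
   former case no split is admissible either. *)
Definition cap_run (R : realType) (p n L : nat) (X : set 'rV[R]_p) (D : R)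
    (a : 'I_L -> R) (tie : forall K, {set 'I_K.+1} -> 'I_K.+1)
    (x : 'I_n -> 'rV[R]_p) (y : 'I_n -> R)
    (Ms : nat -> model R p) (N : nat) : Prop :=
  [/\ is_initial X x y (Ms 0%N),
      forall K, (K < N)%N -> ~ all_small D x (Ms K) /\
        exists M', split_step D a x y (Ms K) M' /\
                   refit_step X D tie x y M' (Ms K.+1)
    & all_small D x (Ms N) \/ ~ exists M', split_step D a x y (Ms N) M'].

(* [crit x y M] is the model-size criterion, e.g. a generalized
   cross-validation score, to be minimized over the run. *)
Definition cap_output (R : realType) (p n L : nat) (X : set 'rV[R]_p) (D : R)
    (a : 'I_L -> R) (tie : forall K, {set 'I_K.+1} -> 'I_K.+1)
    (crit : ('I_n -> 'rV[R]_p) -> ('I_n -> R) -> model R p -> R)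
    (x : 'I_n -> 'rV[R]_p) (y : 'I_n -> R) (M : model R p) : Prop :=
  exists Ms N Kn, [/\ cap_run X D a tie x y Ms N, (Kn <= N)%N, M = Ms Kn
    & forall K, (K <= N)%N -> crit x y M <= crit x y (Ms K)].

(* The CAP estimator is a deterministic function of the training data. *)
Definition cap_estimator (R : realType) (p L : nat) (X : set 'rV[R]_p) (D : R)
    (a : 'I_L -> R) (tie : forall K, {set 'I_K.+1} -> 'I_K.+1)
    (crit : forall n, ('I_n -> 'rV[R]_p) -> ('I_n -> R) -> model R p -> R)
    (cap : forall n, ('I_n -> 'rV[R]_p) -> ('I_n -> R) -> model R p) : Prop :=
  forall n (x : 'I_n -> 'rV[R]_p) (y : 'I_n -> R), (forall i, X (x i)) ->
    cap_output X D a tie (@crit n) x y (cap n x y).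

Definition evenly_spaced_knots (R : realType) (L : nat) (a : 'I_L -> R) :
    Prop :=
  (forall l, 0 < a l < 1) /\
  exists a1 h, 0 < h /\ forall l : 'I_L, a l = a1 + l%:R * h.

Definition emp_mean (R : realType) (p n : nat) (x : 'I_n -> 'rV[R]_p)
    (C : {set 'I_n}) : 'rV[R]_p :=
  #|C|%:R^-1 *: \sum_(i in C) x i.

Definition Gamma (R : realType) (p n : nat) (x : 'I_n -> 'rV[R]_p)
    (A : set 'rV[R]_p) (i : 'I_n) : 'cV[R]_(1 + p) :=
  col_mx 1%:M ((diam A)^-1 *: (x i - emp_mean x (obs_in x A))^T).

Definition gram (R : realType) (p n : nat) (x : 'I_n -> 'rV[R]_p)
    (A : set 'rV[R]_p) : 'M[R]_(1 + p) :=
  \sum_(i in obs_in x A) Gamma x A i *m (Gamma x A i)^T.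

(* [A] will be symmetric: its set of eigenvalues is finite and nonempty. *)
Definition min_eigenvalue (R : realType) (q : nat) (A : 'M[R]_q) : R :=
  inf [set l | eigenvalue A l].

Definition max_diam (R : realType) (p : nat) (M : model R p) : R :=
  max_ord (fun k : 'I_(msize M).+1 => diam (cell k)).

Definition lambda_min (R : realType) (p n : nat) (x : 'I_n -> 'rV[R]_p)
    (M : model R p) : R :=
  min_ord (fun k : 'I_(msize M).+1 =>
    min_eigenvalue (#|obs_in x (cell k)|%:R^-1 *: gram x (cell k))).

Definition min_cell_information (R : realType) (p n : nat)
    (x : 'I_n -> 'rV[R]_p) (M : model R p) : R :=
  min_ord (fun k : 'I_(msize M).+1 =>
    diam (cell k) ^+ 2 * #|obs_in x (cell k)|%:R / ln n%:R).

(* Main.v *)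
(* On a cell of diameter [d] with [N] points, the least squares plane differs from
   a tangent plane of [f0] by [O(d (eta + noise))], where [eta d] bounds the
   Taylor error and [noise] is the supremum of the sums of the noise over the cell
   cut by axis half-spaces, divided by [d N]. If this is [o(d)] uniformly over the
   cells, all the planes lie below [f0 + o(1)] and the plane of the cell containing
   [v] is at least [f0 v - o(1)], so that the maximum of the planes converges.

   The cells depend on the noise, hence a uniform bound over all possible cells is
   needed. A cell is cut out by its neighbours: it can be described with [G]
   half-spaces, where [G] is of the order of the number of nearby cells, which
   could be of the order of [ln n]. A union bound over such sets costs [G ln n],
   whereas A5 only provides [d^2 N >> ln n]. Two ideas remedy this. By chaining
   through a net of the describable sets, the cost drops to [ln n + G ln ln n]. By
   A4 the cells are fat, so that a packing argument bounds the number of nearby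
   cells in terms of [d^2 N]: many nearby cells of comparable size are impossible,
   and many small ones, which by A5 contain many points, force [d^2 N] to be
   large. *)

Require Import Defs.
From HB Require Import structures.
From mathcomp Require Import all_boot all_order all_algebra.
From mathcomp Require Import all_classical all_reals all_analysis.
From mathcomp Require Import measurable_realfun.
From mathcomp Require Import ring lra zify.

Set Implicit Arguments.
Unset Strict Implicit.
Unset Printing Implicit Defensive.

Import Order.TTheory GRing.Theory Num.Theory.
Import numFieldNormedType.Exports.
Import HBNNSimple.

Local Open Scope classical_set_scope.
Local Open Scope ring_scope.

Implicit Types (R : realType) (p n : nat)
  (tie : forall K, {set 'I_K.+1} -> 'I_K.+1).

(** * Shattering *)

(** Least squares fixes the target. The noise sums over a cell of [N] points are of order
    [sqrt(N (ln n + G ln ln n))], which is [o(d N)] when [ln n + G ln ln n = o(d^2 N)]; the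
    geometric part has to deliver this inequality, A5 paying for the first term and packing for the
    second. Sets are compared only through their traces on the sample; by Radon and Sauer-Shelah,
    half-spaces leave polynomially many. The family of these traces takes finitely many values and
    depends on the covariates alone. The sample space is split by its value, and on each piece a
    union bound is run over tests chosen from that value. Conditioning thus reduces to exponential
    moments integrated over covariate events. In the geometry the obstacle is the arbitrary
    tie-breaking rule: several indices may carry the same plane, observations may sit on boundaries,
    and after rejected refits the cells are axis-parallel pieces of induced ones. Hence the labels,
    the principal representatives, the closures of cells and the reference points. *)

Definition shatters (T : finType) (F : {set {set T}}) (D : {set T}) : bool :=
  [forall E : {set T}, (E \subset D) ==> [exists C in F, C :&: D == E]]%SET.

Lemma shattersP (T : finType) (F : {set {set T}}) (D : {set T}) :
  reflect (forall E : {set T}, E \subset D -> exists2 C, C \in F & (C :&: D = E)%SET)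
          (shatters F D).
Proof.
apply: (iffP forallP) => [H E ED|H E].
  by have /implyP/(_ ED)/exists_inP[C CF /eqP] := H E; exists C.
apply/implyP => ED; apply/exists_inP; have [C CF CE] := H E ED.
by exists C => //; apply/eqP.
Qed.

(** Pajor's form of the Sauer-Shelah lemma, by induction on the family. Split [F] by an element [a]
    on which two members differ. A set shattered by both halves is counted twice, and the second
    count is paid by adding [a] to it, which gives a further set shattered by [F]. *)
Lemma pajor (T : finType) (F : {set {set T}}) :
  (#|F| <= #|[set D | shatters F D]%SET|)%N.
Proof.
have [n] := ubnP #|F|; elim: n F => // n IHn F /ltnSE leFn.
have [lt1F|] := ltnP 1 #|F|; last first.
  case: (set_0Vmem F) => [-> _|[C CF] le1]; first by rewrite cards0.
  apply: (leq_trans le1); apply/card_gt0P; exists finset.set0.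
  rewrite inE; apply/shattersP => E; rewrite finset.subset0 => /eqP ->.
  by exists C; rewrite ?finset.setI0.
have /card_gt1P[C1 [C2 [C1F C2F C12]]] := lt1F.
wlog [a aC1 aC2] : C1 C2 C1F C2F C12 / exists2 a, a \in C1 & a \notin C2.
  move=> W; have [/subsetPn[a aC1 aC2]|C1C2] := boolP (~~ (C1 \subset C2)).
    by apply: (W C1 C2) => //; exists a.
  have [/subsetPn[a aC1 aC2]|C2C1] := boolP (~~ (C2 \subset C1)).
    by apply: (W C2 C1) => //; rewrite 1?eq_sym//; exists a.
  by move: C12; rewrite finset.eqEsubset; move: C1C2 C2C1; rewrite !negbK => -> ->.
pose F1 := [set C in F | a \in C]%SET; pose F0 := [set C in F | a \notin C]%SET.
have F1s : F1 \subset F by apply/fintype.subsetP => C; rewrite inE => /andP[].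
have F0s : F0 \subset F by apply/fintype.subsetP => C; rewrite inE => /andP[].
have cF : #|F| = (#|F0| + #|F1|)%N.
  rewrite -(cardsID [set C : {set T} | a \in C]%SET F) addnC; congr (_ + _)%N.
    by apply: eq_card => C; rewrite !inE andbC.
  by apply: eq_card => C; rewrite !inE.
have F1p : (0 < #|F1|)%N by apply/card_gt0P; exists C1; rewrite inE C1F.
have F0p : (0 < #|F0|)%N by apply/card_gt0P; exists C2; rewrite inE C2F.
have IH0 := IHn F0 ltac:(lia); have IH1 := IHn F1 ltac:(lia).
pose S0 := [set D | shatters F0 D]%SET; pose S1 := [set D | shatters F1 D]%SET.
have a0 D : D \in S0 -> a \notin D.
  rewrite inE => /shattersP/(_ D (subxx _))[C]; rewrite inE => /andP[_ aC] CD.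
  by apply: contra aC; rewrite -CD inE => /andP[].
have subSh (G G' : {set {set T}}) D : G \subset G' -> shatters G D -> shatters G' D.
  move=> /fintype.subsetP GG' /shattersP H; apply/shattersP => E /H[C CG CE].
  by exists C => //; apply: GG'.
pose S2 := [set a |: D | D in S0 :&: S1]%SET.
have dis : ((S0 :|: S1) :&: S2 = finset.set0)%SET.
  apply/finset.setP => D; rewrite [RHS]inE; apply/negbTE/negP => /setIP[D01].
  case/imsetP => D' D'S eD; have /setUP[D0|D1] := D01.
    by have := a0 _ D0; rewrite eD !inE eqxx.
  move: D1; rewrite inE => /shattersP/(_ (D :\ a)%SET (finset.subD1set _ _))[C].
  rewrite inE => /andP[_ aC] /finset.setP/(_ a).
  by rewrite !inE aC eD !inE eqxx.
have cS2 : #|S2| = #|(S0 :&: S1)%SET|.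
  apply: card_in_imset => D D' /setIP[/a0 aD _] /setIP[/a0 aD' _] /finset.setP e.
  apply/finset.setP => x; have := e x; rewrite !inE.
  by case: eqP => // -> _; rewrite (negbTE aD) (negbTE aD').
rewrite cF; apply: (leq_trans (leq_add IH0 IH1)).
rewrite -/S0 -/S1 -cardsUI -cS2 -cardsUI.
rewrite dis cards0 addn0; apply: subset_leq_card.
apply/fintype.subsetP => D /setUP[/setUP[]|].
- by rewrite !inE; apply: subSh.
- by rewrite !inE; apply: subSh.
case/imsetP => D' /setIP[D0 D1] ->; rewrite !inE in D0 D1 *.
apply/shattersP => E ED; case: (boolP (a \in E)) => aE.
  have /shattersP/(_ (E :\ a)%SET)[|C] := D1.
    apply/fintype.subsetP => x; rewrite finset.in_setD1 => /andP[xa /(fintype.subsetP ED)].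
    by rewrite !inE (negbTE xa).
  rewrite inE => /andP[CF aC] CE; exists C => //.
  have -> : (C :&: (a |: D') = a |: (C :&: D'))%SET.
    by apply/finset.setP => x; rewrite !inE; case: eqP => // ->; rewrite aC.
  by rewrite CE finset.setD1K.
have /shattersP/(_ E)[|C] := D0.
  apply/fintype.subsetP => x xE; have := fintype.subsetP ED x xE.
  by rewrite !inE => /orP[/eqP xa|//]; rewrite xa (negbTE aE) in xE.
rewrite inE => /andP[CF aC] CE; exists C => //.
rewrite -[RHS]CE; apply/finset.setP => x; rewrite !inE.
by case: eqP => // ->; rewrite (negbTE aC).
Qed.

Lemma card_small_subsets (T : finType) (S : {set T}) (q : nat) :
  (#|[set D : {set T} | (D \subset S) && (#|D| <= q)%N]%SET| <= #|S|.+1 ^ q)%N.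
Proof.
elim: q => [|q IHq].
  rewrite expn0 -(cards1 (finset.set0 : {set T})); apply: subset_leq_card.
  by apply/fintype.subsetP => D; rewrite !inE leqn0 cards_eq0 => /andP[].
pose W := [set D : {set T} | (D \subset S) && (#|D| <= q)%N]%SET.
pose f (u : {set T} * option T) := if u.2 is Some x then (x |: u.1)%SET else u.1.
pose O := (None |: [set Some x | x in S])%SET.
have cO : (#|O| <= #|S|.+1)%N.
  by rewrite (leq_trans (leq_card_setU _ _))// cards1 add1n ltnS leq_imset_card.
apply: (@leq_trans #|[set f u | u in finset.setX W O]%SET|); last first.
  by apply: (leq_trans (leq_imset_card _ _)); rewrite cardsX expnSr leq_mul.
apply: subset_leq_card; apply/fintype.subsetP => D; rewrite inE => /andP[DS Dq].
apply/imsetP; case: (set_0Vmem D) => [->|[x xD]].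
  by exists (finset.set0, None); rewrite // !inE cards0 finset.sub0set.
exists ((D :\ x)%SET, Some x) => /=; last by rewrite /f /= finset.setD1K.
rewrite !inE /= (fintype.subset_trans (finset.subD1set _ _) DS) /=.
rewrite (cardsD1 x) xD in Dq; rewrite -ltnS Dq /=.
by apply/imsetP; exists x => //; apply: (fintype.subsetP DS).
Qed.

(** Pajor's inequality is applied to the family of traces: a set that it shatters lies in [S] and is
    shattered by [F], hence is small. *)
Lemma sauer_shelah (T : finType) (F : {set {set T}}) (S : {set T}) (q : nat) :
  (forall D, shatters F D -> (#|D| <= q)%N) ->
  (#|[set C :&: S | C in F]%SET| <= #|S|.+1 ^ q)%N.
Proof.
move=> vc; apply: (leq_trans (pajor _)); apply: leq_trans (card_small_subsets S q).
apply: subset_leq_card; apply/fintype.subsetP => D; rewrite !inE => /shattersP sh.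
have DS : D \subset S.
  have [_ /imsetP[C _ ->] <-] := sh D (subxx _).
  exact: fintype.subset_trans (finset.subsetIl _ _) (finset.subsetIr _ _).
rewrite DS; apply: vc; apply/shattersP => E /sh[_ /imsetP[C CF ->] <-].
by exists C; rewrite // -finset.setIA (finset.setIidPr DS).
Qed.

(** * Describable sets *)

(* The second test, having the same traces as some reference point of [t] on
   all of [h2], expresses which of several tied planes wins: as the tie-breaking
   rule is arbitrary, this can only be read off a point of the cell. *)
Definition desc_set (T : finType) (h1 h2 : seq {set T}) (t : seq T) : {set T} :=
  [set i | all (fun h : {set T} => i \in h) h1 &&
    has (fun x => all (fun h : {set T} => (i \in h) == (x \in h)) h2) t]%SET.

Definition describable (T : finType) (H : {set {set T}}) (G : nat) : {set {set T}} :=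
  [set C | `[< exists h1 h2 t, [/\ {subset h1 <= H}, {subset h2 <= H},
     (size h1 <= G)%N /\ (size h2 <= G)%N, (size t <= G)%N & C = desc_set h1 h2 t] >]]%SET.

Lemma describableP (T : finType) (H : {set {set T}}) (G : nat) (C : {set T}) :
  reflect (exists h1 h2 t, [/\ {subset h1 <= H}, {subset h2 <= H},
     (size h1 <= G)%N /\ (size h2 <= G)%N, (size t <= G)%N & C = desc_set h1 h2 t])
   (C \in describable H G).
Proof. by rewrite inE; apply: asboolP. Qed.

Lemma describable_le (T : finType) (H : {set {set T}}) (G G' : nat) (C : {set T}) :
  (G <= G')%N -> C \in describable H G -> C \in describable H G'.
Proof.
move=> GG' /describableP[h1 [h2 [t [? ? [? ?] ? ?]]]]; apply/describableP.
by exists h1, h2, t; split => //; first split; apply: leq_trans GG'.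
Qed.

(** Least squares also involves the noise over a cell cut by an axis half-space; this is one more
    unit of complexity, the origin of the [G.+1] further on. *)
Lemma describableI (T : finType) (H : {set {set T}}) (G : nat) (C h : {set T}) :
  h \in H -> C \in describable H G -> (C :&: h)%SET \in describable H G.+1.
Proof.
move=> hH /describableP[h1 [h2 [t [h1H h2H [s1 s2] st ->]]]]; apply/describableP.
exists (h :: h1), h2, t; split => //=.
- by move=> x; rewrite inE => /orP[/eqP ->|/h1H].
- by split; rewrite 1?ltnS// leqW.
- by rewrite leqW.
by apply/finset.setP => i; rewrite !inE /= [LHS]andbC andbA.
Qed.

(** A trace is determined by [2 G] traces of members of [H], each among [(#|S| + 1) ^ q], and by [G]
    reference points taken in [S] or absent, whence the exponent [(2 q + 1) G]. Shorter lists are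
    padded with [setT]. *)
Lemma card_traces_describable (T : finType) (H : {set {set T}}) (G q : nat) (S : {set T}) :
  finset.setT \in H -> (forall D, shatters H D -> (#|D| <= q)%N) ->
  (#|[set C :&: S | C in describable H G]%SET| <= #|S|.+1 ^ ((2 * q + 1) * G))%N.
Proof.
move=> HT vc; pose HS := [set C :&: S | C in H]%SET.
pose O := (None |: [set Some x | x in S])%SET.
have cO : (#|O| <= #|S|.+1)%N.
  by rewrite (leq_trans (leq_card_setU _ _))// cards1 add1n ltnS leq_imset_card.
have cHS : (#|HS| <= #|S|.+1 ^ q)%N by exact: sauer_shelah.
pose A1 := [set f : {ffun 'I_G -> {set T}} | f \in ffun_on (mem HS)]%SET.
pose A2 := [set f : {ffun 'I_G -> option T} | f \in ffun_on (mem O)]%SET.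
pose D := finset.setX (finset.setX A1 A1) A2.
pose f (u : {ffun 'I_G -> {set T}} * {ffun 'I_G -> {set T}} * {ffun 'I_G -> option T}) :=
  (S :&: desc_set (codom u.1.1) (codom u.1.2) (pmap id (codom u.2)))%SET.
apply: (@leq_trans #|f @: D|%SET); last first.
  apply: (leq_trans (leq_imset_card _ _)); rewrite !cardsX.
  have -> : #|A1| = (#|HS| ^ G)%N.
    by rewrite cardsE card_ffun_on card_ord.
  have -> : #|A2| = (#|O| ^ G)%N.
    by rewrite cardsE card_ffun_on card_ord.
  rewrite -!expnMn expnM; have [->|G0] := posnP G; first by rewrite !expn0.
  rewrite leq_exp2r// mul2n -addnn addn1 expnSr expnD; apply: leq_mul => //; exact: leq_mul.
apply: subset_leq_card; apply/fintype.subsetP => E /imsetP[C CG ->{E}].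
have [h1 [h2 [t [h1H h2H [s1 s2] st ->]]]] := describableP _ _ _ CG.
(* A reference point matters on [S] only if some point of [S] has the same pattern on [h2], and then
   that point can replace it. *)
pose r x := [pick y in S | all (fun h : {set T} => (y \in h) == (x \in h)) h2].
pose g h k : {set T} := (nth finset.setT h k :&: S)%SET.
have nH (h : seq {set T}) k : {subset h <= H} -> g h k \in HS.
  move=> hH; apply: imset_f; have [kh|kh] := ltnP k (size h); last by rewrite nth_default.
  exact/hH/mem_nth.
apply/imsetP; exists ([ffun k : 'I_G => g h1 k], [ffun k : 'I_G => g h2 k],
  [ffun k : 'I_G => nth None [seq r x | x <- t] k]).
  rewrite !inE /=; apply/andP; split; first (apply/andP; split).
  - by apply/ffun_onP => k; rewrite ffunE nH.
  - by apply/ffun_onP => k; rewrite ffunE nH.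
  apply/ffun_onP => k; rewrite ffunE; have [kt|kt] := ltnP k (size t); last first.
    by rewrite nth_default ?size_map// !inE.
  case: t kt {st} => // x0 t kt; rewrite (nth_map x0)//.
  rewrite /r; case: pickP => [y /andP[yS _]|_]; rewrite !inE //=.
  by apply/imsetP; exists y.
have allg (h : seq {set T}) (P : pred {set T}) (Q : pred {set T}) : (size h <= G)%N ->
    P finset.setT -> (forall a, P a = Q (a :&: S)%SET) ->
    all P h = all Q (codom [ffun k : 'I_G => g h k]).
  move=> sh PT PQ; apply/allP/allP => [Ph _ /codomP[k ->]|Qh a ah].
    rewrite ffunE /g -PQ; have [kh|kh] := ltnP k (size h); last by rewrite nth_default.
    exact/Ph/mem_nth.
  have kh := ah; rewrite -index_mem in kh.
  rewrite PQ; apply: Qh; apply/codomP; exists (Ordinal (leq_trans kh sh)).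
  by rewrite ffunE /g /= nth_index.
rewrite /f; apply/finset.setP => i; rewrite !inE /= [LHS]andbC.
case iS : (i \in S) => //=; congr (_ && _).
  by apply: allg => // a; rewrite !inE iS andbT.
apply/hasP/hasP => -[x].
  move=> xt ix; have rx : r x != None.
    by rewrite /r; case: pickP => // /(_ i); rewrite iS ix.
  case e : (r x) rx => [y|//] _; exists y.
    rewrite mem_pmap; apply/mapP; exists (Some y) => //.
    have kt := xt; rewrite -index_mem in kt.
    apply/codomP; exists (Ordinal (leq_trans kt st)).
    by rewrite ffunE /= (nth_map x)// nth_index.
  have yS : (y \in S) && all (fun h : {set T} => (y \in h) == (x \in h)) h2.
    by move: e; rewrite /r; case: pickP => [z zS [<-]|//].
  case/andP: yS => yS yx.
  rewrite -(allg _ (fun h : {set T} => (i \in h) == (y \in h)))//; first 1 last.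
  - by rewrite !inE.
  - by move=> a; rewrite !inE iS yS !andbT.
  apply/allP => a ah; rewrite (eqP (allP ix a ah)) eq_sym; exact: (allP yx).
rewrite mem_pmap => /mapP[[y|//] /codomP[k]]; rewrite ffunE => ek [->] iy.
have [kt|kt] := ltnP k (size t); last by rewrite nth_default ?size_map in ek.
case: t kt st ek => // x0 t kt st; rewrite (nth_map x0)// => ek.
exists (nth x0 (x0 :: t) k); first exact: mem_nth.
have yS : (y \in S) && all (fun h : {set T} => (y \in h) == (nth x0 (x0 :: t) k \in h)) h2.
  by move: (esym ek); rewrite /r; case: pickP => [z zS [<-]|//].
case/andP: yS => yS yx.
rewrite -(allg _ (fun h : {set T} => (i \in h) == (y \in h)))// in iy; first last.
- by move=> a; rewrite !inE iS yS !andbT.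
- by rewrite !inE.
apply/allP => a ah; rewrite (eqP (allP iy a ah)); exact: (allP yx).
Qed.

Lemma card_describable (T : finType) (H : {set {set T}}) (G q : nat) :
  finset.setT \in H -> (forall D, shatters H D -> (#|D| <= q)%N) ->
  (#|describable H G| <= #|T|.+1 ^ ((2 * q + 1) * G))%N.
Proof.
move=> HT vc; have := card_traces_describable G [set: T]%SET HT vc.
rewrite cardsT => /(leq_trans _); apply.
rewrite (_ : imset _ _ = describable H G)//.
apply/finset.setP => C; apply/imsetP/idP => [[D DG ->]|CG].
  by rewrite finset.setIT.
by exists C; rewrite ?finset.setIT.
Qed.

(* Counting: for a pair with a large symmetric difference, at most a fraction
   [(1 - eta) ^+ m] of the samples of size [m] misses that difference. *)
Lemma separating_sample R (T : finType) (F : {set {set T}}) (eta : R) (m : nat) :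
  0 < eta <= 1 -> (#|F| ^ 2)%:R * (1 - eta) ^+ m < 1 ->
  exists2 S : {set T}, (#|S| <= m)%N & forall C C', C \in F -> C' \in F ->
    (C :&: S = C' :&: S)%SET -> #|(C :\: C')%SET|%:R <= eta * #|T|%:R.
Proof.
move=> /andP[e0 e1] lt1.
pose dl (b : {set T} * {set T}) := ((b.1 :\: b.2) :|: (b.2 :\: b.1))%SET.
pose bad S := [set b in finset.setX F F |
  (eta * #|T|%:R < #|dl b|%:R) && (dl b :&: S == finset.set0)%SET]%SET.
suff [S Sm bS] : exists2 S : {set T}, (#|S| <= m)%N &
    #|bad S|%:R <= (#|F| ^ 2)%:R * (1 - eta) ^+ m.
  exists S => // C C' CF C'F CC'; rewrite leNgt; apply/negP => big.
  have : (C, C') \in bad S.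
    rewrite !inE /= CF C'F /=; apply/andP; split.
      by apply: (lt_le_trans big); rewrite ler_nat subset_leq_card// finset.subsetUl.
    apply/eqP/finset.setP => i; have /finset.setP/(_ i) := CC'; rewrite !inE.
    by case: (i \in S); rewrite ?andbF// !andbT => ->; case: (_ \in _).
  move=> Cb; have : (1 <= #|bad S|)%N by apply/card_gt0P; eexists; exact: Cb.
  by rewrite -(ler_nat R) leNgt (le_lt_trans bS lt1).
elim: m {lt1} => [|m [S Sm bS]].
  exists finset.set0; first by rewrite cards0.
  rewrite expr0 mulr1 ler_nat; apply: (@leq_trans #|finset.setX F F|); last by rewrite cardsX.
  by apply: subset_leq_card; apply/fintype.subsetP => b; rewrite inE => /andP[].
have [bS0|b0] := eqVneq (bad S) finset.set0.
  exists S; first exact: leqW.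
  by rewrite bS0 cards0 mulr_ge0// exprn_ge0 ?subr_ge0.
pose cnt i := #|[set b in bad S | i \in dl b]%SET|.
(* The sample is built greedily. Each bad difference has more than [eta * #|T|] elements, so on
   average an element lies in more than a fraction [eta] of them; adding the best one multiplies the
   number of bad pairs by at most [1 - eta]. *)
have [i ci] : exists i, eta * #|bad S|%:R < (cnt i)%:R.
  apply/existsP; apply: contraT; rewrite negb_exists => /forallP noi.
  have : \sum_(i : T) (cnt i)%:R <= \sum_(i : T) eta * #|bad S|%:R.
    by apply: ler_sum => i _; rewrite leNgt; exact: noi.
  rewrite sumr_const cardT -cardE leNgt; case/negP.
  have -> : \sum_(i : T) (cnt i)%:R = \sum_(b in bad S) #|dl b|%:R :> R.
    rewrite -!natr_sum; congr (_%:R).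
    under eq_bigr do rewrite /cnt -sum1_card.
    under [RHS]eq_bigr do rewrite -sum1_card.
    rewrite [RHS](exchange_big_dep predT)//=; apply: eq_bigr => i _.
    by apply: eq_bigl => b; rewrite inE.
  have -> : eta * #|bad S|%:R *+ #|T| = \sum_(b in bad S) (eta * #|T|%:R).
    by rewrite sumr_const -[LHS]mulr_natr -[RHS]mulr_natr mulrAC.
  have [b bb] : exists b, b \in bad S by apply/finset.set0Pn.
  rewrite (bigD1 b bb) [X in _ < X](bigD1 b bb); apply: ltr_leD.
    by move: bb; rewrite inE => /andP[_ /andP[]].
  apply: ler_sum => b' /andP[b'S _]; move: (b'S : b' \in bad S).
  by rewrite inE => /andP[_ /andP[/ltW]].
exists (i |: S)%SET; first by rewrite cardsU1; case: (i \notin S); rewrite ?add1n// leqW.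
have sub : bad (i |: S)%SET \subset (bad S :\: [set b in bad S | i \in dl b])%SET.
  apply/fintype.subsetP => b bi; move: (bi); rewrite [_ \in bad _]inE => /andP[bF /andP[b1 /eqP b2]].
  have dS x : x \in dl b -> x \in (i |: S)%SET = false.
    by move=> xd; have /finset.setP/(_ x) := b2; rewrite finset.in_setI xd finset.in_set0.
  have ib : i \notin dl b by apply/negP => /dS; rewrite finset.setU11.
  apply/finset.setDP; split; last by rewrite inE (negbTE ib) andbF.
  rewrite inE bF b1 /=.
  apply/eqP/finset.setP => x; rewrite finset.in_setI finset.in_set0; apply/negP => /andP[/dS].
  by rewrite finset.in_setU => /norP[_ /negbTE ->].
apply: (@le_trans _ _ (#|bad S|%:R - (cnt i)%:R)).
  rewrite -natrB; last by apply: subset_leq_card; apply/fintype.subsetP => b; rewrite inE => /andP[].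
  rewrite ler_nat (leq_trans (subset_leq_card sub))// cardsD.
  rewrite (finset.setIidPr _)//; by apply/fintype.subsetP => b; rewrite inE => /andP[].
apply: (@le_trans _ _ (#|bad S|%:R * (1 - eta))); first by rewrite mulrBr mulr1 lerD2l lerN2 mulrC ltW.
by rewrite exprSr mulrA ler_wpM2r// subr_ge0.
Qed.

(** One representative per trace on a separating sample of size [m] forms a net, so that its
    cardinality involves [m] instead of [#|T|]. The sample is chosen for the largest complexity [G0]
    and then serves all [G]; the factor 2 in the exponent counts pairs of describable sets. *)
Lemma describable_net R (T : finType) (H : {set {set T}}) (q G0 m : nat) (eta : R) :
  finset.setT \in H -> (forall D, shatters H D -> (#|D| <= q)%N) ->
  0 < eta <= 1 -> (#|T|.+1 ^ ((2 * q + 1) * G0 * 2))%:R * (1 - eta) ^+ m < 1 ->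
  forall G, (G <= G0)%N -> exists N : {set {set T}}, [/\ N \subset describable H G,
    (#|N| <= m.+1 ^ ((2 * q + 1) * G))%N &
    forall C, C \in describable H G -> exists2 C', C' \in N &
      #|(C :\: C')%SET|%:R <= eta * #|T|%:R /\ #|(C' :\: C)%SET|%:R <= eta * #|T|%:R].
Proof.
move=> HT vc eta01 lt1 G GG0; have /andP[e0 e1] := eta01.
have [|S Sm sepS] := @separating_sample R T (describable H G0) eta m eta01.
  apply: le_lt_trans lt1; rewrite ler_wpM2r ?exprn_ge0 ?subr_ge0// ler_nat expnM.
  by rewrite leq_exp2r// card_describable.
pose tr := [set C :&: S | C in describable H G]%SET.
pose rep D : {set T} := odflt finset.set0 [pick C in describable H G | (C :&: S == D)%SET].
exists [set rep D | D in tr]%SET; split.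
- apply/fintype.subsetP => _ /imsetP[D /imsetP[C CG ->] ->].
  by rewrite /rep; case: pickP => [C' /andP[]//|/(_ C)]; rewrite CG eqxx.
- apply: (leq_trans (leq_imset_card _ _)).
  apply: (leq_trans (card_traces_describable G S HT vc)).
  have [->|pos] := posnP ((2 * q + 1) * G)%N; first by rewrite !expn0.
  by rewrite leq_exp2r.
move=> C CG; exists (rep (C :&: S)%SET); first by apply: imset_f; apply: imset_f.
rewrite /rep; case: pickP => [C' /andP[C'G /eqP e]|/(_ C)] /=; last by rewrite CG eqxx.
by split; apply: sepS; rewrite ?e//; apply: describable_le GG0 _.
Qed.

Definition halfspaces R p n (x : 'I_n -> 'rV[R]_p) : {set {set 'I_n}} :=
  [set C : {set 'I_n} | `[< exists b u, forall i, (i \in C) = (0 < b + dot u (x i)) >]]%SET.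

Lemma halfspacesP R p n (x : 'I_n -> 'rV[R]_p) (C : {set 'I_n}) :
  reflect (exists b u, forall i, (i \in C) = (0 < b + dot u (x i))) (C \in halfspaces x).
Proof. by rewrite inE; apply: asboolP. Qed.

Lemma dot0l R p (v : 'rV[R]_p) : dot 0 v = 0.
Proof. by rewrite /dot big1// => j _; rewrite mxE mul0r. Qed.

Lemma setT_halfspaces R p n (x : 'I_n -> 'rV[R]_p) :
  finset.setT \in halfspaces x.
Proof. by apply/halfspacesP; exists 1, 0 => i; rewrite inE dot0l addr0 ltr01. Qed.

Lemma open_halfspace R p n (x : 'I_n -> 'rV[R]_p) b u :
  [set i | 0 < b + dot u (x i)]%SET \in halfspaces x.
Proof. by apply/halfspacesP; exists b, u => i; rewrite inE. Qed.

(** Among finitely many points the negative values stay below some [- e], so raising the offset by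
    [e] makes the inequality strict without changing the trace. The default 1 of the minimum covers
    the absence of negative values. *)
Lemma closed_halfspace R p n (x : 'I_n -> 'rV[R]_p) b u :
  [set i | 0 <= b + dot u (x i)]%SET \in halfspaces x.
Proof.
pose g i := b + dot u (x i).
have [e e0 He] : exists2 e, 0 < e & forall i, g i < 0 -> e <= - g i.
  exists (\big[Num.min/1]_(i | g i < 0) - g i).
    by elim/big_ind : _ => // [a c a0 c0|i gi]; rewrite ?lt_min ?a0// oppr_gt0.
  by move=> i gi; rewrite (bigD1 i)//= ge_min lexx.
apply/halfspacesP; exists (b + e), u => i; rewrite inE addrAC -/(g i).
have [gi|gi] := leP 0 (g i); first by rewrite ltr_wpDl.
by apply/esym/negbTE; rewrite -leNgt; have := He i gi; rewrite lerNr -subr_le0 opprK.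
Qed.

(* Radon: the signs of an affine dependency of [p.+2] points form a pattern
   that no half-space cuts out. *)
Lemma halfspaces_vc R p n (x : 'I_n -> 'rV[R]_p) (D : {set 'I_n}) :
  shatters (halfspaces x) D -> (#|D| <= p.+1)%N.
Proof.
move=> /shattersP sh; rewrite leqNgt; apply/negP => ltD.
pose A : 'M[R]_(#|D|, 1 + p) := \matrix_(k, j) row_mx 1%:M (x (enum_val k)) 0 j.
have /rowV0Pn[v vK v0] : kermx A != 0.
  rewrite -mxrank_eq0 mxrank_ker subn_eq0 -ltnNge.
  exact: leq_ltn_trans (rank_leq_col A) ltD.
have lin (w : 'rV_#|D|) b u : (w <= kermx A)%MS ->
    \sum_k w 0 k * (b + dot u (x (enum_val k))) = 0.
  move=> /sub_kermxP wA.
  have c0 : \sum_k w 0 k = 0.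
    have /matrixP/(_ 0 (lshift p 0)) := wA; rewrite !mxE => e; rewrite -[RHS]e.
    by apply: eq_bigr => k _; rewrite mxE row_mxEl mxE eqxx mulr1.
  have cj j : \sum_k w 0 k * x (enum_val k) 0 j = 0.
    have /matrixP/(_ 0 (rshift 1 j)) := wA; rewrite !mxE => e; rewrite -[RHS]e.
    by apply: eq_bigr => k _; rewrite mxE row_mxEr.
  under eq_bigr do rewrite mulrDr; rewrite big_split /= -mulr_suml c0 mul0r add0r.
  under eq_bigr do rewrite /dot mulr_sumr; rewrite exchange_big /= big1// => j _.
  under eq_bigr do rewrite mulrCA; by rewrite -mulr_sumr cj mulr0.
have [w wK [k0 wk0]] : exists2 w : 'rV_#|D|, (w <= kermx A)%MS & exists k, 0 < w 0 k.
  have [k vk] : exists k, v 0 k != 0.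
    apply/existsP; apply: contraNT v0; rewrite negb_exists => /forallP v0.
    by apply/eqP/rowP => k; rewrite mxE; apply/eqP; have := v0 k; rewrite negbK.
  have [|vk'|e] := ltgtP (v 0 k) 0.
  - by exists (- v); rewrite ?eqmx_opp//; exists k; rewrite mxE oppr_gt0.
  - by exists v => //; exists k.
  - by rewrite e eqxx in vk.
(* A half-space cutting out the points of positive coefficient would make every term of the
   dependency nonnegative and one of them positive, whereas the sum vanishes. *)
pose E := [set i in D | [exists k, (enum_val k == i) && (0 < w 0 k)]]%SET.
have [|C /halfspacesP[b [u Cu]] CE] := sh E.
  by apply/fintype.subsetP => i; rewrite inE => /andP[].
have Ck k : (0 < b + dot u (x (enum_val k))) = (0 < w 0 k).
  have /finset.setP/(_ (enum_val k)) := CE.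
  rewrite !inE enum_valP andbT Cu => ->; apply/existsP/idP => [[k' /andP[/eqP/enum_val_inj <-//]]|wk].
  by exists k; rewrite eqxx.
have := lin w b u wK; apply/eqP; rewrite gt_eqF// (bigD1 k0)//=.
apply: ltr_wpDr; last by rewrite mulr_gt0// Ck.
apply: sumr_ge0 => k _; have [wk|wk] := ltP 0 (w 0 k).
  by rewrite mulr_ge0 ?ltW// Ck.
by rewrite mulr_le0// leNgt Ck -leNgt.
Qed.

(** * Exponential moments of the noise given the covariates *)

(** Extension from indicators to nonnegative functions through simple functions and monotone
    convergence. Two measures are allowed because [mu] is [P] itself when independence is exploited,
    and Lebesgue measure weighted by a density in the Gaussian case. *)
Lemma integral_weight_comp (d d1 d2 : measure_display) (T : measurableType d)
    (T1 : measurableType d1) (U : measurableType d2) R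
    (P : {measure set T -> \bar R}) (mu : {measure set T1 -> \bar R})
    (h : T1 -> R) (Z1 : T1 -> U) (Z : T -> U) (c : R) (g : U -> R) :
  measurable_fun setT h -> (forall w, 0 <= h w) ->
  measurable_fun setT Z1 -> measurable_fun setT Z -> 0 <= c ->
  (forall B, measurable B ->
     (\int[mu]_w (h w * \1_B (Z1 w))%:E = c%:E * P (Z @^-1` B))%E) ->
  measurable_fun setT g -> (forall u, 0 <= g u) ->
  (\int[mu]_w (h w * g (Z1 w))%:E = c%:E * \int[P]_w (g (Z w))%:E)%E.
Proof.
move=> mh h0 mZ1 mZ c0 hB mg g0.
have mg' : measurable_fun setT (EFin \o g) by exact/measurable_EFinP.
pose f := nnsfun_approx measurableT mg'.
have fg u : EFin \o f^~ u @ \oo --> (g u)%:E.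
  by apply: cvg_nnsfun_approx => // t _; rewrite lee_fin.
have mfZ n : measurable_fun setT (f n \o Z) by exact: measurableT_comp.
have mfZ1 n : measurable_fun setT (f n \o Z1) by exact: measurableT_comp.
have ndf u m n : (m <= n)%N -> f m u <= f n u.
  by move=> mn; apply/lefP/nd_nnsfun_approx.
transitivity (limn (fun n => \int[mu]_w (h w * f n (Z1 w))%:E)%E).
  rewrite -monotone_convergence//.
  - apply: eq_integral => w _; apply/esym/cvg_lim => //.
    rewrite EFinM; under eq_fun do rewrite EFinM.
    apply: cvgeZl => //.
    exact: fg.
  - move=> n; apply/measurable_EFinP/measurable_funM => //; exact: mfZ1.
  - by move=> n w _; rewrite lee_fin mulr_ge0.
  - by move=> w _ m n mn; rewrite lee_fin ler_wpM2l// ndf.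
transitivity (limn (fun n => c%:E * \int[P]_w (f n (Z w))%:E)%E); last first.
  apply/cvg_lim => //; apply: cvgeZl => //.
  have -> : (\int[P]_w (g (Z w))%:E = \int[P]_w limn (fun n => (f n (Z w))%:E))%E.
    by apply: eq_integral => w _; apply/esym/cvg_lim => //; exact: fg.
  apply: cvg_monotone_convergence => //.
  - move=> n; apply/measurable_EFinP; exact: mfZ.
  - by move=> n w _; rewrite lee_fin.
  - by move=> w _ m n mn; rewrite lee_fin ndf.
congr (limn _); apply/funext => n.
have mfr r : measurable (f n @^-1` [set r]) by [].
have mi r : measurable_fun setT (fun w => \1_(f n @^-1` [set r]) (Z w) : R).
  by apply: (measurableT_comp _ mZ); apply: measurable_indic.
have mi1 r : measurable_fun setT (fun w => \1_(f n @^-1` [set r]) (Z1 w) : R).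
  by apply: (measurableT_comp _ mZ1); apply: measurable_indic.
transitivity (\sum_(r \in range (f n))
    \int[mu]_w (r * (h w * \1_(f n @^-1` [set r]) (Z1 w)))%:E)%E.
  under eq_integral => w _.
    rewrite fimfunE mulrC mulr_fsuml//.
    under eq_fsbigr do rewrite -mulrA [X in _ * X]mulrC.
    rewrite -fsumEFin//; over.
  rewrite ge0_integral_fsum//.
  - by move=> r; apply/measurable_EFinP/measurable_funM => //; apply: measurable_funM.
  - move=> r w _; rewrite lee_fin mulrCA mulr_ge0//.
    by have := nnfun_muleindic_ge0 (f n) r (Z1 w); rewrite lee_fin.
transitivity (\sum_(r \in range (f n))
    c%:E * \int[P]_w (r * \1_(f n @^-1` [set r]) (Z w))%:E)%E; last first.
  rewrite -ge0_mule_fsumr; last first.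
    move=> r; apply: integral_ge0 => w _.
    by have := nnfun_muleindic_ge0 (f n) r (Z w).
  congr (_ * _)%E; rewrite -ge0_integral_fsum//.
  - by apply: eq_integral => w _; rewrite fsumEFin// -fimfunE.
  - by move=> r; apply/measurable_EFinP/measurable_funM.
  - by move=> r w _; have := nnfun_muleindic_ge0 (f n) r (Z w).
apply: eq_fsbigr => r /[!inE] -[u _ <-{r}].
have fu0 : 0 <= f n u by [].
under eq_integral do rewrite EFinM; under [in RHS]eq_integral do rewrite EFinM.
rewrite ge0_integralZl_EFin//; first last.
- by apply/measurable_EFinP/measurable_funM.
- by move=> w _; rewrite lee_fin mulr_ge0.
rewrite ge0_integralZl_EFin//; first last.
- by apply/measurable_EFinP.
rewrite hB// muleCA; congr (_ * (_ * _))%E.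
have mZf : measurable (Z @^-1` (f n @^-1` [set f n u])) by rewrite -[X in measurable X]setTI; apply: mZ.
by rewrite (integral_indic P measurableT mZf) setIT.
Qed.

(** Independence is known on indicators. The functions are substituted one factor at a time while
    the others remain indicators, hence the mixed statement with a second list [s'] in the
    induction. *)
Lemma integral_prod_independent (d d' : measure_display) (T : measurableType d)
    (U : measurableType d') R (P : probability T R) (I : eqType)
    (h : T -> R) (Z : I -> T -> U) (c : R) (g : I -> U -> R) (e : I -> R) :
  measurable_fun setT h -> (forall w, 0 <= h w) -> 0 <= c ->
  (forall i, measurable_fun setT (Z i)) ->
  (forall (s : seq I) (B : I -> set U), uniq s -> (forall i, measurable (B i)) ->
     (\int[P]_w (h w * \prod_(i <- s) \1_(B i) (Z i w))%:E
       = (c * \prod_(i <- s) fine (P (Z i @^-1` B i)))%:E)%E) ->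
  (forall i, measurable_fun setT (g i)) -> (forall i u, 0 <= g i u) ->
  (forall i, \int[P]_w (g i (Z i w))%:E = (e i)%:E)%E ->
  forall s : seq I, uniq s ->
  (\int[P]_w (h w * \prod_(i <- s) g i (Z i w))%:E = (c * \prod_(i <- s) e i)%:E)%E.
Proof.
move=> mh h0 c0 mZ hB mg g0 ge s us.
have e0 i : 0 <= e i.
  by rewrite -lee_fin -ge; apply: integral_ge0 => w _; rewrite lee_fin.
have mind i (B : set U) : measurable B -> measurable_fun setT (fun w => \1_B (Z i w) : R).
  by move=> mB; apply: (measurableT_comp _ (mZ i)); apply: measurable_indic.
suff H (s' : seq I) (B : I -> set U) : uniq (s ++ s') -> (forall i, measurable (B i)) ->
     (\int[P]_w (h w * \prod_(i <- s) g i (Z i w) * \prod_(i <- s') \1_(B i) (Z i w))%:E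
       = (c * \prod_(i <- s) e i * \prod_(i <- s') fine (P (Z i @^-1` B i)))%:E)%E.
  have := H [::] (fun=> setT); rewrite cats0 => /(_ us (fun=> measurableT)).
  by rewrite big_nil mulr1 => <-; apply: eq_integral => w _; rewrite big_nil mulr1.
elim: s us s' B => [|i s IH] /= us s' B us' mB.
  rewrite big_nil mulr1 -hB//; apply: eq_integral => w _; by rewrite big_nil mulr1.
move/andP: us => [_ us].
pose h' w := h w * \prod_(i <- s) g i (Z i w) * \prod_(i <- s') \1_(B i) (Z i w).
pose c' := c * \prod_(i <- s) e i * \prod_(i <- s') fine (P (Z i @^-1` B i)).
transitivity (\int[P]_w (h' w * g i (Z i w))%:E)%E.
  by apply: eq_integral => w _; rewrite big_cons /h'; congr (_%:E); ring.
have mgZ j : measurable_fun setT (fun w => g j (Z j w)) by apply: measurableT_comp.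
rewrite (@integral_weight_comp _ _ _ _ _ _ _ P P h' (Z i) (Z i) c')//.
- by rewrite ge -EFinM big_cons /c'; congr (_%:E); ring.
- apply: measurable_funM; first by apply: measurable_funM => //; apply: measurable_prod.
  by apply: measurable_prod => j _; apply: mind.
- by move=> w; rewrite !mulr_ge0 ?prodr_ge0.
- by rewrite /c' !mulr_ge0 ?prodr_ge0// => j _; rewrite fine_ge0.
move=> C mC; pose B' j := if j == i then C else B j.
have mB' j : measurable (B' j) by rewrite /B'; case: ifP.
have iNs' : forall j, j \in s' -> (j == i) = false.
  move=> j js'; apply/negbTE/negP => /eqP ji; move: us'.
  by rewrite cat_uniq mem_cat -ji js' orbT.
have us'' : uniq (s ++ i :: s').
  by rewrite -[i :: s']cat1s uniq_catCA.
transitivity (\int[P]_w (h w * \prod_(i <- s) g i (Z i w) *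
    \prod_(i <- i :: s') \1_(B' i) (Z i w))%:E)%E.
  apply: eq_integral => w _; rewrite big_cons /B' eqxx /h'; congr (_%:E).
  have -> : \prod_(j <- s') \1_(if j == i then C else B j) (Z j w)
      = \prod_(j <- s') \1_(B j) (Z j w) :> R.
    by apply: eq_big_seq => j js'; rewrite (iNs' j js').
  ring.
rewrite IH// big_cons /B' eqxx.
have -> : \prod_(j <- s') fine (P (Z j @^-1` (if j == i then C else B j)))
    = \prod_(j <- s') fine (P (Z j @^-1` B j)).
  by apply: eq_big_seq => j js'; rewrite (iNs' j js').
have fP : P (Z i @^-1` C) \is a fin_num.
  by rewrite fin_num_measure// -[X in measurable X]setTI; apply: mZ.
by rewrite -[RHS]/(c'%:E * P (Z i @^-1` C))%E -[in RHS](fineK fP) -EFinM /c'; congr (_%:E) => /=; ring.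
Qed.

(** A pi-system generating the sigma-algebra of the first [n] covariates. Statements about all
    events of that sigma-algebra take the place of conditional expectations given the covariates. *)
Definition rectangles (T U : Type) (mU : set (set U)) (X : nat -> T -> U) (n : nat) :
    set (set T) :=
  [set A | exists2 B : nat -> set U, forall i, mU (B i) & A = \bigcap_(i in `I_n) X i @^-1` B i].

Lemma integral_pi_system (d : measure_display) (T : measurableType d) R
    (P : probability T R) (G : set (set T)) (W : T -> R) (c : R) :
  setI_closed G -> G `<=` measurable -> measurable_fun setT W -> (forall w, 0 <= W w) ->
  (\int[P]_w (W w)%:E = c%:E)%E ->
  (forall A, G A -> \int[P]_(w in A) (W w)%:E = c%:E * P A)%E ->
  forall A, <<s G >> A -> (\int[P]_(w in A) (W w)%:E = c%:E * P A)%E.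
Proof.
move=> GI Gm mW W0 Wc GW.
have c0 : 0 <= c by rewrite -lee_fin -Wc; apply: integral_ge0 => w _; rewrite lee_fin.
have mWD D : measurable_fun D (fun w => (W w)%:E).
  by apply/measurable_EFinP; apply: measurable_funS mW.
have sGm := smallest_sub (@sigma_algebra_measurable _ T) Gm.
apply: (@dynkin_induction _ (g_sigma_algebraType G) G) => //=.
- by rewrite Wc probability_setT mule1.
- move=> A mA HA; have mA' := sGm _ mA.
  have : (\int[P]_(w in A `|` ~` A) (W w)%:E = c%:E)%E by rewrite setUv.
  rewrite ge0_integral_setU//; last 3 first.
  + exact: measurableC.
  + by move=> w _; rewrite lee_fin.
  + by rewrite disj_set2E setICr eqxx.
  rewrite HA probability_setC//.
  have pA : P A \is a fin_num by rewrite fin_num_measure.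
  have : (c%:E * P A)%E \is a fin_num by rewrite fin_numM.
  rewrite -(fineK pA) -EFinM => _; case: (integral _ _ _) => [r| |]//= [] e.
  by rewrite -EFinB -EFinM; congr (_%:E); lra.
- move=> F mF tF HF; have mF' n : @measurable d T (F n) by exact: sGm (mF n).
  rewrite ge0_integral_bigcup//; last by move=> w _; rewrite lee_fin.
  rewrite measure_bigcup//.
  have -> : (\sum_(i <oo | i \in [set: nat]) P (F i) = \sum_(i <oo) P (F i))%E.
    by apply: eq_eseriesl => i; exact/mem_set.
  rewrite -nneseriesZl//; apply: eq_eseriesr => i _; exact: HF.
Qed.

Lemma prod_indic (T U : Type) R (I : eqType) (s : seq I) (Z : I -> T -> U)
    (B : I -> set U) (w : T) :
  \prod_(i <- s) \1_(B i) (Z i w) = \1_(\bigcap_(i in [set` s]) Z i @^-1` B i) w :> R.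
Proof.
rewrite [RHS]indicE; have [/set_mem H|] := boolP (w \in _).
  by rewrite big_seq big1// => i si; rewrite indicE mem_set//; exact: H.
move=> /negP H; apply/eqP; rewrite prodf_seq_eq0; apply: contra_notT H => /hasPn H.
apply/mem_set => i /= si; have := H i si; rewrite /= indicE.
by case: (boolP (Z i w \in B i)) => [/set_mem//|]; rewrite eqxx.
Qed.

Lemma integral_prod_indic (d d' : measure_display) (T : measurableType d)
    (U : measurableType d') R (P : probability T R) (I : eqType)
    (A : set T) (s : seq I) (Z : I -> T -> U) (B : I -> set U) :
  measurable A -> (forall i, measurable_fun setT (Z i)) -> (forall i, measurable (B i)) ->
  (\int[P]_w (\1_A w * \prod_(i <- s) \1_(B i) (Z i w) : R)%:E
    = P (A `&` \bigcap_(i in [set` s]) Z i @^-1` B i))%E.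
Proof.
move=> mA mZ mB; have mZB i : measurable (Z i @^-1` B i).
  by rewrite -[X in measurable X]setTI; apply: mZ.
have mI : measurable (\bigcap_(i in [set` s]) Z i @^-1` B i).
  by apply: fin_bigcap_measurable => // i _; exact: mZB.
under eq_integral do rewrite prod_indic -[_ * _]/((\1_A \* \1__) _) -indicI.
by rewrite integral_indic// ?setIT//; exact: measurableI.
Qed.

Lemma rectangles_setI_closed (T U : Type) (mU : set (set U)) (X : nat -> T -> U) (n : nat) :
  setI_closed mU -> setI_closed (rectangles mU X n).
Proof.
move=> mUI _ _ [B1 mB1 ->] [B2 mB2 ->]; exists (fun i => B1 i `&` B2 i).
  by move=> i; apply: mUI.
by rewrite -bigcapI.
Qed.

Lemma rectangles_measurable (d d' : measure_display) (T : measurableType d)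
    (U : measurableType d') (X : nat -> T -> U) (n : nat) :
  (forall i, measurable_fun setT (X i)) -> rectangles measurable X n `<=` measurable.
Proof.
move=> mX _ [B mB ->]; apply: fin_bigcap_measurable => // i _.
by rewrite -[X in measurable X]setTI; apply: mX.
Qed.

Lemma prod_fine R (I : eqType) (s : seq I) (f : I -> \bar R) :
  (forall i, f i \is a fin_num) -> (\prod_(i <- s) f i = (\prod_(i <- s) fine (f i))%:E)%E.
Proof.
move=> ff; elim: s => [|i s IH]; first by rewrite !big_nil.
by rewrite !big_cons IH EFinM fineK.
Qed.

Lemma mutually_independent_prod (d d' : measure_display) (T : measurableType d)
    (U : measurableType d') R (P : probability T R) (I : eqType)
    (Z : I -> T -> U) (s : seq I) (B : I -> set U) :
  mutually_independent P (fun i => g_sigma_algebra_preimage (Z i)) ->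
  (forall i, measurable_fun setT (Z i)) -> uniq s -> (forall i, measurable (B i)) ->
  P (\bigcap_(i in [set` s]) Z i @^-1` B i) = (\prod_(i <- s) fine (P (Z i @^-1` B i)))%:E.
Proof.
move=> ind mZ us mB; rewrite ind//; last first.
  by move=> i _; exists (B i) => //; rewrite setTI.
rewrite prod_fine// => i; rewrite fin_num_measure//.
by rewrite -[X in measurable X]setTI; apply: mZ.
Qed.

Lemma preimage_pair (T U V : Type) (f : T -> U) (g : T -> V) (A : set U) (B : set V) :
  (fun w => (f w, g w)) @^-1` (A `*` B) = f @^-1` A `&` g @^-1` B.
Proof. by []. Qed.

(** When [G] has constant conditional mean [c] given the covariate, each index of [C] contributes a
    factor [c] over a rectangle, by independence; Dynkin's argument then reaches all covariate
    events. *)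
Lemma integral_prod_iid (d d1 d2 : measure_display) (T : measurableType d)
    (U : measurableType d1) (V : measurableType d2) R (P : probability T R)
    (X : nat -> T -> U) (Y : nat -> T -> V) (G : U * V -> R) (c : R) :
  (forall i, measurable_fun setT (X i)) -> (forall i, measurable_fun setT (Y i)) ->
  iid P (fun i w => (X i w, Y i w)) ->
  measurable_fun setT G -> (forall z, 0 <= G z) ->
  (forall B, measurable B ->
     \int[P]_(w in X 0%N @^-1` B) (G (X 0%N w, Y 0%N w))%:E = c%:E * P (X 0%N @^-1` B))%E ->
  forall n (C : {set 'I_n}) A, <<s rectangles measurable X n >> A ->
  (\int[P]_(w in A) (\prod_(i in C) G (X i w, Y i w))%:E = (c ^+ #|C|)%:E * P A)%E.
Proof.
move=> mX mY [ind idd] mG G0 Gc n C.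
pose Z i w := (X i w, Y i w).
have mZ i : measurable_fun setT (Z i) by exact: measurable_fun_pair.
have mXB i B : measurable B -> measurable (X i @^-1` B).
  by move=> mB; rewrite -[X in measurable X]setTI; apply: mX.
have fB i B : measurable B -> P (X i @^-1` B) \is a fin_num.
  by move=> mB; rewrite fin_num_measure//; apply: mXB.
(* The hypothesis concerns index 0 only; it is carried to the other indices through the common law
   of the pairs. *)
have GcN i B : measurable B ->
    (\int[P]_w (\1_B (X i w) * G (Z i w))%:E = (c * fine (P (X i @^-1` B)))%:E)%E.
  move=> mB; pose F (z : U * V) := \1_B z.1 * G z.
  have mF : measurable_fun setT (fun z => (F z)%:E).
    apply/measurable_EFinP; apply: measurable_funM => //.
    by apply: (measurableT_comp _ measurable_fst); apply: measurable_indic.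
  have push j : (\int[P]_w (F (Z j w))%:E = \int[pushforward P (Z j)]_z (F z)%:E)%E.
    rewrite ge0_integral_pushforward// => z _; rewrite lee_fin /F mulr_ge0//.
  have eP : (\int[pushforward P (Z i)]_z (F z)%:E = \int[pushforward P (Z 0%N)]_z (F z)%:E)%E.
    by apply: eq_measure_integral => // A mA _; apply: idd.
  rewrite -[LHS]/(\int[P]_w (F (Z i w))%:E)%E push eP -push.
  rewrite EFinM fineK ?fB//.
  have -> : P (X i @^-1` B) = P (X 0%N @^-1` B).
    by have := idd i 0%N (B `*` setT) ltac:(exact: measurableX); rewrite !preimage_pair !preimage_setT !setIT.
  rewrite -Gc// [RHS]integral_mkcond; apply: eq_integral => w _.
  rewrite /F /patch /= indicE; have [wB|wB] := boolP (w \in _).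
    by rewrite (_ : X 0%N w \in B) ?mul1r//; apply/mem_set; exact: (set_mem wB).
  rewrite (_ : X 0%N w \in B = false) ?mul0r//; apply/negbTE; apply: contra wB.
  by move=> /set_mem wB; apply/mem_set.
have c0 : 0 <= c.
  have := GcN 0%N setT measurableT; rewrite preimage_setT probability_setT mulr1 => e.
  by rewrite -lee_fin -e; apply: integral_ge0 => w _; rewrite lee_fin mulr_ge0.
pose C' : pred nat := fun i => i \in [seq val j | j <- enum C].
have C'E (i : 'I_n) : C' i = (i \in C).
  by rewrite /C' (mem_map val_inj) mem_enum.
pose s := [seq val j | j <- enum 'I_n].
have us : uniq s by rewrite (map_inj_uniq val_inj) enum_uniq.
have sE : [set` s] = `I_n.
  apply/seteqP; split=> i /=; first by case/mapP => j _ ->; exact: ltn_ord.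
  by move=> ltin; apply/mapP; exists (Ordinal ltin); rewrite ?mem_enum.
have rectE (B : nat -> set U) : (forall i, measurable (B i)) ->
  (\int[P]_w (\prod_(i <- s) (\1_(B i) (X i w) * (if C' i then G (Z i w) else 1)))%:E =
    (\prod_(i <- s) (fine (P (X i @^-1` B i)) * (if C' i then c else 1)))%:E)%E.
  move=> mB.
  have mB1 i : measurable_fun setT (fun z : U * V => \1_(B i) z.1 : R).
    by apply: (measurableT_comp _ measurable_fst); apply: measurable_indic.
  transitivity (\int[P]_w (\1_setT w * \prod_(i <- s)
      ((fun z => \1_(B i) z.1 * (if C' i then G z else 1)) (Z i w)))%:E)%E.
    by apply: eq_integral => w _; rewrite indicT mul1r.
  rewrite (@integral_prod_independent _ _ _ _ _ P _ _ Z 1 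
    (fun i z => \1_(B i) z.1 * (if C' i then G z else 1))
    (fun i => (fine (P (X i @^-1` B i)) * (if C' i then c else 1)))) ?mul1r//.
  - move=> s' B' us' mB'; rewrite mul1r integral_prod_indic// setTI.
    exact: mutually_independent_prod.
  - by move=> i; apply: measurable_funM => //; case: (C' i).
  - by move=> i u; rewrite mulr_ge0//; case: (C' i).
  move=> i; case: (C' i); first by rewrite GcN// mulrC.
  under eq_integral do rewrite mulr1 -[\1_(B i) _]/((\1_(X i @^-1` B i) : T -> R) _).
  by rewrite integral_indic// ?setIT ?mulr1 ?fineK ?fB//; apply: mXB.
have prodC (w : T) : \prod_(i in C) G (X i w, Y i w) =
    \prod_(i <- s) (if C' i then G (Z i w) else 1).
  by rewrite big_map big_enum /= big_mkcond /=; apply: eq_bigr => i _; rewrite C'E.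
have prodc : \prod_(i <- s) (if C' i then c else 1) = c ^+ #|C|.
  rewrite big_map big_enum /= -prodr_const [RHS]big_mkcond /=.
  by apply: eq_bigr => i _; rewrite C'E.
apply: integral_pi_system.
- by apply: rectangles_setI_closed => A1 A2; apply: measurableI.
- exact: rectangles_measurable.
- rewrite (funext prodC); apply: measurable_prod => i _; case: (C' i) => //.
  exact: (measurableT_comp mG (mZ i)).
- by move=> w; rewrite prodr_ge0.
- transitivity (\int[P]_w (\prod_(i <- s) (\1_setT (X i w) * (if C' i then G (Z i w) else 1)))%:E)%E.
    by apply: eq_integral => w _; rewrite prodC; under [in RHS]eq_bigr do rewrite indicT mul1r.
  rewrite rectE//; under eq_bigr do rewrite preimage_setT probability_setT mul1r.
  by rewrite prodc.
move=> _ [B mB ->].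
rewrite integral_mkcond.
transitivity (\int[P]_w (\prod_(i <- s) (\1_(B i) (X i w) * (if C' i then G (Z i w) else 1)))%:E)%E.
  apply: eq_integral => w _; rewrite big_split /= prod_indic sE -prodC /patch indicE.
  by case: (w \in _); rewrite ?mul1r ?mul0r.
rewrite rectE// big_split /= prodc mulrC EFinM; congr (_ * _)%E.
have := @mutually_independent_prod _ _ _ _ _ P _ Z s (fun i => B i `*` setT) ind mZ us.
rewrite sE => e; rewrite (_ : \bigcap_(i in `I_n) _ = \bigcap_(i in `I_n) Z i @^-1` (B i `*` setT)).
  rewrite e; last by move=> i; apply: measurableX.
  by congr (_%:E); apply: eq_bigr => i _; rewrite preimage_pair preimage_setT setIT.
by apply: eq_bigcapr => i _; rewrite preimage_pair preimage_setT setIT.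
Qed.

(** A sub-exponential bound with variance factor [v] and radius [s0], conditional on the covariates
    in integrated form. *)
Definition conditional_mgf_bound (d d' : measure_display) (T : measurableType d)
    (U : measurableType d') R (P : probability T R)
    (X : nat -> T -> U) (zeta : nat -> T -> R) (s0 v : R) : Prop :=
  forall n (C : {set 'I_n}) A s, <<s rectangles measurable X n >> A -> `|s| <= s0 ->
  (\int[P]_(w in A) (expR (s * \sum_(i in C) zeta i w))%:E
    <= (expR (v * s ^+ 2 * #|C|%:R))%:E * P A)%E.

Lemma integral_prod_given (d d' : measure_display) (T : measurableType d)
    (V : measurableType d') R (P : probability T R)
    (zeta : nat -> T -> V) (A : set T) (g : V -> R) (e : R) :
  measurable A -> (forall i, measurable_fun setT (zeta i)) ->
  (forall (s : seq nat) (B : nat -> set V), uniq s -> (forall i, measurable (B i)) ->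
    P (A `&` \bigcap_(i in [set` s]) zeta i @^-1` B i)
      = (P A * (\prod_(i <- s) fine (P (zeta i @^-1` B i)))%:E)%E) ->
  measurable_fun setT g -> (forall z, 0 <= g z) ->
  (forall i, \int[P]_w (g (zeta i w))%:E = e%:E)%E ->
  forall n (C : {set 'I_n}),
  (\int[P]_(w in A) (\prod_(i in C) g (zeta i w))%:E = (e ^+ #|C|)%:E * P A)%E.
Proof.
move=> mA mz ind mg g0 ge n C; pose s := [seq val j | j <- enum C].
have us : uniq s by rewrite (map_inj_uniq val_inj) enum_uniq.
have pA : P A \is a fin_num by rewrite fin_num_measure.
transitivity (\int[P]_w (\1_A w * \prod_(i <- s) g (zeta i w))%:E)%E.
  rewrite integral_mkcond; apply: eq_integral => w _.
  rewrite big_map big_enum /patch indicE.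
  by case: (w \in A); rewrite ?mul1r ?mul0r.
rewrite (@integral_prod_independent _ _ _ _ _ P _ _ zeta (fine (P A)) (fun=> g) (fun=> e))//.
- by rewrite big_map big_enum /= prodr_const EFinM fineK// muleC.
- by rewrite fine_ge0.
by move=> s' B us' mB; rewrite integral_prod_indic// ind// EFinM fineK.
Qed.

Lemma tail_le_mgf (d : measure_display) (T : measurableType d) R
    (P : probability T R) (A : set T) (S : T -> R) (s u : R) :
  measurable A -> measurable_fun setT S -> 0 <= s ->
  (P (A `&` [set w | (u < S w)%R]) <= (expR (- (s * u)))%:E *
    \int[P]_(w in A) (expR (s * S w))%:E)%E.
Proof.
move=> mA mS s0; set E := [set w | _].
have mE : measurable E.
  rewrite (_ : E = S @^-1` `]u, +oo[); first by rewrite -[X in measurable X]setTI; apply: mS.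
  by apply/seteqP; split=> w /=; rewrite in_itv /= andbT.
have mexp D : measurable_fun D (fun w => (expR (s * S w))%:E).
  apply/measurable_EFinP; apply: measurable_funS measurableT _ _ => //.
  by apply: measurableT_comp => //; apply: measurable_funM.
apply: (@le_trans _ _ (\int[P]_(w in A `&` E) ((expR (- (s * u)))%:E * (expR (s * S w))%:E))%E).
  rewrite -[leLHS]mul1e -integral_cst; last exact: measurableI.
  apply: ge0_le_integral => //; first exact: measurableI.
  - by apply: emeasurable_funM => //; exact: measurable_cst.
  move=> w [_ /= uS]; rewrite -EFinM -expRD lee_fin -expR0 ler_expR.
  by rewrite addrC -mulrBr mulr_ge0// subr_ge0 ltW.
have mAE := measurableI _ _ mA mE.
rewrite ge0_integralZl_EFin ?expR_ge0//.
apply: lee_wpmul2l; first by rewrite lee_fin expR_ge0.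
exact: ge0_subset_integral.
Qed.

Lemma noise_tail (d d' : measure_display) (T : measurableType d)
    (U : measurableType d') R (P : probability T R)
    (X : nat -> T -> U) (zeta : nat -> T -> R) (s0 v : R) :
  (forall i, measurable_fun setT (X i)) -> (forall i, measurable_fun setT (zeta i)) ->
  0 <= s0 -> 0 <= v -> conditional_mgf_bound P X zeta s0 v ->
  forall n (C : {set 'I_n}) A N H, <<s rectangles measurable X n >> A ->
    #|C|%:R <= N -> 0 < H -> H <= s0 ^+ 2 * N ->
  (P (A `&` [set w | (1 + v) * Num.sqrt (H * N) < `|\sum_(i in C) zeta i w|]%R)
    <= (2 * expR (- H))%:E * P A)%E.
Proof.
move=> mX mz s00 v0 mgf n C A N H sA CN H0 HN.
have mA : measurable A.
  by apply: (smallest_sub (@sigma_algebra_measurable _ T)) sA; exact: rectangles_measurable.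
have N0 : 0 < N.
  rewrite lt_neqAle (le_trans _ CN)// andbT; apply/eqP => N0.
  by move: HN; rewrite -N0 mulr0 leNgt H0.
(* Chernoff's bound at this [s] has exponent [- (1 + v) H], of which the exponential moment gives
   back at most [v H]. The condition [H <= s0 ^+ 2 * N] keeps [s] within the radius. *)
pose s := Num.sqrt (H / N).
have ss : s ^+ 2 = H / N by rewrite sqr_sqrtr// divr_ge0 ?ltW.
have s_ge0 : 0 <= s by rewrite sqrtr_ge0.
have s_le : s <= s0.
  by rewrite -(ger0_norm s00) -sqrtr_sqr ler_wsqrtr// ler_pdivrMr.
have su : s * ((1 + v) * Num.sqrt (H * N)) = (1 + v) * H.
  rewrite mulrCA /s -sqrtrM ?divr_ge0 ?ltW// (_ : H / N * (H * N) = H ^+ 2); last by field; rewrite gt_eqF.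
  by rewrite sqrtr_sqr ger0_norm// ltW.
pose S w := \sum_(i in C) zeta i w.
have mS : measurable_fun setT S.
  rewrite /S; under eq_fun do rewrite -big_enum /=.
  exact: measurable_sum.
set u := (1 + v) * _ in su *.
have one (sg : R) : `|sg| = 1 ->
    (P (A `&` [set w | (u < sg * S w)%R]) <= (expR (- H))%:E * P A)%E.
  move=> sg1; have mSg : measurable_fun setT (fun w => sg * S w) by exact: measurable_funM.
  apply: le_trans (tail_le_mgf P u mA mSg s_ge0) _.
  rewrite su; under eq_integral do rewrite mulrA.
  have sgs : `|s * sg| <= s0 by rewrite normrM sg1 mulr1 ger0_norm.
  apply: (@le_trans _ _ ((expR (- ((1 + v) * H)))%:E * ((expR (v * (s * sg) ^+ 2 * #|C|%:R))%:E * P A))%E).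
    by apply: lee_wpmul2l; [rewrite lee_fin expR_ge0|exact: mgf].
  rewrite muleA -EFinM -expRD; apply: lee_wpmul2r => //.
  rewrite lee_fin ler_expR exprMn -[sg ^+ 2]ger0_norm ?sqr_ge0// normrX sg1 expr1n mulr1 ss.
  have : v * (H / N) * #|C|%:R <= v * H.
    by rewrite -mulrA ler_wpM2l// -mulrA ler_piMr ?(ltW H0)// ler_pdivrMl ?mulr1.
  lra.
apply: (@le_trans _ _ (P (A `&` [set w | (u < 1 * S w)%R]) + P (A `&` [set w | (u < -1 * S w)%R]))%E).
  have mE (sg : R) : measurable [set w | u < sg * S w].
    rewrite (_ : mkset _ = (fun w => sg * S w) @^-1` `]u, +oo[).
      by rewrite -[X in measurable X]setTI; apply: measurable_funM.
    by apply/seteqP; split=> w /=; rewrite in_itv /= andbT.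
  apply: (@le_trans _ _ (P ((A `&` [set w | (u < 1 * S w)%R]) `|` (A `&` [set w | (u < -1 * S w)%R])))).
    apply: le_measure; rewrite ?inE.
    - apply: measurableI => //.
      rewrite (_ : mkset _ = (fun w => `|S w|) @^-1` `]u, +oo[).
        by rewrite -[X in measurable X]setTI; apply: measurableT_comp.
      by apply/seteqP; split=> w /=; rewrite in_itv /= andbT.
    - by apply: measurableU; apply: measurableI.
    by move=> w [Aw /=]; rewrite real_lter_normr ?num_real// => /orP[]; [left|right]; split=> //=; rewrite ?mul1r ?mulN1r.
  by apply: measureU2; apply: measurableI.
rewrite mulr_natl mulr2n EFinD muleDl ?fin_num_measure//.
by apply: leeD; apply: one; rewrite ?normrN normr1.
Qed.

Lemma expR_le_quadratic R (t : R) : expR t <= 1 + t + t ^+ 2 * expR `|t|.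
Proof.
have [t0|t0] := leP 0 t.
  have e1 : expR t <= 1 + t * expR t.
    have : (1 - t) * expR t <= 1.
      by have := ler_wpM2r (expR_ge0 t) (expR_ge1Dx (- t)); rewrite -expRD addNr expR0.
    by rewrite mulrBl mul1r; lra.
  rewrite ger0_norm//; apply: (le_trans e1).
  by have := ler_wpM2l t0 e1; rewrite mulrDr mulr1 mulrA -expr2; lra.
suff H (a : R) : 0 < a -> expR (- a) <= 1 - a + a ^+ 2 * expR a.
  by have := H (- t); rewrite opprK sqrrN oppr_gt0 ltr0_norm//; exact.
move=> a0; have ha := expR_ge1Dx a.
have e2 : expR (- a) <= (1 + a)^-1.
  by rewrite expRN lef_pV2 ?posrE ?expR_gt0 ?addr_gt0.
apply: (le_trans e2); apply: (@le_trans _ _ (1 - a + a ^+ 2)).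
  rewrite -[leLHS]mul1r ler_pdivrMr ?addr_gt0//.
  by have : 0 <= a ^+ 3 := exprn_ge0 3 (ltW a0); nra.
have h1 : 1 <= expR a by lra.
by have := ler_wpM2l (sqr_ge0 a) h1; rewrite mulr1; lra.
Qed.

(** With [y = b |e| / 2], half of the exponent [b |e|] absorbs [exp |s e|] and the other half
    absorbs [e^2], since [y^2 <= 4 exp y]; hence the constant [16 / b^2]. The linear term is kept
    exact so that centering can cancel it. *)
Lemma expR_le_tilted R (b s e : R) : 0 < b -> `|s| <= b / 2 ->
  expR (s * e) <= 1 + s * e + s ^+ 2 * (16 / b ^+ 2) * expR (b * `|e|).
Proof.
move=> b0 sb; apply: (le_trans (expR_le_quadratic _)); rewrite lerD2l exprMn.
rewrite -[leLHS]mulrA -[leRHS]mulrA ler_wpM2l ?sqr_ge0// normrM.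
pose y := b / 2 * `|e|; have y0 : 0 <= y by rewrite mulr_ge0// divr_ge0// ltW.
have e1 : expR (`|s| * `|e|) <= expR y by rewrite ler_expR ler_wpM2r.
have e2 : e ^+ 2 <= 16 / b ^+ 2 * expR y.
  have : y ^+ 2 <= 4 * expR y.
    have h1 := expR_ge1Dx (y / 2); have h2 : 0 <= 1 + y / 2 by lra.
    have : expR y = expR (y / 2) ^+ 2 by rewrite -expRM_natl; congr expR; field.
    by move=> ->; nra.
  rewrite /y exprMn -(real_normK (num_real e)) => H.
  have -> : `|e| ^+ 2 = 4 / b ^+ 2 * ((b / 2) ^+ 2 * `|e| ^+ 2).
    by field; rewrite gt_eqF.
  have : 0 <= 4 / b ^+ 2 by rewrite divr_ge0 ?sqr_ge0.
  by move=> /ler_wpM2l/(_ _ _ H) /le_trans; apply; rewrite mulrA le_eqVlt; apply/orP; left; apply/eqP; field; rewrite gt_eqF.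
have -> : expR (b * `|e|) = expR y * expR y by rewrite -expRD; congr expR; rewrite /y; lra.
rewrite mulrA; apply: ler_pM => //; rewrite ?sqr_ge0 ?expR_ge0//.
Qed.

Lemma integral_affine_comb (d : measure_display) (T : measurableType d) R
    (P : probability T R) (D : set T) (a1 a2 : T -> R) (k s t : R) :
  measurable D -> P.-integrable D (EFin \o a1) -> P.-integrable D (EFin \o a2) ->
  (\int[P]_(w in D) (a1 w)%:E = 0)%E -> (\int[P]_(w in D) (a2 w)%:E = 0)%E ->
  (\int[P]_(w in D) (k + s * a1 w + t * a2 w)%:E = k%:E * P D)%E.
Proof.
move=> mD i1 i2 e1 e2.
have ik : P.-integrable D (EFin \o cst k).
  exact: finite_measure_integrable_cst.
have is1 : P.-integrable D (fun w => s%:E * (a1 w)%:E)%E by exact: integrableZl.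
have it2 : P.-integrable D (fun w => t%:E * (a2 w)%:E)%E by exact: integrableZl.
under eq_integral do rewrite !EFinD !EFinM.
rewrite integralD//=; last by apply: integrableD.
rewrite integralD//= !integralZl// e1 e2 !mule0 !adde0.
exact: integral_cst.
Qed.

Lemma closed_measurable_borelV R p (A : set 'rV[R]_p) :
  closed A -> measurable (A : set (borelV R p)).
Proof.
move=> cA; rewrite -[A]setCK; apply: measurableC.
by apply: sub_sigma_algebra; rewrite openC.
Qed.

Lemma compact_measurable_borelV R p (A : set 'rV[R]_p) :
  compact A -> measurable (A : set (borelV R p)).
Proof.
move=> cA; apply: closed_measurable_borelV; apply: compact_closed => //.
Qed.

(* [expR (s * e)] is dominated by an expression affine in [e] and
   [expR (b * `|e|)], whose integral over [X @^-1` B] is exactly a constant times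
   the probability, so that independence factorizes the product over [C]. *)
Lemma data_noise_mgf R p (d : measure_display) (T : measurableType d)
    (P : probability T R) (XX : set 'rV[R]_p) (f0 : 'rV[R]_p -> R)
    (X : nat -> {RV P >-> borelV R p}) (Y : nat -> {RV P >-> R}) (b c : R) (h : 'rV[R]_p -> R) :
  (forall i w, XX (X i w)) ->
  iid P (fun (i : nat) (w : T) => (X i w, Y i w) : (borelV R p * R)%type) ->
  compact XX -> is_cond_expectation P XX (X 0%N) (Y 0%N) f0 -> 0 < b ->
  is_cond_expectation P XX (X 0%N) (fun w => expR (b * `|Y 0%N w - f0 (X 0%N w)|)) h ->
  (forall v, XX v -> h v <= c) ->
  exists s0 v, [/\ 0 < s0, 0 <= v &
    conditional_mgf_bound P (fun i => X i : T -> borelV R p) (fun i w => Y i w - f0 (X i w)) s0 v].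
Proof.
move=> X_in XYiid cXX [iY mf0 if0 ef0] b0 [ie mh ih eh] hc.
have mXX := compact_measurable_borelV cXX.
pose c' := Num.max c 0; have c'0 : 0 <= c' by rewrite le_max lexx orbT.
pose kap := 16 / b ^+ 2; have kap0 : 0 <= kap by rewrite divr_ge0 ?sqr_ge0.
exists (b / 2), (kap * c'); split; [by rewrite divr_gt0|by rewrite mulr_ge0|].
move=> n C A s sA sb.
(* The functions are measurable on [XX] only; their extensions by 0 are measurable everywhere and
   agree with them along the covariates. *)
pose f1 : borelV R p -> R := f0 \_ XX; pose h1 : borelV R p -> R := h \_ XX.
have mf1 : measurable_fun setT f1 by apply/(measurable_restrictT _ mXX).
have mh1 : measurable_fun setT h1 by apply/(measurable_restrictT _ mXX).
have f1E i w : f1 (X i w) = f0 (X i w) by rewrite /f1 patchE mem_set.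
have h1E i w : h1 (X i w) = h (X i w) by rewrite /h1 patchE mem_set.
have h1c v : h1 v <= c'.
  rewrite /h1 patchE; case: ifPn => [/set_mem vX|_]; last by rewrite le_max lexx orbT.
  by rewrite le_max hc.
pose ep (z : borelV R p * R) := z.2 - f1 z.1.
(* The conditional mean [h1] is subtracted and its bound [c'] added: this can only increase the
   dominating expression, and both nonconstant terms then integrate to 0 over covariate events. *)
pose G (z : borelV R p * R) := (1 + s ^+ 2 * kap * c') + s * ep z
  + s ^+ 2 * kap * (expR (b * `|ep z|) - h1 z.1).
have GE z : expR (s * ep z) <= G z.
  apply: (le_trans (expR_le_tilted (ep z) b0 sb)); rewrite /G -/kap.
  have : 0 <= s ^+ 2 * kap * (c' - h1 z.1).
    by apply: mulr_ge0; rewrite ?subr_ge0//; apply: mulr_ge0 => //; apply: sqr_ge0.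
  by rewrite !mulrBr; lra.
have G0 z : 0 <= G z by apply: le_trans (GE z); exact: expR_ge0.
have mep : measurable_fun setT ep.
  apply: measurable_funB; first exact: measurable_snd.
  exact: (measurableT_comp mf1 measurable_fst).
have mG : measurable_fun setT G.
  apply: measurable_funD; last first.
    apply: measurable_funM => //; apply: measurable_funB; last exact: (measurableT_comp mh1 measurable_fst).
    apply: measurableT_comp => //; apply: measurable_funM => //.
    exact: (measurableT_comp _ mep).
  by apply: measurable_funD => //; apply: measurable_funM.
have mX i : measurable_fun setT (X i : T -> borelV R p) by [].
have mY i : measurable_fun setT (Y i : T -> R) by [].
pose c1 := 1 + s ^+ 2 * kap * c'.
have GB (B : set (borelV R p)) : measurable B ->
    (\int[P]_(w in X 0%N @^-1` B) (G (X 0%N w, Y 0%N w))%:E = c1%:E * P (X 0%N @^-1` B))%E.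
  move=> mB; have mXB : measurable (X 0%N @^-1` B).
    by rewrite -[Y in measurable Y]setTI; apply: mX.
  have iS (f : T -> R) : P.-integrable setT (EFin \o f) -> P.-integrable (X 0%N @^-1` B) (EFin \o f).
    by apply: integrableS.
  have fin (f : T -> R) : P.-integrable setT (EFin \o f) ->
      (\int[P]_(w in X 0%N @^-1` B) (f w)%:E)%E \is a fin_num.
    by move=> /iS; apply: integrable_fin_num.
  have sub0 (f g : T -> R) : P.-integrable setT (EFin \o f) -> P.-integrable setT (EFin \o g) ->
      (\int[P]_(w in X 0%N @^-1` B) (f w)%:E = \int[P]_(w in X 0%N @^-1` B) (g w)%:E)%E ->
      (\int[P]_(w in X 0%N @^-1` B) (f w - g w)%:E = 0)%E.
    move=> fi gi e; under eq_integral do rewrite EFinB.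
    by rewrite (integralB_EFin mXB (iS _ fi) (iS _ gi)) e subee// fin.
  transitivity (\int[P]_(w in X 0%N @^-1` B) (c1 + s * (Y 0%N w - f0 (X 0%N w)) +
      s ^+ 2 * kap * (expR (b * `|Y 0%N w - f0 (X 0%N w)|) - h (X 0%N w)))%:E)%E.
    by apply: eq_integral => w _; rewrite /G /ep /= f1E h1E.
  apply: integral_affine_comb => //.
  - exact: (integrableB mXB (iS _ iY) (iS _ if0)).
  - exact: (integrableB mXB (iS _ ie) (iS _ ih)).
  - by apply: sub0 => //; exact: ef0.
  - by apply: sub0 => //; exact: eh.
have c1e : c1 <= expR (s ^+ 2 * kap * c') by exact: expR_ge1Dx.
have c10 : 0 <= c1 by rewrite addr_ge0// mulr_ge0// mulr_ge0// sqr_ge0.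
have mA : measurable A.
  by apply: (smallest_sub (@sigma_algebra_measurable _ T)) sA; exact: rectangles_measurable.
have pE := integral_prod_iid mX mY XYiid mG G0 GB C sA.
apply: (@le_trans _ _ ((c1 ^+ #|C|)%:E * P A)%E); last first.
  apply: lee_wpmul2r => //; rewrite lee_fin.
  have -> : kap * c' * s ^+ 2 * #|C|%:R = #|C|%:R * (s ^+ 2 * kap * c') by ring.
  by rewrite expRM_natl; apply: lerXn2r; rewrite ?nnegrE ?expR_ge0.
rewrite -pE; apply: ge0_le_integral => //.
- apply/measurable_EFinP/measurableT_comp => //; apply: measurable_funM => //.
  under eq_fun do rewrite -big_enum /=; apply: measurable_sum => i.
  rewrite (_ : (fun w => _) = (fun w => ep (X i w, Y i w))).
    by apply: measurable_funTS; apply: (measurableT_comp mep); apply: measurable_fun_pair.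
  by apply/funext => w; rewrite /ep /= f1E.
- apply/measurable_EFinP; under eq_fun do rewrite -big_enum /=; apply: measurable_prod => i _.
  by apply: measurable_funTS; apply: (measurableT_comp mG); apply: measurable_fun_pair.
move=> w _; rewrite lee_fin mulr_sumr expR_sum; apply: ler_prod => i _.
by rewrite expR_ge0 -f1E; exact: (GE (X i w, Y i w)).
Qed.

Lemma normal_mgf R (d : measure_display) (T : measurableType d)
    (P : probability T R) (xi : {RV P >-> R}) (B s : R) :
  0 <= B -> (forall S, measurable S -> P (xi @^-1` S) = normal_law B S) ->
  (\int[P]_w (expR (s * xi w))%:E = (expR (B / 2 * s ^+ 2))%:E)%E.
Proof.
move=> B0 law; have mxi : measurable_fun setT xi by [].
have mg : measurable_fun setT (fun x : R => expR (s * x)).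
  by apply: measurableT_comp => //; apply: measurable_funM.
have [e|Bn0] := eqVneq B 0.
  have mge : measurable_fun setT (fun x : R => (expR (s * x))%:E) by apply/measurable_EFinP.
  have -> : (\int[P]_w (expR (s * xi w))%:E = \int[pushforward P xi]_x (expR (s * x))%:E)%E.
    by rewrite ge0_integral_pushforward// => x _; rewrite lee_fin expR_ge0.
  rewrite (@eq_measure_integral _ _ _ _ (\d_(0 : R))).
    by rewrite integral_dirac// diracT mul1e mulr0 e mul0r mul0r.
  by move=> A mA _; have := law A mA; rewrite /normal_law e eqxx.
pose sg := Num.sqrt B; have sg0 : sg != 0 by rewrite gt_eqF// sqrtr_gt0 lt_neqAle eq_sym Bn0.
have sgE : sg ^+ 2 = B by rewrite sqr_sqrtr.
pose mu := (@lebesgue_measure R).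
have base (S : set R) : measurable S -> (\int[mu]_x (normal_pdf 0 sg x * \1_S x)%:E = 1%:E * P (xi @^-1` S))%E.
  move=> mS; rewrite mul1e law// /normal_law (negbTE Bn0) /normal_prob [RHS]integral_mkcond.
  apply: eq_integral => x _; rewrite /patch indicE.
  by case: (x \in S); rewrite ?mulr1 ?mulr0.
have := @integral_weight_comp _ _ _ _ _ _ _ P mu (normal_pdf 0 sg) idfun xi 1 _
  (measurable_normal_pdf 0 sg) (normal_pdf_ge0 0 sg) (@measurable_id _ _ setT) mxi ler01 base mg (fun u => expR_ge0 _).
rewrite mul1e => <-.
(* Completing the square: the centered density times [exp (s x)] is [exp (B s^2 / 2)] times the
   density centered at [sg^2 s]. *)
rewrite -[RHS]mule1 -(integral_normal_pdf (sg ^+ 2 * s) sg) -ge0_integralZl_EFin ?expR_ge0//; first last.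
- by apply/measurable_EFinP; exact: measurable_normal_pdf.
- by move=> x _; rewrite lee_fin normal_pdf_ge0.
apply: eq_integral => x _; rewrite -EFinM; congr (_%:E).
rewrite /idfun /= /normal_pdf (negbTE sg0) /normal_fun.
rewrite -[LHS]mulrA -expRD [RHS]mulrCA -expRD; congr (_ * expR _).
by rewrite -sgE; field.
Qed.

Lemma rectangles_sigma_family (d d1 d2 : measure_display) (T : measurableType d)
    (U : measurableType d1) (V : measurableType d2) (X : nat -> T -> U) (Y : nat -> T -> V)
    (n : nat) (A : set T) :
  <<s rectangles measurable X n >> A -> sigma_family (fun i w => (X i w, Y i w)) A.
Proof.
apply: smallest_sub; first exact: smallest_sigma_algebra.
move=> _ [B mB ->].
apply: (@fin_bigcap_measurable _ (g_sigma_algebraType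
  (\bigcup_i g_sigma_algebra_preimage (fun w => (X i w, Y i w))))) => // i _.
apply: sub_sigma_algebra; exists i => //; exists (B i `*` setT); first exact: measurableX.
by rewrite setTI preimage_pair preimage_setT setIT.
Qed.

Lemma gaussian_noise_mgf R (d d1 d2 : measure_display) (T : measurableType d)
    (U : measurableType d1) (V : measurableType d2) (P : probability T R)
    (X : nat -> T -> U) (Y : nat -> T -> V) (M : nat) (B : R)
    (xi : nat -> 'I_M -> {RV P >-> R}) (m : 'I_M) :
  (forall i, measurable_fun setT (X i)) -> 0 <= B ->
  iid P (fun (im : nat * 'I_M) (w : T) => xi im.1 im.2 w) ->
  (forall i m (S : set R), measurable S -> P (xi i m @^-1` S) = normal_law B S) ->
  independent_families P (fun (im : nat * 'I_M) (w : T) => xi im.1 im.2 w)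
    (fun i w => (X i w, Y i w)) ->
  conditional_mgf_bound P X (fun i w => xi i m w) 1 (B / 2).
Proof.
move=> mX B0 [ind _] law indXY n C A s sA _.
have mA : measurable A.
  by apply: (smallest_sub (@sigma_algebra_measurable _ T)) sA; exact: rectangles_measurable.
have mxi i : measurable_fun setT (xi i m : T -> R) by [].
have mg : measurable_fun setT (fun x : R => expR (s * x)).
  by apply: measurableT_comp => //; apply: measurable_funM.
under eq_integral do rewrite mulr_sumr expR_sum.
rewrite (@integral_prod_given _ _ _ _ _ P (fun i => xi i m) A (fun x => expR (s * x))
  (expR (B / 2 * s ^+ 2)))//.
- by rewrite -expRM_natl mulrC.
- move=> s' E us' mE; rewrite setIC.
  pose s2 : seq (nat * 'I_M) := [seq (i, m) | i <- s'].
  have us2 : uniq s2 by rewrite map_inj_uniq// => i j [].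
  pose Z (im : nat * 'I_M) (w : T) := xi im.1 im.2 w.
  have eq2 : \bigcap_(i in [set` s']) (xi i m : T -> R) @^-1` E i =
      \bigcap_(im in [set` s2]) Z im @^-1` E im.1.
    apply/seteqP; split=> w /= H.
      by move=> _ /= /mapP[i si ->]; exact: H.
    by move=> i /= si; apply: (H (i, m)); apply/mapP; exists i.
  rewrite indXY; last exact: rectangles_sigma_family sA.
    rewrite muleC; congr (_ * _)%E; rewrite eq2.
    rewrite (mutually_independent_prod (Z := Z) (B := fun im => E im.1))//.
    by rewrite big_map.
  rewrite eq2.
  apply: (@fin_bigcap_measurable _ (g_sigma_algebraType
    (\bigcup_i g_sigma_algebra_preimage (Z i)))) => // i _.
  apply: sub_sigma_algebra; exists i => //; exists (E i.1) => //.
  by rewrite setTI.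
by move=> i; apply: normal_mgf => // S; exact: law.
Qed.

(** * Uniform control of the noise *)

Lemma open_halfspace_measurable R p (b : R) (u : 'rV[R]_p) :
  measurable ([set v | 0 < b + dot u v] : set (borelV R p)).
Proof.
have cdot : continuous (dot u : 'rV[R]_p -> R).
  apply: continuous_big => [|j _ v]; first exact: add_continuous.
  apply: (@continuousM _ _ (cst (u 0 j)) (fun v : 'rV[R]_p => v 0 j)).
    exact: cst_continuous.
  exact: coord_continuous.
apply: sub_sigma_algebra; rewrite -[mkset _]/((fun v => b + dot u v) @^-1` [set r | 0 < r]).
apply: open_comp; last exact: open_gt.
move=> v _; apply: (@continuousD _ _ _ (cst b) (dot u) v); [exact: cst_continuous|exact: cdot].
Qed.

(* Only countably many half-spaces matter, whence measurability. *)
Lemma rational_halfspace R p n (x : 'I_n -> 'rV[R]_p) (C : {set 'I_n}) :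
  C \in halfspaces x ->
  exists q : rat * 'rV[rat]_p, forall i,
    (i \in C) = (0 < ratr q.1 + dot (map_mx ratr q.2) (x i)).
Proof.
move=> /halfspacesP[b [u Cb]]; pose g i := b + dot u (x i).
pose e := \big[Num.min/1]_(i in C) g i.
have e0 : 0 < e.
  rewrite /e; elim/big_ind : _ => // [a c a0 c0|i iC]; first by rewrite lt_min a0.
  by rewrite -Cb.
have eg i : i \in C -> e <= g i by move=> iC; rewrite /e (bigD1 i)//= ge_min lexx.
pose S := 1 + \sum_i \sum_j `|x i 0 j|.
have S0 : 0 < S by rewrite ltr_pwDl// sumr_ge0// => i _; rewrite sumr_ge0.
(* Lowering the offset by [e / 2] leaves a margin [e / 2] on both sides of the boundary, and
   approximating the coefficients within [h] moves each value by at most [h * S = e / 4]. *)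
pose h := e / 4 / S; have h0 : 0 < h by rewrite !divr_gt0.
have approx (r : R) : {q : rat | `|ratr q - r| < h}.
  have /(rat_in_itvoo)/cid[q] : r - h < r + h by rewrite ltrD2l gtrN.
  by rewrite in_itv /= => /andP[q1 q2]; exists q; rewrite ltr_distl q1.
exists (sval (approx (b - e / 2)), \row_j sval (approx (u 0 j))) => i /=.
case: (approx (b - e / 2)) => b' /= hb'.
set u' := map_mx _ _.
have hu' j : `|u' 0 j - u 0 j| < h.
  by rewrite /u' !mxE; case: (approx _).
have close : `|(ratr b' + dot u' (x i)) - (g i - e / 2)| <= e / 4.
  have -> : (ratr b' + dot u' (x i)) - (g i - e / 2) =
      (ratr b' - (b - e / 2)) + \sum_j (u' 0 j - u 0 j) * x i 0 j.
    under eq_bigr do rewrite mulrBl; rewrite sumrB /g /dot; ring.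
  have -> : e / 4 = h * S by rewrite /h divfK// gt_eqF.
  apply: (le_trans (ler_normD _ _)); rewrite /S mulrDr mulr1; apply: lerD; first exact: ltW.
  apply: (le_trans (ler_norm_sum _ _ _)).
  apply: (@le_trans _ _ (h * \sum_j `|x i 0 j|)).
    rewrite mulr_sumr; apply: ler_sum => j _; rewrite normrM ler_wpM2r//; exact: ltW.
  rewrite ler_wpM2l ?(ltW h0)//; rewrite [leRHS](bigD1 i)//= lerDl.
  by apply: sumr_ge0 => k _; apply: sumr_ge0.
move: close; rewrite ler_distl => /andP[c1 c2].
have [iC|iNC] := boolP (i \in C); first by have egi := eg i iC; apply/esym; apply: (introT idP); lra.
have : g i <= 0 by rewrite leNgt -Cb.
by move=> gi; apply/esym/negbTE; rewrite -leNgt; lra.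
Qed.

Lemma bigcup_countType_measurable (d : measure_display) (T : measurableType d)
    (Q : countType) (F : Q -> set T) :
  (forall q, measurable (F q)) -> measurable (\bigcup_q F q).
Proof.
move=> mF; rewrite (_ : \bigcup_q F q = \bigcup_k oapp F set0 (unpickle k)).
  by apply: bigcupT_measurable => k; case: (unpickle k) => /=.
apply/seteqP; split=> w /=; first by move=> [q _ Fq]; exists (pickle q); rewrite ?pickleK.
by move=> [k _]; case: (unpickle k) => //= q Fq; exists q.
Qed.

(** Being a trace is a countable union of rectangles over the rational half-spaces, and there are
    finitely many candidates [C]. The tests may therefore depend on this family while remaining
    determined by the covariates. *)
Lemma halfspaces_adapted R p (T : pointedType)
    (X : nat -> T -> borelV R p) (n : nat) (H : {set {set 'I_n}}) :
  <<s rectangles measurable X n >> [set w | halfspaces (fun i : 'I_n => X i w) = H].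
Proof.
pose GT := g_sigma_algebraType (rectangles measurable X n).
have mC (C : {set 'I_n}) : @measurable _ GT [set w | C \in halfspaces (fun i : 'I_n => X i w)].
  pose F (q : rat * 'rV[rat]_p) := \bigcap_(i in `I_n) X i @^-1`
    [set v | forall k : 'I_n, val k = i -> (k \in C) = (0 < ratr q.1 + dot (map_mx ratr q.2) v)].
  have mF q : @measurable _ GT (F q).
    apply: sub_sigma_algebra; exists (fun i : nat => [set v | forall k : 'I_n, val k = i ->
      (k \in C) = (0 < ratr q.1 + dot (map_mx ratr q.2) v)]) => // i.
    have [ltin|leni] := ltnP i n; last first.
      rewrite (_ : mkset _ = setT); first exact: measurableT.
      by apply/seteqP; split => // v _ k ki; move: leni; rewrite -ki leqNgt ltn_ord.
    pose O : set (borelV R p) := [set v | 0 < ratr q.1 + dot (map_mx ratr q.2) v].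
    have mO : measurable O by exact: open_halfspace_measurable.
    rewrite (_ : mkset _ = if Ordinal ltin \in C then O else ~` O).
      by case: ifP => // _; apply: measurableC.
    apply/seteqP; split=> v /=.
      move=> /(_ (Ordinal ltin) erefl); case: ifP => _ e; rewrite /O /=; first by rewrite -e.
      by rewrite -e.
    by case: ifP => iC vO k ki; rewrite (_ : k = Ordinal ltin) ?iC; [|exact: val_inj| |exact: val_inj]; apply/esym => //; apply/negbTE/negP.
  rewrite (_ : mkset _ = \bigcup_q F q); first exact: bigcup_countType_measurable.
  apply/seteqP; split=> w /=.
    by move=> /rational_halfspace[q Cq]; exists q => // i /= _ k <-; exact: Cq.
  move=> [q _ Fq]; apply/halfspacesP.
  by exists (ratr q.1), (map_mx ratr q.2) => i; apply: (Fq (val i)) => //=; exact: ltn_ord.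
rewrite (_ : mkset _ = \bigcap_(C in [set: {set 'I_n}])
  (if C \in H then [set w | C \in halfspaces (fun i : 'I_n => X i w)]
   else ~` [set w | C \in halfspaces (fun i : 'I_n => X i w)])).
  apply: (@fin_bigcap_measurable _ GT) => // C _.
  by case: ifP => _; [|apply: (@measurableC _ GT)]; exact: mC.
apply/seteqP; split=> w /=; first by move=> <- C _ /=; case: ifP => [|/negbT/negP].
move=> wH; apply/finset.setP => C; have := wH C I; case: ifP => //= _.
by move=> /negP/negbTE.
Qed.

Lemma measure_bigsetU_le (d : measure_display) (T : measurableType d) R
    (mu : {measure set T -> \bar R}) (I : eqType) (s : seq I) (A : I -> set T) :
  (forall i, measurable (A i)) ->
  (mu (\big[setU/set0]_(i <- s) A i) <= \sum_(i <- s) mu (A i))%E.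
Proof.
move=> mA; elim: s => [|i s IH]; first by rewrite !big_nil measure0.
rewrite !big_cons; apply: (le_trans (measureU2 _ _ _)) => //.
  exact: bigsetU_measurable.
exact: leeD.
Qed.

Lemma bigsetUP (T : Type) (I : eqType) (s : seq I) (A : I -> set T) (w : T) :
  (\big[setU/set0]_(i <- s) A i) w <-> exists2 i, i \in s & A i w.
Proof.
elim: s => [|i s IH]; first by rewrite big_nil; split=> // -[].
rewrite big_cons; split=> [[Aw|/IH[j js Aw]]|[j]].
- by exists i; rewrite ?inE ?eqxx.
- by exists j; rewrite ?inE ?js ?orbT.
by rewrite inE => /orP[/eqP -> Aw|js Aw]; [left|right; apply/IH; exists j].
Qed.

Lemma sum_measure_disjoint_le (d : measure_display) (T : measurableType d) R
    (mu : {measure set T -> \bar R}) (I : eqType) (s : seq I) (A : I -> set T) :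
  uniq s -> (forall i, measurable (A i)) -> (forall i j w, A i w -> A j w -> i = j) ->
  (\sum_(i <- s) mu (A i) = mu (\big[setU/set0]_(i <- s) A i))%E.
Proof.
move=> us mA dA; elim: s us => [|i s IH] /= us; first by rewrite !big_nil measure0.
move/andP: us => [iNs us].
rewrite !big_cons IH// measureU//; first exact: bigsetU_measurable.
apply/seteqP; split=> // w [Aw /bigsetUP[j js Ajw]].
by move: iNs; rewrite (dA _ _ _ Aw Ajw) js.
Qed.

(** A test [(C, N, H)] asks the noise over [C] to be of order [sqrt(H N)], and fails on a covariate
    event with relative probability at most [2 exp (- H)]. The union bound is taken on each of the
    disjoint events fixing the family of half-space traces; their probabilities sum to at most 1, so
    the number of possible families costs nothing. *)
Lemma finite_tests_prob R p (d : measure_display) (T : measurableType d)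
    (P : probability T R) (X : nat -> T -> borelV R p) (zeta : nat -> T -> R) (s0 v : R)
    (n : nat) (ts : {set {set 'I_n}} -> seq ({set 'I_n} * R * R)) (delta : R) :
  (forall i, measurable_fun setT (X i)) -> (forall i, measurable_fun setT (zeta i)) ->
  0 <= s0 -> 0 <= v -> conditional_mgf_bound P X zeta s0 v ->
  (forall h t, t \in ts h -> [/\ #|t.1.1|%:R <= t.1.2, 0 < t.2 & t.2 <= s0 ^+ 2 * t.1.2]) ->
  (forall h, \sum_(t <- ts h) 2 * expR (- t.2) <= delta) ->
  exists F : set T, [/\ measurable F, ((1 - delta)%:E <= P F)%E &
    forall w, F w -> forall t, t \in ts (halfspaces (fun i : 'I_n => X i w)) ->
      `|\sum_(i in t.1.1) zeta i w| <= (1 + v) * Num.sqrt (t.2 * t.1.2)].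
Proof.
move=> mX mz s00 v0 mgf tsP tsd.
pose A h := [set w | halfspaces (fun i : 'I_n => X i w) = h].
pose bad (t : {set 'I_n} * R * R) :=
  [set w | (1 + v) * Num.sqrt (t.2 * t.1.2) < `|\sum_(i in t.1.1) zeta i w|].
have sA h : <<s rectangles measurable X n >> (A h) by exact: halfspaces_adapted.
have mA h : measurable (A h).
  by apply: (smallest_sub (@sigma_algebra_measurable _ T)) (sA h); exact: rectangles_measurable.
have mb t : measurable (bad t).
  pose S w := \sum_(i in t.1.1) zeta i w.
  have mS : measurable_fun setT (Num.norm \o S).
    apply: measurableT_comp => //.
    by rewrite /S; under eq_fun do rewrite -big_enum /=; exact: measurable_sum.
  rewrite (_ : bad t = (Num.norm \o S) @^-1` `](1 + v) * Num.sqrt (t.2 * t.1.2), +oo[).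
    by rewrite -[X in measurable X]setTI; apply: mS.
  by apply/seteqP; split=> w /=; rewrite in_itv /= andbT.
have mAb h t : measurable (A h `&` bad t) by exact: measurableI.
pose B h := \big[setU/set0]_(t <- ts h) (A h `&` bad t).
have mB h : measurable (B h) by apply: bigsetU_measurable.
pose Bad := \big[setU/set0]_(h : {set {set 'I_n}}) B h.
have mBad : measurable Bad by apply: bigsetU_measurable.
have delta0 : 0 <= delta.
  by apply: le_trans (tsd finset.set0); apply: sumr_ge0 => t _; rewrite mulr_ge0// expR_ge0.
have PB h : (P (B h) <= delta%:E * P (A h))%E.
  apply: (le_trans (measure_bigsetU_le _ _ _)) => //.
  apply: (@le_trans _ _ (\sum_(t <- ts h) (2 * expR (- t.2))%:E * P (A h))%E).
    rewrite big_seq [leRHS]big_seq; apply: lee_sum => t tt.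
    have [cN H0 HN] := tsP h t tt.
    exact: (noise_tail mX mz s00 v0 mgf (sA h) cN H0 HN).
  rewrite -ge0_sume_distrl; last by move=> t _; rewrite lee_fin mulr_ge0// expR_ge0.
  by apply: lee_wpmul2r => //; rewrite sumEFin lee_fin.
have sumA : (\sum_(h : {set {set 'I_n}}) P (A h) <= 1)%E.
  rewrite sum_measure_disjoint_le//; last by move=> h h' w <- <-.
    by apply: probability_le1; exact: bigsetU_measurable.
  exact: index_enum_uniq.
exists (~` Bad); split; first exact: measurableC.
  rewrite probability_setC// EFinB leeB//.
  apply: (le_trans (measure_bigsetU_le _ _ _)) => //.
  apply: (@le_trans _ _ (\sum_(h : {set {set 'I_n}}) delta%:E * P (A h))%E).
    by apply: lee_sum => h _; exact: PB.
  rewrite -ge0_sume_distrr; last by move=> h _.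
  by rewrite -[leRHS]mule1; apply: lee_wpmul2l.
move=> w nB t tt; rewrite leNgt; apply/negP => bt; apply: nB.
apply/bigsetUP; exists (halfspaces (fun i : 'I_n => X i w)); first exact: mem_index_enum.
by apply/bigsetUP; exists t.
Qed.

Lemma sum_seq_const_le R (I : eqType) (s : seq I) (F : I -> R) (n : nat) (c d : R) :
  (forall i, i \in s -> F i <= c) -> 0 <= c -> (size s <= n)%N -> n%:R * c <= d ->
  \sum_(i <- s) F i <= d.
Proof.
move=> Fc c0 sn nd; apply: le_trans nd; apply: (@le_trans _ _ (\sum_(i <- s) c)).
  by rewrite big_seq [leRHS]big_seq; apply: ler_sum => i /Fc.
by rewrite big_const_seq count_predT iter_addr addr0 -[leLHS]mulr_natl ler_wpM2r// ler_nat.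
Qed.

(* Every describable set is close to an element of a small net: the first batch
   of tests controls the sums over the net, the second one the sums over the
   (small) differences. *)
Lemma chaining_tests R (n q G0 m : nat) (h : {set {set 'I_n}})
    (eta s0 N0 H2 d1 d2 : R) (H1 : nat -> R) (a := (2 * q + 1)%N) :
  finset.setT \in h -> (forall D, shatters h D -> (#|D| <= q)%N) ->
  0 < eta <= 1 -> (n.+1 ^ (a * G0 * 2))%:R * (1 - eta) ^+ m < 1 ->
  (forall G, (G <= G0)%N -> [/\ 0 < H1 G, H1 G <= s0 ^+ 2 * N0 &
     (m.+1 ^ (a * G))%:R * (2 * expR (- H1 G)) <= d1]) ->
  0 < H2 -> H2 <= s0 ^+ 2 * (eta * n%:R) -> (n.+1 ^ (a * G0 * 2))%:R * (2 * expR (- H2)) <= d2 ->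
  exists ts : seq ({set 'I_n} * R * R), [/\
    forall t, t \in ts -> [/\ #|t.1.1|%:R <= t.1.2, 0 < t.2 & t.2 <= s0 ^+ 2 * t.1.2],
    \sum_(t <- ts) 2 * expR (- t.2) <= G0.+1%:R * d1 + d2 &
    forall (z : 'I_n -> R) (K : R), 0 <= K ->
      (forall t, t \in ts -> `|\sum_(i in t.1.1) z i| <= K * Num.sqrt (t.2 * t.1.2)) ->
      forall G C (N : R), (G <= G0)%N -> C \in describable h G -> #|C|%:R <= N -> N0 <= N ->
      `|\sum_(i in C) z i| <= K * (Num.sqrt (H1 G * (N + eta * n%:R))
                                   + 2 * Num.sqrt (H2 * (eta * n%:R)))].
Proof.
move=> hT vc eta01 lt1 H1P H20 H2e d2P.
have [e0 e1] : 0 < eta /\ eta <= 1 by apply/andP.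
have net G : exists N : {set {set 'I_n}}, (G <= G0)%N -> [/\ N \subset describable h G,
    (#|N| <= m.+1 ^ (a * G))%N &
    forall C, C \in describable h G -> exists2 C', C' \in N &
      #|(C :\: C')%SET|%:R <= eta * n%:R /\ #|(C' :\: C)%SET|%:R <= eta * n%:R].
  have [GG0|] := boolP (G <= G0)%N; last by exists finset.set0.
  have [|N [N1 N2 N3]] := @describable_net R 'I_n h q G0 m eta hT vc eta01 _ G GG0.
    by rewrite card_ord.
  by exists N => _; split=> //; move: N3; rewrite card_ord.
have {net}[Nt NtP] := choice net.
(* The size bound is raised to [N0] because a test needs an exponent at most [s0 ^+ 2] times it,
   which is known of [H1 G] only at the scale [N0]. *)
pose f1 G (C : {set 'I_n}) := (C, Num.max #|C|%:R N0, H1 G).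
pose t1 := [seq f1 G C | G <- iota 0 G0.+1, C <- enum (Nt G)].
pose small := [set E : {set 'I_n} | (#|E|%:R <= eta * n%:R) &&
  [exists C in describable h G0, [exists C' in describable h G0, E == C :\: C']]]%SET.
pose f2 (E : {set 'I_n}) := (E, eta * n%:R, H2).
pose t2 := [seq f2 E | E <- enum small].
have sz2 : (size t2 <= n.+1 ^ (a * G0 * 2))%N.
  rewrite size_map -cardE.
  apply: (@leq_trans #|((fun C C' : {set 'I_n} => (C :\: C')%SET) @2: (describable h G0, describable h G0))%SET|).
    apply: subset_leq_card; apply/fintype.subsetP => E; rewrite inE => /andP[_].
    move=> /exists_inP[C CD /exists_inP[C' CD' /eqP ->]].
    by apply/imset2P; exists C C'.
  rewrite curry_imset2X; apply: (leq_trans (leq_imset_card _ _)); rewrite cardsX expnM expnS expn1.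
  by have := card_describable G0 hT vc; rewrite card_ord => le1; apply: leq_mul.
have d10 : 0 <= d1.
  by have [_ _] := H1P 0%N (leq0n _); apply: le_trans; rewrite mulr_ge0// mulr_ge0// expR_ge0.
exists (t1 ++ t2); split.
- move=> t; rewrite mem_cat => /orP[/allpairsPdep[G [C [Gi CN ->]]]|/mapP[E]] /=.
    move: Gi; rewrite mem_iota add0n ltnS => /andP[_ GG0]; have [h0 hs _] := H1P G GG0.
    split; rewrite ?le_max ?lexx//; apply: (le_trans hs).
    by rewrite ler_wpM2l ?sqr_ge0// le_max lexx orbT.
  by rewrite mem_enum inE => /andP[E1 _] -> /=.
- rewrite big_cat /=; apply: lerD; last first.
    apply: (sum_seq_const_le _ _ sz2 d2P); last by rewrite mulr_ge0// expR_ge0.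
    by move=> t /mapP[E _ ->].
  rewrite big_allpairs_dep; apply: (sum_seq_const_le (n := G0.+1) (c := d1)) => //.
    move=> G; rewrite mem_iota add0n ltnS => /andP[_ GG0].
    have [_ cN _] := NtP G GG0; have [_ _ hd] := H1P G GG0.
    by apply: (sum_seq_const_le _ _ _ hd) => //; rewrite -?cardE// mulr_ge0// expR_ge0.
  by rewrite size_iota.
move=> z K K0 zt G C N GG0 CG CN NN0.
have [NtD _ /(_ C CG)[C' C'N [s1 s2]]] := NtP G GG0.
have C'D : C' \in describable h G by apply: (fintype.subsetP NtD).
have dif (A B : {set 'I_n}) : A \in describable h G -> B \in describable h G ->
    #|(A :\: B)%SET|%:R <= eta * n%:R ->
    `|\sum_(i in (A :\: B)%SET) z i| <= K * Num.sqrt (H2 * (eta * n%:R)).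
  move=> AD BD AB; apply: (zt ((A :\: B)%SET, eta * n%:R, H2)).
  rewrite mem_cat; apply/orP; right; apply/mapP; exists (A :\: B)%SET => //.
  rewrite mem_enum inE AB /=; apply/exists_inP; exists A; first exact: describable_le GG0 AD.
  by apply/exists_inP; exists B => //; exact: describable_le GG0 BD.
have main : `|\sum_(i in C') z i| <= K * Num.sqrt (H1 G * (N + eta * n%:R)).
  apply: (le_trans (zt (C', Num.max #|C'|%:R N0, H1 G) _)).
    rewrite mem_cat; apply/orP; left; apply/allpairsPdep; exists G, C'.
    by rewrite mem_iota add0n ltnS GG0 mem_enum.
  rewrite ler_wpM2l// ler_wsqrtr//= ler_wpM2l//; first by have [/ltW] := H1P G GG0.
  rewrite ge_max; apply/andP; split; last by rewrite (le_trans NN0)// lerDl mulr_ge0// ltW.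
  rewrite -(cardsID C C') natrD; apply: lerD => //.
  by apply: (le_trans _ CN); rewrite ler_nat; apply: subset_leq_card; apply: finset.subsetIr.
have splitC (A B : {set 'I_n}) : \sum_(i in A) z i =
    \sum_(i in (A :&: B)%SET) z i + \sum_(i in (A :\: B)%SET) z i.
  exact: big_setID.
have -> : \sum_(i in C) z i = \sum_(i in C') z i
    + (\sum_(i in (C :\: C')%SET) z i - \sum_(i in (C' :\: C)%SET) z i).
  by rewrite (splitC C C') (splitC C' C) finset.setIC; ring.
rewrite mulrDr; apply: (le_trans (ler_normD _ _)); apply: lerD => //.
apply: (le_trans (ler_normB _ _)).
have -> : K * (2 * Num.sqrt (H2 * (eta * n%:R))) =
  K * Num.sqrt (H2 * (eta * n%:R)) + K * Num.sqrt (H2 * (eta * n%:R)) by ring.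
by apply: lerD; apply: dif.
Qed.

(** Inner probabilities are traded for measurable subsets of nearly full probability, which can be
    intersected. *)
Lemma with_prob_to_oneP (d : measure_display) (T : measurableType d) R
    (P : probability T R) (E : nat -> set T) :
  with_prob_to_one P E <->
  forall e, 0 < e -> \forall n \near \oo,
    exists F, [/\ measurable F, F `<=` E n & ((1 - e)%:E <= P F)%E].
Proof.
have ip1 n : (inner_prob P (E n) <= 1)%E.
  by apply: ge_ereal_sup => _ [F [mF _] <-]; exact: probability_le1.
have ip0 n : (0 <= inner_prob P (E n))%E.
  by apply: ereal_sup_ubound; exists set0 => //; split.
have ipf n : inner_prob P (E n) \is a fin_num.
  by rewrite ge0_fin_numE// (le_lt_trans (ip1 n))// ltry.
split=> [/fine_cvgP[_ /cvgrPdist_lt cv] e e0|H].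
  have := cv e e0; apply: filterS => n /=; rewrite ltr_distlC => /andP[lt1 _].
  have : ((1 - e)%:E < inner_prob P (E n))%E by rewrite -(fineK (ipf n)) lte_fin.
  by move=> /ereal_sup_gt[_ [F [mF FE] <-] /ltW]; exists F.
apply/fine_cvgP; split; first by near=> n.
apply/cvgrPdist_le => e e0; have := H e e0; apply: filterS => n [F [mF FE PF]].
have : ((1 - e)%:E <= inner_prob P (E n))%E.
  by apply: (le_trans PF); apply: ereal_sup_ubound; exists F.
have := ip1 n; rewrite -(fineK (ipf n)) !lee_fin => h1 h2.
by rewrite ger0_norm ?subr_ge0//; rewrite lerBlDr -lerBlDl.
Unshelve. all: by end_near. Qed.

Lemma with_prob_to_oneI (d : measure_display) (T : measurableType d) R
    (P : probability T R) (E1 E2 : nat -> set T) :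
  with_prob_to_one P E1 -> with_prob_to_one P E2 ->
  with_prob_to_one P (fun n => E1 n `&` E2 n).
Proof.
move=> /with_prob_to_oneP H1 /with_prob_to_oneP H2; apply/with_prob_to_oneP => e e0.
have e20 : 0 < e / 2 by rewrite divr_gt0.
near=> n.
have [F1 [mF1 FE1 P1]] : exists F, [/\ measurable F, F `<=` E1 n & ((1 - e / 2)%:E <= P F)%E].
  by near: n; exact: H1.
have [F2 [mF2 FE2 P2]] : exists F, [/\ measurable F, F `<=` E2 n & ((1 - e / 2)%:E <= P F)%E].
  by near: n; exact: H2.
exists (F1 `&` F2); split; first exact: measurableI.
  by move=> w [? ?]; split; [exact: FE1|exact: FE2].
rewrite -[F1 `&` F2]setCK setCI probability_setC//; last first.
  by apply: measurableU; exact: measurableC.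
have : (P (~` F1 `|` ~` F2) <= e%:E)%E.
  have mC1 := measurableC mF1; have mC2 := measurableC mF2.
  apply: (@le_trans _ _ (P (~` F1) + P (~` F2))%E); first exact: measureU2.
  rewrite (probability_setC P mF1) (probability_setC P mF2); move: P1 P2.
  rewrite -(fineK (fin_num_measure P F1 mF1)) -(fineK (fin_num_measure P F2 mF2)).
  by rewrite -!EFinB -EFinD !lee_fin; lra.
by move=> h; rewrite EFinB leeB.
Unshelve. all: by end_near. Qed.

Lemma with_prob_to_one_sub (d : measure_display) (T : measurableType d) R
    (P : probability T R) (E1 E2 : nat -> set T) :
  (\forall n \near \oo, E1 n `<=` E2 n) -> with_prob_to_one P E1 -> with_prob_to_one P E2.
Proof.
move=> sub /with_prob_to_oneP H; apply/with_prob_to_oneP => e e0.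
apply: filterS2 sub (H e e0) => n E12 [F [mF FE PF]].
by exists F; split=> //; exact: subset_trans FE E12.
Qed.

Lemma with_prob_to_one_forall (d : measure_display) (T : measurableType d) R
    (P : probability T R) (I : finType) (E : I -> nat -> set T) :
  (forall i, with_prob_to_one P (E i)) ->
  with_prob_to_one P (fun n => [set w | forall i, E i n w]).
Proof.
move=> H; have {}H (s : seq I) : with_prob_to_one P (fun n => [set w | forall i, i \in s -> E i n w]).
  elim: s => [|i s IH].
    apply/with_prob_to_oneP => e e0; near=> n; exists setT; split => //.
    by rewrite probability_setT lee_fin gerBl ltW.
  apply: with_prob_to_one_sub (with_prob_to_oneI (H i) IH); near=> n.
  by move=> w [Ei Es] j; rewrite inE => /orP[/eqP -> //|/Es].
apply: with_prob_to_one_sub (H (enum I)); near=> n => w Ew i; apply: Ew.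
by rewrite mem_enum.
Unshelve. all: by end_near. Qed.

(** * Numerical estimates for the chaining *)

Lemma expR_ge_pow R (k : nat) (x : R) : 0 <= x -> (x / k.+1%:R) ^+ k.+1 <= expR x.
Proof.
move=> x0; have -> : expR x = expR (x / k.+1%:R) ^+ k.+1.
  by rewrite -expRM_natl; congr expR; rewrite mulrC divfK.
apply: lerXn2r; rewrite ?nnegrE ?expR_ge0 ?divr_ge0//.
by apply: le_trans (expR_ge1Dx _); rewrite lerDr.
Qed.

Lemma ln_natS_le R (n : nat) : 1 <= ln n%:R :> R -> ln n.+1%:R <= 2 * ln n%:R :> R.
Proof.
case: n => [|[|n]] L1.
- by move: L1; rewrite ln0// ler10.
- by move: L1; rewrite ln1 ler10.
rewrite mulr_natl -lnXn// -natrX ler_ln ?posrE ?ltr0n ?expn_gt0// ler_nat.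
by rewrite expnS expn1; nia.
Qed.

Lemma natrX_expR R (n k : nat) :
  (n.+1 ^ k)%:R = expR (k%:R * ln n.+1%:R) :> R.
Proof. by rewrite expRM_natl lnK ?posrE ?ltr0n// natrX. Qed.

(* With [L = ln n], a net of mesh [L ^- 6] makes the first chaining step cost
   [L + G ln L] instead of [G L], and leaves differences so small that their
   crude union bound, of order [L ^+ 2], is harmless. *)
Lemma noise_numerics R (a : nat) (g0 D s0 : R) :
  0 <= g0 -> 0 < D -> 0 < s0 -> exists2 Lam : R, 1 < Lam & forall n : nat, Lam <= ln n%:R ->
  let L := ln n%:R in let G0 := Num.truncn (g0 * L) in let eta := L ^- 6 in
  let m := (Num.truncn ((a * G0 * 2)%:R * ln n.+1%:R * L ^+ 6)).+1 in
  let H1 (G : nat) := L + 9 * (a * G)%:R * ln L in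
  let H2 := 4 * a%:R * g0 * L ^+ 2 + L in
  let N0 := n%:R / (D * L) in
  [/\ 0 < eta <= 1, (n.+1 ^ (a * G0 * 2))%:R * (1 - eta) ^+ m < 1,
    (forall G, (G <= G0)%N -> [/\ 0 < H1 G, H1 G <= s0 ^+ 2 * N0 &
       (m.+1 ^ (a * G))%:R * (2 * expR (- H1 G)) <= 2 * expR (- L)]),
    [/\ 0 < H2, H2 <= s0 ^+ 2 * (eta * n%:R) &
        (n.+1 ^ (a * G0 * 2))%:R * (2 * expR (- H2)) <= 2 * expR (- L)] &
    [/\ G0.+1%:R * (2 * expR (- L)) + 2 * expR (- L) <= L^-1,
        0 < L, eta * n%:R <= N0 & H2 * (eta * n%:R) <= N0 * L]].
Proof.
move=> g00 D0 s00; set A := a%:R; have A0 : 0 <= A by rewrite ler0n.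
have Ag0 : 0 <= A * g0 by rewrite mulr_ge0.
pose c1 := D * (1 + 9 * A * g0) / s0 ^+ 2; have c10 : 0 <= c1.
  by rewrite divr_ge0 ?sqr_ge0// mulr_ge0 ?(ltW D0)//; lra.
pose c2 := (4 * A * g0 + 1) / s0 ^+ 2; have c20 : 0 <= c2.
  by rewrite divr_ge0 ?sqr_ge0//; lra.
(* The last summand gives [exp L >= (L / 10)^10 >= L^8 (c1 + c2 + 2 g0 + 4)], from which every
   comparison of [n = exp L] with powers of [L] follows; the other summands make [L] exceed the
   constants. *)
pose Lam := 3 + 4 * A * g0 + D + D * (4 * A * g0 + 1) + 10 ^+ 10 * (c1 + c2 + 2 * g0 + 4).
have DA : 0 <= D * (4 * A * g0 + 1) by rewrite mulr_ge0 ?(ltW D0)//; lra.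
have big0 : 0 <= 10 ^+ 10 * (c1 + c2 + 2 * g0 + 4) by rewrite mulr_ge0//; lra.
have Ag4 : 0 <= 4 * A * g0 by rewrite -mulrA mulr_ge0.
have LamE1 : 3 + 4 * A * g0 <= Lam by rewrite /Lam; lra.
have LamE2 : D <= Lam by rewrite /Lam; lra.
have LamE3 : D * (4 * A * g0 + 1) <= Lam by rewrite /Lam; lra.
have LamE4 : 10 ^+ 10 * (c1 + c2 + 2 * g0 + 4) <= Lam by rewrite /Lam; lra.
clearbody Lam; exists Lam; first by lra.
move=> n LamL L G0 eta m H1 H2 N0; rewrite -/L in LamL.
have L3 : 3 <= L.
  by apply: le_trans LamL; lra.
have L0 : 0 < L by lra.
have L1 : 1 <= L by lra.
have LX k : 1 <= L ^+ k by rewrite exprn_ege1.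
have LX0 k : 0 < L ^+ k by rewrite exprn_gt0.
have n0 : (0 < n)%N by case: n @L LamL L3 {G0 eta m H1 H2 N0} L0 L1 LX LX0 => // L _ L3; move: L3; rewrite /L ln0//; lra.
have nE : n%:R = expR L by rewrite /L lnK// posrE ltr0n.
have ll0 : 0 <= ln L by rewrite ln_ge0.
have llL : ln L <= L by have := expR_ge1Dx (ln L); rewrite lnK ?posrE//; lra.
have expL : L ^+ 8 * (c1 + c2 + 2 * g0 + 4) <= expR L.
  apply: le_trans (expR_ge_pow 9 (ltW L0)).
  rewrite expr_div_n ler_pdivlMr ?exprn_gt0// -mulrA (_ : L ^+ 10 = L ^+ 8 * L ^+ 2); last by rewrite -exprD.
  rewrite ler_wpM2l ?(ltW (LX0 8))// mulrC.
  apply: (@le_trans _ _ L); first by apply: le_trans LamL.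
  by rewrite expr2 ler_peMr// ltW.
clear big0 LamE4.
have pw k c : (k <= 8)%N -> 0 <= c -> c <= c1 + c2 + 2 * g0 + 4 -> L ^+ k * c <= expR L.
  move=> k8 c0 cc; apply: le_trans expL; apply: ler_pM => //; first exact: ltW.
  by rewrite ler_weXn2l.
have G0L : G0%:R <= g0 * L by rewrite Num.Theory.truncn_le// mulr_ge0// ltW.
have lnS : ln n.+1%:R <= 2 * L by exact: ln_natS_le.
have lnS0 : 0 <= ln n.+1%:R :> R by rewrite ln_ge0// ler1n.
have aG0 : (a * G0 * 2)%:R * ln n.+1%:R <= 4 * A * g0 * L ^+ 2.
  rewrite !natrM -/A; apply: (@le_trans _ _ (A * (g0 * L) * 2 * (2 * L))); last by rewrite le_eqVlt; apply/orP; left; apply/eqP; ring.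
  by apply: ler_pM => //; rewrite ?mulr_ge0//; rewrite ler_wpM2r// ler_wpM2l.
have e0 : 0 < eta by rewrite invr_gt0.
split.
- by rewrite e0 /= invf_le1.
- rewrite natrX_expR; set W := (_ * ln _).
  (* The size [m] is chosen for this: [(1 - eta) ^+ m <= exp (- eta m)] then beats [exp W], the
     bound on the number of pairs of describable sets. *)
  have mW : W < eta * m%:R.
    by rewrite mulrC ltr_pdivlMr// /m -/W truncnS_gt.
  apply: (@le_lt_trans _ _ (expR W * expR (- (eta * m%:R)))).
    rewrite ler_wpM2l ?expR_ge0// mulrC -mulrN expRM_natl.
    by apply: lerXn2r; rewrite ?nnegrE ?expR_ge0 ?subr_ge0 ?invf_le1// expR_ge1Dx.
  by rewrite -expRD -[ltRHS]expR0 ltr_expR subr_lt0.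
- move=> G GG0.
  have GL : G%:R <= g0 * L by apply: le_trans G0L; rewrite ler_nat.
  have aGL : (a * G)%:R <= A * g0 * L by rewrite natrM -mulrA ler_wpM2l.
  have aGl0 : 0 <= (a * G)%:R * ln L by rewrite mulr_ge0.
  split.
  + by rewrite /H1 -mulrA; lra.
  + have N0E : s0 ^+ 2 * N0 = expR L * (s0 ^+ 2 / D) / L.
      by rewrite /N0 nE; field; rewrite !gt_eqF.
    rewrite N0E ler_pdivlMr//.
    have h1 : L ^+ 3 * c1 <= expR L by apply: pw => //; lra.
    apply: (@le_trans _ _ (L ^+ 3 * (1 + 9 * A * g0))); last first.
      apply: (@le_trans _ _ (L ^+ 3 * c1 * (s0 ^+ 2 / D))).
        by rewrite le_eqVlt; apply/orP; left; apply/eqP; rewrite /c1; field; rewrite !gt_eqF.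
      by rewrite ler_wpM2r// divr_ge0 ?sqr_ge0// ltW.
    have h2 : (a * G)%:R * ln L <= A * g0 * L * L by apply: ler_pM.
    have h3 : L <= L ^+ 2 by rewrite expr2 ler_peMr// ltW.
    have -> : L ^+ 3 * (1 + 9 * A * g0) = (L ^+ 2 + 9 * (A * g0 * L * L)) * L by ring.
    by rewrite ler_wpM2r ?(ltW L0)// /H1 -mulrA; lra.
  (* The size [m] is of order [L^2 * L^6], so [L^9] bounds it for large [L]; the logarithm of the
     cardinality of the net is at most [9 a G ln L], the origin of the 9 in [H1]. *)
  have m9 : m.+1%:R <= L ^+ 9.
    have h0 : (Num.truncn ((a * G0 * 2)%:R * ln n.+1%:R * L ^+ 6))%:R <= 4 * A * g0 * L ^+ 2 * L ^+ 6.
      apply: (@le_trans _ _ ((a * G0 * 2)%:R * ln n.+1%:R * L ^+ 6)).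
        by rewrite truncn_le// mulr_ge0 ?(ltW (LX0 _))// mulr_ge0.
      by rewrite ler_wpM2r ?(ltW (LX0 _)).
    have h1 : 4 * A * g0 * L ^+ 2 * L ^+ 6 = 4 * A * g0 * L ^+ 8 by rewrite -mulrA -exprD.
    have h2 : (4 * A * g0 + 2) * L ^+ 8 <= L ^+ 9.
      by rewrite [leRHS]exprS ler_wpM2r ?(ltW (LX0 8))//; lra.
    by rewrite /m -addn2 natrD; have := LX 8%N; rewrite h1 in h0; lra.
  apply: (@le_trans _ _ (expR (9 * (a * G)%:R * ln L) * (2 * expR (- H1 G)))).
    rewrite ler_wpM2r ?mulr_ge0 ?expR_ge0//.
    have -> : 9 * (a * G)%:R * ln L = (9 * (a * G))%:R * ln L by rewrite (natrM _ 9).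
    rewrite expRM_natl lnK ?posrE// exprM natrX.
    by apply: lerXn2r; rewrite ?nnegrE ?(ltW (LX0 _)).
  rewrite mulrCA -expRD; rewrite ler_wpM2l// ler_expR /H1; lra.
- have H20 : 0 < H2.
    by rewrite /H2 ltr_wpDl// mulr_ge0 ?(ltW (LX0 _)).
  split => //.
  + have h1 : L ^+ 8 * c2 <= expR L by apply: pw => //; lra.
    rewrite nE mulrA [s0 ^+ 2 * eta]mulrC -mulrA mulrC ler_pdivlMr ?LX0//.
    apply: (@le_trans _ _ (L ^+ 8 * (4 * A * g0 + 1))); last first.
      apply: (@le_trans _ _ (s0 ^+ 2 * (L ^+ 8 * c2))).
        by rewrite le_eqVlt; apply/orP; left; apply/eqP; rewrite /c2; field; rewrite gt_eqF.
      by rewrite ler_wpM2l// sqr_ge0.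
    have h3 : L <= L ^+ 2 by rewrite expr2 ler_peMr// ltW.
    have -> : L ^+ 8 * (4 * A * g0 + 1) = (4 * A * g0 * L ^+ 2 + L ^+ 2) * L ^+ 6 by ring.
    by rewrite ler_wpM2r ?(ltW (LX0 _))// /H2 -/A; lra.
  + rewrite natrX_expR mulrCA -expRD ler_wpM2l// ler_expR /H2 -/A; lra.
split => //.
- have h1 : L ^+ 2 * (2 * g0 + 4) <= expR L by apply: pw => //; lra.
  rewrite expRN.
  have -> : G0.+1%:R * (2 * (expR L)^-1) + 2 * (expR L)^-1 = (2 * G0%:R + 4) / expR L.
    by rewrite -natr1; ring.
  rewrite ler_pdivrMr ?expR_gt0// [leRHS]mulrC ler_pdivlMr//.
  apply: le_trans h1; rewrite expr2 -mulrA [leLHS]mulrC ler_wpM2l ?(ltW L0)//.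
  by rewrite mulrDr mulrCA; lra.
- rewrite /N0 /eta mulrC ler_wpM2l// lef_pV2 ?posrE ?mulr_gt0//.
  rewrite [leRHS]exprS mulrC ler_wpM2l ?(ltW L0)//.
  apply: (@le_trans _ _ (L ^+ 1)); last by rewrite ler_weXn2l.
  by rewrite expr1; exact: le_trans LamL.
have -> : N0 * L = n%:R / D by rewrite /N0; field; rewrite !gt_eqF.
rewrite mulrA mulrC ler_wpM2l// -ler_pdivlMr ?invr_gt0// invrK.
rewrite [leRHS]mulrC ler_pdivlMr// mulrC.
have h3 : L <= L ^+ 2 by rewrite expr2 ler_peMr// ltW.
apply: (@le_trans _ _ (D * ((4 * A * g0 + 1) * L ^+ 2))).
  by rewrite ler_wpM2l ?(ltW D0)// /H2 -/A; lra.
rewrite mulrA; apply: (@le_trans _ _ (L * L ^+ 2)).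
  by rewrite ler_wpM2r ?(ltW (LX0 _))//; exact: le_trans LamL.
by rewrite -exprS ler_weXn2l.
Qed.

Lemma near_ln_ge R (Lam : R) : \forall n \near \oo, Lam <= ln n%:R :> R.
Proof.
near=> n; have h : expR Lam <= n%:R :> R by near: n; exact: nbhs_infty_ger.
by rewrite -[leLHS]expRK ler_ln ?posrE ?expR_gt0// (lt_le_trans (expR_gt0 _) h).
Unshelve. all: by end_near. Qed.

(** The bound [N] is decoupled from the cardinality of [C], so that a piece of a cell, however
    small, is controlled at the scale of the whole cell. *)
Definition noise_event R p (T : Type) (X : nat -> T -> 'rV[R]_p)
    (zeta : nat -> T -> R) (g0 D K : R) (n : nat) : set T :=
  [set w | forall G C (N : R), G%:R <= g0 * ln n%:R ->
    C \in describable (halfspaces (fun i : 'I_n => X i w)) G ->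
    #|C|%:R <= N -> n%:R / (D * ln n%:R) <= N ->
    `|\sum_(i in C) zeta i w| <= K * Num.sqrt (N * (ln n%:R + G%:R * ln (ln n%:R)))].

Lemma uniform_noise R p (d : measure_display) (T : measurableType d)
    (P : probability T R) (X : nat -> T -> borelV R p) (zeta : nat -> T -> R) (s0 v g0 D : R) :
  (forall i, measurable_fun setT (X i)) -> (forall i, measurable_fun setT (zeta i)) ->
  0 < s0 -> 0 <= v -> conditional_mgf_bound P X zeta s0 v -> 0 <= g0 -> 0 < D ->
  exists2 K, 0 <= K & with_prob_to_one P (noise_event X zeta g0 D K).
Proof.
move=> mX mz s00 v0 mgf g00 D0.
pose q := p.+1; pose a := (2 * q + 1)%N.
have a9 : 1 <= 9 * a%:R :> R by rewrite -natrM ler1n muln_gt0 /a addn1.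
have a18 : 1 <= 9 * a%:R * 2 :> R by rewrite -natrM -natrM ler1n !muln_gt0 /a addn1.
have [Lam Lam1 num] := noise_numerics a g00 D0 s00.
exists ((1 + v) * (9 * a%:R * 2 + 2)); first by rewrite mulr_ge0// ?addr_ge0// ?mulr_ge0.
apply/with_prob_to_oneP => e e0.
near=> n; have Ln : Num.max Lam e^-1 <= ln n%:R by near: n; exact: near_ln_ge.
have [LamL eL] : Lam <= ln n%:R /\ e^-1 <= ln n%:R by move: Ln; rewrite ge_max => /andP.
have := num n LamL; set L := ln n%:R; cbv zeta.
set G0 := Num.truncn _; set eta := L ^- 6; set m := (Num.truncn _).+1.
set H2 := 4 * a%:R * g0 * L ^+ 2 + L; set N0 := n%:R / (D * L).
pose H1 (G : nat) := L + 9 * (a * G)%:R * ln L.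
move=> [eta01 lt1 H1P [H20 H2e d2P] [dle L0 etaN H2N]].
have tests (h : {set {set 'I_n}}) : exists ts : seq ({set 'I_n} * R * R),
   [/\ forall t, t \in ts -> [/\ #|t.1.1|%:R <= t.1.2, 0 < t.2 & t.2 <= s0 ^+ 2 * t.1.2],
     \sum_(t <- ts) 2 * expR (- t.2) <= e &
     finset.setT \in h -> (forall D, shatters h D -> (#|D| <= q)%N) ->
     forall (z : 'I_n -> R) (K : R), 0 <= K ->
      (forall t, t \in ts -> `|\sum_(i in t.1.1) z i| <= K * Num.sqrt (t.2 * t.1.2)) ->
      forall G C (N : R), (G <= G0)%N -> C \in describable h G -> #|C|%:R <= N -> N0 <= N ->
      `|\sum_(i in C) z i| <= K * (Num.sqrt (H1 G * (N + eta * n%:R))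
                                   + 2 * Num.sqrt (H2 * (eta * n%:R)))].
  (* Tests must be supplied for every conceivable family [h]. Those that are not of bounded VC
     dimension get none, as they never arise from half-spaces. *)
  have [[hT vc]|no] := pselect (finset.setT \in h /\ forall D, shatters h D -> (#|D| <= q)%N).
    have [ts [ts1 ts2 ts3]] := chaining_tests hT vc eta01 lt1 H1P H20 H2e d2P.
    exists ts; split => //; apply: (le_trans ts2); apply: (le_trans dle).
    by rewrite -[leRHS]invrK lef_pV2 ?posrE ?invr_gt0.
  exists [::]; split => //; first by rewrite big_nil ltW.
  by move=> hT vc; case: no.
have [ts tsP] := choice tests.
have [F [mF PF Fts]] := @finite_tests_prob R p d T P X zeta s0 v n ts e mX mz (ltW s00) v0 mgf
  (fun h => let: And3 H _ _ := tsP h in H) (fun h => let: And3 _ H _ := tsP h in H).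
exists F; split => // w Fw G C N GL CG CN N0N.
have [_ _ tsh] := tsP (halfspaces (fun i : 'I_n => X i w)).
have GG0 : (G <= G0)%N.
  have gL0 : 0 <= g0 * L by rewrite mulr_ge0// ltW.
  by rewrite /G0 truncn_ge_nat.
have lnL0 : 0 <= ln L by rewrite ln_ge0// (le_trans _ LamL)// ltW.
have ple1 := @halfspaces_vc R p n (fun i : 'I_n => X i w).
have := tsh (setT_halfspaces _) ple1 (fun i => zeta i w) (1 + v) _ (Fts w Fw) G C N GG0 CG CN N0N.
rewrite addr_ge0// => /(_ isT) /le_trans; apply.
rewrite -mulrA ler_wpM2l ?addr_ge0//.
have N0p : 0 <= N0 by rewrite divr_ge0// mulr_ge0 ?ltW.
have Np : 0 <= N by exact: le_trans N0N.
set Q := N * (L + G%:R * ln L).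
have GlL : 0 <= G%:R * ln L by rewrite mulr_ge0.
have Q0 : 0 <= Q by rewrite mulr_ge0// addr_ge0// ltW.
have s1 : Num.sqrt (H1 G * (N + eta * n%:R)) <= 9 * a%:R * 2 * Num.sqrt Q.
  have -> : 9 * a%:R * 2 * Num.sqrt Q = Num.sqrt ((9 * a%:R * 2) ^+ 2 * Q).
    by rewrite [RHS]sqrtrM ?sqr_ge0// sqrtr_sqr ger0_norm// !mulr_ge0.
  apply: ler_wsqrtr.
  apply: (@le_trans _ _ ((9 * a%:R * (L + G%:R * ln L)) * (2 * N))).
    apply: ler_pM.
    - by rewrite /H1 addr_ge0 ?(ltW L0)// !mulr_ge0.
    - by rewrite addr_ge0// mulr_ge0// invr_ge0 exprn_ge0// ltW.
    - rewrite /H1 natrM mulrDr -!mulrA lerD2r mulrA ler_peMl ?(ltW L0)//.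
    - by rewrite mulr_natl mulr2n lerD2l (le_trans etaN).
  have -> : 9 * a%:R * (L + G%:R * ln L) * (2 * N) = (9 * a%:R * 2) * Q by rewrite /Q; ring.
  rewrite ler_wpM2r// expr2 ler_peMl// (le_trans ler01).
have s2 : Num.sqrt (H2 * (eta * n%:R)) <= Num.sqrt Q.
  apply: ler_wsqrtr; apply: (le_trans H2N); apply: ler_pM => //; first exact: ltW.
  by rewrite lerDl.
by rewrite [leRHS]mulrDl lerD// ler_wpM2l.
Unshelve. all: by end_near. Qed.

(** * Least squares on a cell *)

Lemma continuous_coord_rV R (q : nat) (j : 'I_q) :
  continuous (fun v : 'rV[R]_q => v 0 j).
Proof. exact: coord_continuous. Qed.

Lemma continuous_qform R (q : nat) (A : 'M[R]_q) :
  continuous (fun v : 'rV[R]_q => \sum_i \sum_j v 0 i * A i j * v 0 j).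
Proof.
apply: continuous_big => [|i _]; first exact: add_continuous.
apply: continuous_big => [|j _ v]; first exact: add_continuous.
apply: (@continuousM _ _ (fun v : 'rV[R]_q => v 0 i * A i j) (fun v : 'rV[R]_q => v 0 j)).
  apply: (@continuousM _ _ (fun v : 'rV[R]_q => v 0 i) (cst (A i j))).
    exact: continuous_coord_rV.
  exact: cst_continuous.
exact: continuous_coord_rV.
Qed.

Lemma qformE R (q : nat) (A : 'M[R]_q) (u v : 'rV[R]_q) :
  (u *m A *m v^T) 0 0 = \sum_i \sum_j u 0 i * A i j * v 0 j.
Proof.
rewrite mxE exchange_big /=; apply: eq_bigr => j _.
by rewrite !mxE mulr_suml.
Qed.

Lemma sphere_compact R (q : nat) :
  compact [set v : 'rV[R]_q | \sum_i v 0 i ^+ 2 = 1].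
Proof.
apply: bounded_closed_compact.
  exists 1; split; first exact: num_real.
  move=> M M1 v /= v1; rewrite /Num.norm /= mx_normrE.
  apply: bigmax_le => [|[i j] _ /=]; first by rewrite (le_trans ler01)// ltW.
  rewrite ord1; apply: le_trans (ltW M1).
  rewrite -[leRHS]sqrtr1 -sqrtr_sqr ler_wsqrtr// -v1 (bigD1 j)//= lerDl.
  by apply: sumr_ge0 => k _; exact: sqr_ge0.
have cS : continuous (fun v : 'rV[R]_q => \sum_i v 0 i ^+ 2).
  apply: continuous_big => [|j _ v]; first exact: add_continuous.
  by apply: (@continuousM _ _ (fun v : 'rV[R]_q => v 0 j) (fun v : 'rV[R]_q => v 0 j));
    exact: continuous_coord_rV.
apply: (@preimage_closed _ _ (fun v : 'rV[R]_q => \sum_i v 0 i ^+ 2) [set r | r = 1]).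
  by move=> v _; exact: cS.
exact: closed_eq.
Qed.

Lemma sum_sqr_eq0 R (q : nat) (v : 'rV[R]_q) : \sum_i v 0 i ^+ 2 = 0 -> v = 0.
Proof.
move=> /eqP; rewrite psumr_eq0; last by move=> i _; exact: sqr_ge0.
move=> /allP v0; apply/rowP => j; rewrite mxE; apply/eqP.
by have := v0 j (mem_index_enum _); rewrite /= sqrf_eq0.
Qed.

(** The Rayleigh quotient attains its minimum [r] on the compact unit sphere, and the first
    variation shows that the minimizer is an eigenvector. The infimum of the eigenvalues is then at
    most [r]. *)
Lemma min_eigenvalue_qform R (q : nat) (A : 'M[R]_q.+1) (v : 'rV[R]_q.+1) :
  A^T = A -> min_eigenvalue A * (\sum_i v 0 i ^+ 2) <= (v *m A *m v^T) 0 0.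
Proof.
move=> symA; pose S := [set v : 'rV[R]_q.+1 | \sum_i v 0 i ^+ 2 = 1].
pose n2 (v : 'rV[R]_q.+1) := \sum_i v 0 i ^+ 2.
have n2_ge0 w : 0 <= n2 w by apply: sumr_ge0 => i _; exact: sqr_ge0.
have n2Z a w : n2 (a *: w) = a ^+ 2 * n2 w.
  by rewrite /n2 mulr_sumr; apply: eq_bigr => i _; rewrite mxE exprMn.
pose b (u w : 'rV[R]_q.+1) := (u *m A *m w^T) 0 0.
have bZ a w : b (a *: w) (a *: w) = a ^+ 2 * b w w.
  by rewrite /b linearZ /= -scalemxAl -scalemxAl -scalemxAr !mxE mulrA.
have bC u w : b u w = b w u.
  rewrite /b !qformE exchange_big /=; apply: eq_bigr => i _; apply: eq_bigr => j _.
  by rewrite -[in LHS]symA mxE; ring.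
have bD u w z : b (u + w) z = b u z + b w z by rewrite /b !mulmxDl mxE.
have bZl t u w : b (t *: u) w = t * b u w by rewrite /b -!scalemxAl mxE.
have dotD u w t : n2 (u + t *: w) = n2 u + 2 * t * (u *m w^T) 0 0 + t ^+ 2 * n2 w.
  rewrite /n2 [(u *m w^T) 0 0]mxE !mulr_sumr -!big_split /=; apply: eq_bigr => i _.
  by rewrite !mxE; ring.
have [|||v0 /set_mem v0S minv0] := @EVT_min_rV R q.+1 (fun w => b w w) S.
- exists (delta_mx 0 0); rewrite /S /= (bigD1 0)//= mxE !eqxx expr1n big1 ?addr0// => i i0.
  by rewrite mxE (negbTE i0) andbF expr0n.
- exact: sphere_compact.
- apply: continuous_subspaceT; rewrite /b; under eq_fun do rewrite qformE.
  exact: continuous_qform.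
pose r := b v0 v0.
have Hr w : r * n2 w <= b w w.
  have [w0|w0] := eqVneq (n2 w) 0.
    have -> : w = 0 by exact: sum_sqr_eq0.
    have n20 : n2 0 = 0 by rewrite /n2 big1// => i _; rewrite mxE expr0n.
    by rewrite n20 mulr0 /b mul0mx mul0mx mxE.
  have wp : 0 < n2 w by rewrite lt_neqAle eq_sym w0 n2_ge0.
  pose c := (Num.sqrt (n2 w))^-1.
  have c2 : c ^+ 2 * n2 w = 1 by rewrite exprVn sqr_sqrtr ?n2_ge0// mulVf.
  have := minv0 (c *: w); rewrite bZ => /(_ _)/(ler_wpM2r (n2_ge0 w)).
  rewrite -/r mulrAC c2 mul1r; apply.
  by apply/mem_set; rewrite /S /=; have := n2Z c w; rewrite /n2 => ->.
have orth w : b v0 w = r * (v0 *m w^T) 0 0.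
  pose be := b v0 w - r * (v0 *m w^T) 0 0; pose ga := b w w - r * n2 w.
  have ga0 : 0 <= ga by rewrite subr_ge0.
  have pos t : 0 <= 2 * t * be + t ^+ 2 * ga.
    have := Hr (v0 + t *: w); rewrite dotD bD !(bC _ (v0 + t *: w)) !bD !bZl.
    rewrite (bC v0 (t *: w)) (bC w (t *: w)) !bZl (bC w v0).
    rewrite (v0S : n2 v0 = 1) -/r; rewrite /be /ga; lra.
  (* At this [t] the quadratic would be negative unless [be = 0]; the [+ 1] allows for [ga = 0]. *)
  have := pos (- be / (ga + 1)).
  have -> : 2 * (- be / (ga + 1)) * be + (- be / (ga + 1)) ^+ 2 * ga =
      - (be ^+ 2 * (ga + 2) / (ga + 1) ^+ 2).
    by field; rewrite gt_eqF//; lra.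
  rewrite oppr_ge0 pmulr_lle0 ?invr_gt0 ?exprn_gt0//; last lra.
  rewrite pmulr_lle0; last lra.
  by rewrite real_exprn_even_le0 ?num_real//= subr_eq0 => /eqP.
have eig : eigenvalue A r.
  apply/eigenvalueP; exists v0; last first.
    apply/eqP => v00; move: v0S; rewrite /S /= v00 big1.
      by move/esym/eqP; rewrite oner_eq0.
    by move=> i _; rewrite mxE expr0n.
  apply/rowP => j; have := orth (delta_mx 0 j).
  by rewrite /b trmx_delta -!colE !mxE.
(* The infimum would be a default value if the eigenvalues were not bounded below. *)
have lb l : eigenvalue A l -> r <= l.
  move=> /eigenvalueP[u uA u0].
  have un : 0 < n2 u.
    rewrite lt_neqAle n2_ge0 andbT eq_sym; apply: contra u0 => /eqP/sum_sqr_eq0 ->; exact: eqxx.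
  have := Hr u; rewrite /b uA -scalemxAl mxE.
  have -> : (u *m u^T) 0 0 = n2 u by rewrite mxE; apply: eq_bigr => i _; rewrite mxE.
  by rewrite ler_pM2r.
apply: le_trans (Hr v); apply: ler_wpM2r; first exact: n2_ge0.
by apply: (@ge_inf _ [set l | eigenvalue A l]) => //; exists r => l /lb.
Qed.

(** * Euclidean norm and inner product *)

Lemma enorm_ge0 R p (v : 'rV[R]_p) : 0 <= enorm v.
Proof. exact: sqrtr_ge0. Qed.

Lemma enorm_sqr R p (v : 'rV[R]_p) : enorm v ^+ 2 = \sum_j v 0 j ^+ 2.
Proof. by rewrite sqr_sqrtr// sumr_ge0// => j _; exact: sqr_ge0. Qed.

Lemma dotC R p (u v : 'rV[R]_p) : dot u v = dot v u.
Proof. by apply: eq_bigr => j _; rewrite mulrC. Qed.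

Lemma dotDr R p (u v w : 'rV[R]_p) : dot u (v + w) = dot u v + dot u w.
Proof. by rewrite /dot -big_split /=; apply: eq_bigr => j _; rewrite mxE mulrDr. Qed.

Lemma dotZr R p (u v : 'rV[R]_p) (a : R) : dot u (a *: v) = a * dot u v.
Proof. by rewrite /dot mulr_sumr; apply: eq_bigr => j _; rewrite mxE mulrCA. Qed.

Lemma dotNr R p (u v : 'rV[R]_p) : dot u (- v) = - dot u v.
Proof. by rewrite -scaleN1r dotZr mulN1r. Qed.

Lemma dotBr R p (u v w : 'rV[R]_p) : dot u (v - w) = dot u v - dot u w.
Proof. by rewrite dotDr dotNr. Qed.

Lemma dotDl R p (u v w : 'rV[R]_p) : dot (u + v) w = dot u w + dot v w.
Proof. by rewrite ![dot _ w]dotC dotDr. Qed.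

Lemma dotNl R p (u v : 'rV[R]_p) : dot (- u) v = - dot u v.
Proof. by rewrite dotC dotNr dotC. Qed.

Lemma dotBl R p (u v w : 'rV[R]_p) : dot (u - v) w = dot u w - dot v w.
Proof. by rewrite dotDl dotNl. Qed.

Lemma dot_sumr R p (I : finType) (C : {set I}) (u : 'rV[R]_p)
    (F : I -> 'rV[R]_p) : dot u (\sum_(i in C) F i) = \sum_(i in C) dot u (F i).
Proof.
elim/big_rec2 : _ => [|i a v _ <-]; last by rewrite dotDr.
by rewrite -(scale0r 0) dotZr mul0r.
Qed.

Lemma dot_self R p (u : 'rV[R]_p) : dot u u = enorm u ^+ 2.
Proof. by rewrite enorm_sqr; apply: eq_bigr => j _; rewrite expr2. Qed.

Lemma enorm_eq0 R p (v : 'rV[R]_p) : enorm v = 0 -> v = 0.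
Proof. by move=> v0; apply: sum_sqr_eq0; rewrite -enorm_sqr v0 expr0n. Qed.

Lemma enorm_gt0 R p (v : 'rV[R]_p) : v != 0 -> 0 < enorm v.
Proof.
move=> v0; rewrite lt_neqAle enorm_ge0 andbT eq_sym; apply: contra v0 => /eqP/enorm_eq0 ->.
exact: eqxx.
Qed.

Lemma enormZ R p (a : R) (v : 'rV[R]_p) : enorm (a *: v) = `|a| * enorm v.
Proof.
rewrite /enorm -sqrtr_sqr -sqrtrM ?sqr_ge0// mulr_sumr; congr Num.sqrt.
by apply: eq_bigr => j _; rewrite mxE exprMn.
Qed.

Lemma enormN R p (v : 'rV[R]_p) : enorm (- v) = enorm v.
Proof. by rewrite -scaleN1r enormZ normrN1 mul1r. Qed.

Lemma cauchy_schwarz R p (u v : 'rV[R]_p) :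
  `|dot u v| <= enorm u * enorm v.
Proof.
have [->|u0] := eqVneq u 0; first by rewrite dot0l normr0 mulr_ge0 ?enorm_ge0.
have up := enorm_gt0 u0.
have sq : (dot u v) ^+ 2 <= (enorm u * enorm v) ^+ 2.
  have : 0 <= dot (enorm u ^+ 2 *: v - dot u v *: u) (enorm u ^+ 2 *: v - dot u v *: u).
    by rewrite dot_self sqr_ge0.
  rewrite !(dotBr, dotBl, dotZr) ![dot (_ *: _) _]dotC !dotZr !dot_self (dotC v u).
  set s := dot u v; set a := enorm u; set b := enorm v.
  move=> h; have : 0 <= a ^+ 2 * ((a * b) ^+ 2 - s ^+ 2).
    by apply: (le_trans h); rewrite le_eqVlt; apply/orP; left; apply/eqP; ring.
  by rewrite pmulr_rge0 ?exprn_gt0// subr_ge0.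
rewrite -(@ler_pXn2r _ 2)// ?nnegrE ?mulr_ge0 ?enorm_ge0//.
by rewrite real_normK ?num_real.
Qed.

Lemma enormD R p (u v : 'rV[R]_p) : enorm (u + v) <= enorm u + enorm v.
Proof.
rewrite -(@ler_pXn2r _ 2)// ?nnegrE ?addr_ge0 ?enorm_ge0//.
rewrite -dot_self !(dotDr, dotDl) !dot_self (dotC v u).
have := le_trans (ler_norm _) (cauchy_schwarz u v); lra.
Qed.

Lemma enormB R p (u v : 'rV[R]_p) : enorm (u - v) = enorm (v - u).
Proof. by rewrite -enormN opprB. Qed.

Lemma enorm_dist_triangle R p (v u w : 'rV[R]_p) :
  enorm (u - w) <= enorm (u - v) + enorm (v - w).
Proof. by rewrite -[u - w](_ : (u - v) + (v - w) = _) ?enormD// addrA subrK. Qed.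

Lemma coord_le_enorm R p (v : 'rV[R]_p) j : `|v 0 j| <= enorm v.
Proof.
rewrite -sqrtr_sqr ler_wsqrtr// (bigD1 j)//= lerDl.
by apply: sumr_ge0 => k _; exact: sqr_ge0.
Qed.

Lemma enorm_le_coord R p (v : 'rV[R]_p) (c : R) :
  0 <= c -> (forall j, `|v 0 j| <= c) -> enorm v <= p%:R * c.
Proof.
move=> c0 vc; have pc : 0 <= p%:R * c by rewrite mulr_ge0.
rewrite -(@ler_pXn2r _ 2)// ?nnegrE ?enorm_ge0// enorm_sqr.
apply: (@le_trans _ _ (\sum_(j < p) c ^+ 2)).
  by apply: ler_sum => j _; rewrite -(real_normK (num_real _)) lerXn2r ?nnegrE.
rewrite sumr_const card_ord -[leLHS]mulr_natl exprMn ler_wpM2r ?sqr_ge0//.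
by case: p {v vc pc} => [|p]; rewrite ?expr0n// expr2 ler_peMl// ler1n.
Qed.

(** The quadratic form of the Gram matrix at [(a, b)] is the sum of the squares of an affine
    function in coordinates centered at the empirical mean and scaled by the diameter; A4 bounds its
    empirical second moment from below. *)
Lemma gram_qform R p n (x : 'I_n -> 'rV[R]_p) (A : set 'rV[R]_p)
    (lam a : R) (b : 'rV[R]_p) :
  let C := obs_in x A in let xb := emp_mean x C in
  lam <= min_eigenvalue (#|C|%:R^-1 *: gram x A) ->
  lam * #|C|%:R * (a ^+ 2 + enorm b ^+ 2)
    <= \sum_(i in C) (a + (diam A)^-1 * dot b (x i - xb)) ^+ 2.
Proof.
move=> C xb le_lam; have [C0|C0] := posnP #|C|.
  by rewrite C0 mulr0 mul0r; apply: sumr_ge0 => i _; exact: sqr_ge0.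
have Cp : 0 < #|C|%:R :> R by rewrite ltr0n.
pose v : 'rV[R]_(1 + p) := row_mx a%:M b.
have n2v : \sum_i v 0 i ^+ 2 = a ^+ 2 + enorm b ^+ 2.
  rewrite big_split_ord /= big_ord1 enorm_sqr; congr (_ + _).
    by rewrite row_mxEl mxE.
  by apply: eq_bigr => j _; rewrite row_mxEr.
have vG i : (v *m Gamma x A i) 0 0 = a + (diam A)^-1 * dot b (x i - xb).
  rewrite mul_row_col mulmx1 mxE mxE; congr (_ + _); rewrite mxE /dot mulr_sumr.
  by apply: eq_bigr => j _; rewrite !mxE mulrCA.
have sym : (#|C|%:R^-1 *: gram x A)^T = #|C|%:R^-1 *: gram x A.
  rewrite linearZ /= /gram linear_sum /=; congr (_ *: _); apply: eq_bigr => i _.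
  by rewrite trmx_mul trmxK.
have qE : (v *m (#|C|%:R^-1 *: gram x A) *m v^T) 0 0 =
    #|C|%:R^-1 * \sum_(i in C) (a + (diam A)^-1 * dot b (x i - xb)) ^+ 2.
  rewrite -scalemxAr -scalemxAl mxE; congr (_ * _).
  rewrite /gram mulmx_sumr mulmx_suml summxE; apply: eq_bigr => i _.
  have -> : v *m (Gamma x A i *m (Gamma x A i)^T) *m v^T
      = (v *m Gamma x A i) *m (v *m Gamma x A i)^T by rewrite trmx_mul !mulmxA.
  by rewrite -vG expr2 [LHS]mxE big_ord1 [X in _ * X]mxE.
have n2_ge0 : 0 <= a ^+ 2 + enorm b ^+ 2 by rewrite addr_ge0// sqr_ge0.
have := @min_eigenvalue_qform R p (#|C|%:R^-1 *: gram x A) v sym.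
rewrite n2v qE => H; rewrite mulrAC -ler_pdivlMr//.
rewrite [leRHS]mulrC; apply: le_trans H.
exact: ler_wpM2r.
Qed.

Lemma sum_centered R p n (x : 'I_n -> 'rV[R]_p) (C : {set 'I_n})
    (u : 'rV[R]_p) : (0 < #|C|)%N -> \sum_(i in C) dot u (x i - emp_mean x C) = 0.
Proof.
move=> C0; under eq_bigr do rewrite dotBr.
rewrite sumrB sumr_const /emp_mean dotZr dot_sumr -[X in _ - X]mulr_natl mulrA divff ?mul1r ?subrr//.
by rewrite pnatr_eq0 -lt0n.
Qed.

Lemma emp_mean_dist R p n (x : 'I_n -> 'rV[R]_p) (C : {set 'I_n})
    (v : 'rV[R]_p) (d : R) : (0 < #|C|)%N -> (forall i, i \in C -> enorm (x i - v) <= d) ->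
  enorm (emp_mean x C - v) <= d.
Proof.
move=> C0 Cd; have Cp : 0 < #|C|%:R :> R by rewrite ltr0n.
have -> : emp_mean x C - v = #|C|%:R^-1 *: \sum_(i in C) (x i - v).
  rewrite sumrB sumr_const scalerBr; congr (_ - _).
  by rewrite -[v *+ #|C|]scaler_nat scalerA mulVf ?scale1r ?gt_eqF.
rewrite enormZ ger0_norm ?invr_ge0// ler_pdivrMl// mulr_natl.
apply: (@le_trans _ _ (\sum_(i in C) enorm (x i - v))).
  elim/big_rec2 : _ => [|i s w _ H]; first by rewrite -(scale0r 0) enormZ normr0 mul0r.
  by apply: le_trans (enormD _ _) _; rewrite lerD2l.
by rewrite -sumr_const; apply: ler_sum.
Qed.

(* The scaled projections on [u] are centered and bounded by [|u|], so that a
   second moment of at least [lam |u|^2] forces a large positive value. *)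
Lemma fat_cell R p n (x : 'I_n -> 'rV[R]_p) (A : set 'rV[R]_p)
    (lam : R) (u : 'rV[R]_p) :
  let C := obs_in x A in let xb := emp_mean x C in
  0 < lam -> lam <= min_eigenvalue (#|C|%:R^-1 *: gram x A) -> (0 < #|C|)%N -> 0 < diam A ->
  (forall i, i \in C -> enorm (x i - xb) <= diam A) ->
  exists2 i, i \in C & lam / 2 * diam A * enorm u <= dot u (x i - xb).
Proof.
move=> C xb lam0 le_lam C0 d0 Cd; set d := diam A in d0 Cd *.
have Cp : 0 < #|C|%:R :> R by rewrite ltr0n.
have [u0|u0] := eqVneq u 0.
  by have /card_gt0P[i iC] := C0; exists i; rewrite // u0 dot0l -(scale0r 0) enormZ normr0 mul0r mulr0.
have up := enorm_gt0 u0.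
pose w i := d^-1 * dot u (x i - xb).
have sw : \sum_(i in C) w i = 0 by rewrite -mulr_sumr sum_centered// mulr0.
have wu i : i \in C -> `|w i| <= enorm u.
  move=> iC; rewrite normrM gtr0_norm ?invr_gt0// ler_pdivrMl// mulrC.
  by apply: (le_trans (cauchy_schwarz _ _)); rewrite ler_wpM2l ?enorm_ge0// Cd.
have := gram_qform 0 u le_lam; rewrite expr0n add0r -/C -/xb -/d.
under eq_bigr do rewrite add0r -/(w _); move=> big.
apply/exists_inP; apply: contraT => /exists_inPn no.
have {}no i : i \in C -> w i < lam / 2 * enorm u.
  by move=> /no; rewrite -ltNge /w => h; rewrite ltr_pdivrMl// mulrA [d * _]mulrC.
have m0 : 0 < lam / 2 * enorm u by rewrite mulr_gt0// divr_gt0.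
suff : \sum_(i in C) w i ^+ 2 < lam * #|C|%:R * enorm u ^+ 2 by rewrite ltNge big.
(* Since the [w i] sum to 0, the sum of their absolute values is twice that of their positive parts,
   and each is at most [enorm u] in absolute value. *)
have le1 : \sum_(i in C) w i ^+ 2 <= enorm u * \sum_(i in C) (2 * Num.max (w i) 0 - w i).
  rewrite mulr_sumr; apply: ler_sum => i iC; have := wu i iC.
  have -> : 2 * Num.max (w i) 0 - w i = `|w i|.
    have [w0|w0] := leP (w i) 0; first by rewrite ler0_norm//; lra.
    by rewrite gtr0_norm//; lra.
  by move=> h; rewrite -(real_normK (num_real _)) expr2 ler_wpM2r.
apply: (le_lt_trans le1).
rewrite sumrB sw subr0 expr2 mulrA mulrC ltr_pM2r//.
rewrite [ltRHS](_ : _ = \sum_(i in C) 2 * (lam / 2 * enorm u)); last first.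
  by rewrite sumr_const -mulr_natl; field.
have /card_gt0P[i0 i0C] := C0.
rewrite (bigD1 i0)//= [ltRHS](bigD1 i0)//=; apply: ltr_leD.
  by rewrite ltr_pM2l// gt_max no.
by apply: ler_sum => i /andP[iC _]; rewrite ler_pM2l// ge_max ltW ?no// ltW.
Qed.

(* Summation by parts: a weighted sum with weights in [0, M] is an average of
   its sums over the super-level sets of the weights. *)
Lemma threshold_sum R (I : finType) (C : {set I}) (w e : I -> R) (M U : R) :
  0 <= M -> (forall i, i \in C -> 0 <= w i <= M) ->
  (forall t, `|\sum_(i in C | t < w i) e i| <= U) ->
  `|\sum_(i in C) w i * e i| <= M * U.
Proof.
have [k] := ubnP #|[set i in C | 0 < w i]%SET|.
elim: k => // k IH in w M * => /ltnSE lek M0 wM eU.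
have U0 : 0 <= U by apply: le_trans (eU 0).
have [/eqP|/card_gt0P[i0]] := posnP #|[set i in C | 0 < w i]%SET|.
  rewrite cards_eq0 => /eqP S0; rewrite big1 ?normr0 ?mulr_ge0// => i iC.
  have /finset.setP/(_ i) := S0; rewrite !inE iC /= => /negbT; rewrite -leNgt => wi.
  by have /andP[wi0 _] := wM i iC; rewrite (le_anti (_ : w i <= 0 <= w i)) ?mul0r// wi wi0.
rewrite inE => /andP[i0C wi0].
pose mu := \big[Num.min/w i0]_(i in C | 0 < w i) w i.
have mu_le i : i \in C -> 0 < w i -> mu <= w i.
  by move=> iC wi; rewrite /mu (bigD1 i) ?iC//= ge_min lexx.
have mu0 : 0 < mu.
  by rewrite /mu; elim/big_ind : _ => // [a b a0 b0|i /andP[]]//; rewrite lt_min a0.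
have [i1 i1C [wi1 mu1]] : exists2 i1, i1 \in C & 0 < w i1 /\ mu = w i1.
  rewrite /mu; elim/big_ind : _ => [|a b [i iC [wi ->]] [j jC [wj ->]]|i /andP[iC wi]].
  - by exists i0.
  - by rewrite /Num.min; case: ifP => _; [exists i|exists j].
  - by exists i.
have muM : mu <= M by rewrite mu1; have /andP[] := wM i1 i1C.
(* The lowest positive level [mu] is peeled off: it multiplies the sum over the support of [w], and
   the remainder has a smaller support and values at most [M - mu]. *)
pose w' i := Num.max (w i - mu) 0.
have split1 : \sum_(i in C) w i * e i = mu * (\sum_(i in C | 0 < w i) e i) + \sum_(i in C) w' i * e i.
  rewrite mulr_sumr big_mkcondr -big_split /=; apply: eq_bigr => i iC.
  have /andP[wi _] := wM i iC; rewrite /w'; case: (ltrP 0 (w i)) => wi'.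
    by rewrite max_l ?subr_ge0 ?mu_le//; ring.
  have -> : w i = 0 by apply/le_anti/andP.
  by rewrite max_r ?mul0r ?addr0// sub0r oppr_le0 ltW.
have := IH w' (M - mu); rewrite subr_ge0 muM => H.
rewrite split1; apply: (le_trans (ler_normD _ _)).
have -> : M * U = mu * U + (M - mu) * U by ring.
apply: lerD; first by rewrite normrM gtr0_norm// ler_wpM2l// ltW.
apply: H => //.
- apply: leq_trans lek; apply: proper_card; apply/properP; split.
    apply/fintype.subsetP => i; rewrite !inE => /andP[iC]; rewrite iC /= /w' lt_max ltxx orbF subr_gt0.
    exact: lt_trans.
  by exists i1; rewrite !inE i1C //= /w' lt_max ltxx orbF subr_gt0 mu1 ltxx.
- move=> i iC; have /andP[wi wiM] := wM i iC.
  by rewrite /w' le_max lexx orbT ge_max subr_ge0 muM andbT lerD2r.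
move=> t; have [t0|t0] := leP 0 t.
  rewrite (eq_bigl (fun i => (i \in C) && (t + mu < w i))) ?eU// => i.
  by rewrite /w' lt_max ltrBrDr [t < 0]ltNge t0 orbF.
(* Below level 0 the super-level set is all of [C]; any negative threshold expresses it. *)
rewrite (eq_bigl (fun i => (i \in C) && (-1 < w i))) ?eU// => i.
case iC : (i \in C) => //=; have /andP[wi _] := wM i iC.
rewrite /w' lt_max t0 orbT; apply/esym; exact: lt_le_trans wi.
Qed.

Lemma linear_term_eq0 R (be ga : R) :
  0 <= ga -> (forall t, 0 <= t ^+ 2 * ga - 2 * t * be) -> be = 0.
Proof.
move=> ga0 /(_ (be / (ga + 1))).
have -> : (be / (ga + 1)) ^+ 2 * ga - 2 * (be / (ga + 1)) * be =
    - (be ^+ 2 * (ga + 2) / (ga + 1) ^+ 2).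
  by field; rewrite gt_eqF//; lra.
rewrite oppr_ge0 pmulr_lle0 ?invr_gt0 ?exprn_gt0//; last lra.
rewrite pmulr_lle0; last lra.
by rewrite real_exprn_even_le0 ?num_real//= => /eqP.
Qed.

Lemma least_squares_orthogonal R p n (x : 'I_n -> 'rV[R]_p)
    (y : 'I_n -> R) (C : {set 'I_n}) (alpha a : R) (beta b : 'rV[R]_p) :
  least_squares x y C alpha beta ->
  \sum_(i in C) (y i - alpha - dot beta (x i)) * (a + dot b (x i)) = 0.
Proof.
move=> ls; pose q i := a + dot b (x i); pose r i := y i - alpha - dot beta (x i).
apply: (@linear_term_eq0 _ _ (\sum_(i in C) q i ^+ 2)).
  by apply: sumr_ge0 => i _; exact: sqr_ge0.
move=> t; have := ls (alpha + t * a) (beta + t *: b).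
rewrite -subr_ge0 -sumrB => h; apply: (le_trans h).
rewrite !mulr_sumr -sumrB le_eqVlt; apply/orP; left; apply/eqP; apply: eq_bigr => i _.
by rewrite dotDl [dot (_ *: _) _]dotC dotZr (dotC (x i)) /q; ring.
Qed.

(** The normal equations are tested against the difference [q] between the fitted and the reference
    plane. With [th] the scaled size of [q], A4 bounds the sum of squares below by [lam #|C| th^2],
    while bias and noise contribute terms linear in [th]. Dividing by [th] bounds both the value at
    the mean and [d] times the slope. *)
Lemma least_squares_error R p n (x : 'I_n -> 'rV[R]_p) (y e : 'I_n -> R)
    (A : set 'rV[R]_p) (lam eta U alpha a0 : R) (beta g : 'rV[R]_p) :
  let C := obs_in x A in let xb := emp_mean x C in let d := diam A in
  0 < lam -> lam <= min_eigenvalue (#|C|%:R^-1 *: gram x A) -> (0 < #|C|)%N -> 0 < d ->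
  (forall i, i \in C -> enorm (x i - xb) <= d) -> least_squares x y C alpha beta ->
  (forall i, i \in C -> `|y i - e i - (a0 + dot g (x i))| <= eta * d) ->
  `|\sum_(i in C) e i| <= U -> (forall j t, `|\sum_(i in C | t < x i 0 j) e i| <= U) ->
  let E := (2 * eta * d + (1 + 3 * p%:R) * U / #|C|%:R) / lam in
  forall v, `|alpha + dot beta v - (a0 + dot g v)| <= E + E / d * enorm (v - xb).
Proof.
move=> C xb d lam0 le_lam C0 d0 Cd ls bias eU eUt E v.
have Cp : 0 < #|C|%:R :> R by rewrite ltr0n.
have U0 : 0 <= U by apply: le_trans eU.
have [i0 i0C] := card_gt0P C0.
have eta0 : 0 <= eta by have := le_trans (normr_ge0 _) (bias i0 i0C); rewrite pmulr_lge0.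
pose b := beta - g; pose a := alpha - a0 + dot b xb.
pose q i := a + dot b (x i - xb).
pose th := Num.sqrt (a ^+ 2 + d ^+ 2 * enorm b ^+ 2).
have th0 : 0 <= th by exact: sqrtr_ge0.
have th2 : th ^+ 2 = a ^+ 2 + d ^+ 2 * enorm b ^+ 2.
  by rewrite sqr_sqrtr// addr_ge0 ?sqr_ge0// mulr_ge0 ?sqr_ge0.
have a_th : `|a| <= th.
  by rewrite -sqrtr_sqr ler_wsqrtr// lerDl mulr_ge0 ?sqr_ge0.
have b_th : d * enorm b <= th.
  rewrite -[leLHS]ger0_norm ?mulr_ge0 ?enorm_ge0 ?(ltW d0)// -sqrtr_sqr ler_wsqrtr//.
  by rewrite exprMn lerDr sqr_ge0.
have qE i : q i = alpha - a0 + dot b (x i) by rewrite /q /a dotBr; ring.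
pose f i := y i - (a0 + dot g (x i)).
have normal : \sum_(i in C) q i ^+ 2 = \sum_(i in C) f i * q i.
  apply/eqP; rewrite eq_sym -subr_eq0 -sumrB; apply/eqP.
  rewrite -[RHS](least_squares_orthogonal (alpha - a0) b ls); apply: eq_bigr => i _.
  by rewrite qE /f /b dotBl; ring.
have quad : lam * #|C|%:R * th ^+ 2 <= \sum_(i in C) q i ^+ 2.
  have := gram_qform a (d *: b) le_lam; rewrite -/C -/xb -/d enormZ exprMn real_normK ?num_real// -th2.
  move=> h; apply: (le_trans h); rewrite le_eqVlt; apply/orP; left; apply/eqP.
  apply: eq_bigr => i _; rewrite [dot (_ *: _) _]dotC dotZr mulrA mulVf ?gt_eqF// mul1r.
  by rewrite /q dotC.
have q_th i : i \in C -> `|q i| <= 2 * th.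
  move=> iC; apply: (le_trans (ler_normD _ _)); have := cauchy_schwarz b (x i - xb).
  have : enorm b * enorm (x i - xb) <= enorm b * d by rewrite ler_wpM2l ?enorm_ge0 ?Cd.
  by rewrite [enorm b * d]mulrC; lra.
have biasS : `|\sum_(i in C) (f i - e i) * q i| <= 2 * eta * d * #|C|%:R * th.
  apply: (le_trans (ler_norm_sum _ _ _)).
  apply: (@le_trans _ _ (\sum_(i in C) eta * d * (2 * th))).
    apply: ler_sum => i iC; rewrite normrM; apply: ler_pM; rewrite ?normr_ge0 ?q_th//.
    by rewrite /f addrAC; exact: bias.
  by rewrite sumr_const -mulr_natl le_eqVlt; apply/orP; left; apply/eqP; ring.
have coordS j : `|\sum_(i in C) (x i - xb) 0 j * e i| <= 3 * d * U.
  have xd i : i \in C -> `|(x i - xb) 0 j| <= d.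
    by move=> iC; apply: le_trans (Cd i iC); exact: coord_le_enorm.
  (* Shifting by [d] puts the weights in [[0, 2 d]], so that [threshold_sum] reduces them to axis
     cuts; the shift costs one more [d * U], whence the 3. *)
  have -> : \sum_(i in C) (x i - xb) 0 j * e i =
      \sum_(i in C) ((x i - xb) 0 j + d) * e i - d * \sum_(i in C) e i.
    by rewrite mulr_sumr -sumrB; apply: eq_bigr => i _; ring.
  have h1 : `|\sum_(i in C) ((x i - xb) 0 j + d) * e i| <= 2 * d * U.
    apply: threshold_sum; first by rewrite mulr_ge0// ltW.
      by move=> i /xd; rewrite ler_norml => /andP[? ?]; apply/andP; split; lra.
    move=> t; rewrite (eq_bigl (fun i => (i \in C) && (t - d + xb 0 j < x i 0 j)))//.
    move=> i; rewrite !mxE; congr (_ && _); apply/idP/idP; lra.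
  have h2 : `|d * \sum_(i in C) e i| <= d * U by rewrite normrM gtr0_norm// ler_wpM2l// ltW.
  by apply: (le_trans (ler_normB _ _)); lra.
have noiseS : `|\sum_(i in C) e i * q i| <= (1 + 3 * p%:R) * U * th.
  have -> : \sum_(i in C) e i * q i = a * \sum_(i in C) e i +
      \sum_(j < p) b 0 j * \sum_(i in C) (x i - xb) 0 j * e i.
    under [X in _ + X]eq_bigr do rewrite mulr_sumr.
    rewrite exchange_big /= mulr_sumr -big_split /=; apply: eq_bigr => i _.
    rewrite /q mulrDr mulrC; congr (_ + _); rewrite /dot mulr_sumr; apply: eq_bigr => j _; ring.
  apply: (le_trans (ler_normD _ _)).
  have h1 : `|a * \sum_(i in C) e i| <= th * U by rewrite normrM; apply: ler_pM.
  have h2 : `|\sum_(j < p) b 0 j * \sum_(i in C) (x i - xb) 0 j * e i| <= p%:R * (3 * U * th).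
    apply: (le_trans (ler_norm_sum _ _ _)).
    apply: (@le_trans _ _ (\sum_(j < p) 3 * U * th)); last by rewrite sumr_const card_ord -[leLHS]mulr_natl.
    apply: ler_sum => j _; rewrite normrM.
    apply: (@le_trans _ _ (enorm b * (3 * d * U))).
      by apply: ler_pM => //; exact: coord_le_enorm.
    have -> : enorm b * (3 * d * U) = 3 * U * (d * enorm b) by ring.
    by rewrite ler_wpM2l// mulr_ge0.
  by apply: (le_trans (lerD h1 h2)); rewrite le_eqVlt; apply/orP; left; apply/eqP; ring.
have thE : th <= E.
  have key : lam * #|C|%:R * th ^+ 2 <= (2 * eta * d * #|C|%:R + (1 + 3 * p%:R) * U) * th.
    apply: (le_trans quad); rewrite normal.
    have -> : \sum_(i in C) f i * q i = \sum_(i in C) (f i - e i) * q i + \sum_(i in C) e i * q i.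
      by rewrite -big_split /=; apply: eq_bigr => i _; ring.
    rewrite mulrDl; apply: lerD; exact: le_trans (ler_norm _) _.
  have [->|thn0] := eqVneq th 0.
    by rewrite divr_ge0 ?(ltW lam0)// addr_ge0 ?divr_ge0 ?mulr_ge0 ?addr_ge0 ?mulr_ge0// ltW.
  have thp : 0 < th by rewrite lt_neqAle eq_sym thn0.
  move: key; rewrite expr2 mulrA ler_pM2r// => key.
  rewrite /E ler_pdivlMr// -(ler_pM2r Cp) mulrDl divfK ?gt_eqF//; lra.
have -> : alpha + dot beta v - (a0 + dot g v) = a + dot b (v - xb).
  by rewrite /a /b dotBr !dotBl; ring.
apply: (le_trans (ler_normD _ _)); apply: lerD; first exact: le_trans thE.
apply: (le_trans (cauchy_schwarz _ _)); rewrite ler_wpM2r ?enorm_ge0//.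
by rewrite ler_pdivlMr// mulrC; exact: le_trans thE.
Qed.

(** * Convex functions *)

Lemma convex_combination R p (XX : set 'rV[R]_p) (x y : 'rV[R]_p) (t : R) :
  convex_set XX -> XX x -> XX y -> 0 <= t <= 1 -> XX (x + t *: (y - x)).
Proof.
move=> cX Xx Xy /andP[t0 t1].
have : XX (t *: y + (1 - t) *: x) := set_mem (cX y x (Itv01 t0 t1) (mem_set Xy) (mem_set Xx)).
by rewrite scalerBl scale1r scalerBr addrCA.
Qed.

Lemma convex_function_le R p (XX : set 'rV[R]_p) (f : 'rV[R]_p -> R)
    (x y : 'rV[R]_p) (t : R) :
  convex_function XX f -> XX x -> XX y -> 0 <= t <= 1 ->
  f (x + t *: (y - x)) <= f x + t * (f y - f x).
Proof.
move=> cf Xx Xy /andP[t0 t1].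
have : f (t *: y + (1 - t) *: x) <= t * f y + (1 - t) * f x :=
  cf (Itv01 t0 t1) y x (mem_set Xy) (mem_set Xx).
have -> : t *: y + (1 - t) *: x = x + t *: (y - x) by rewrite scalerBl scale1r scalerBr addrCA.
by move=> h; apply: (le_trans h); rewrite le_eqVlt; apply/orP; left; apply/eqP; ring.
Qed.

Lemma enorm_le_norm R p (v : 'rV[R]_p) : enorm v <= p%:R * `|v|.
Proof.
apply: enorm_le_coord => // j; rewrite /Num.norm /= mx_normrE.
exact: (@le_bigmax _ _ _ 0 (fun i : 'I_1 * 'I_p => `|v i.1 i.2|) (0, j)).
Qed.

Lemma norm_le_enorm R p (v : 'rV[R]_p) : `|v| <= enorm v.
Proof.
rewrite /Num.norm /= mx_normrE; apply: bigmax_le => [|[i j] _ /=]; first exact: enorm_ge0.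
by rewrite ord1; exact: coord_le_enorm.
Qed.

Lemma first_order_convex R p (XX : set 'rV[R]_p) (f : 'rV[R]_p -> R)
    (g x y : 'rV[R]_p) :
  convex_set XX -> convex_function XX f -> XX x -> XX y ->
  (forall e, 0 < e -> \forall z \near within XX (nbhs x),
      `|f z - f x - dot g (z - x)| <= e * enorm (z - x)) ->
  f x + dot g (y - x) <= f y.
Proof.
move=> cX cf Xx Xy dg; apply/ler_addgt0Pr => e e0.
pose e' := e / (1 + enorm (y - x)).
have n0 : 0 < 1 + enorm (y - x) by rewrite ltr_pwDl// enorm_ge0.
have e'0 : 0 < e' by rewrite divr_gt0.
have /nbhs_ballP[r /= r0 Hr] := dg e' e'0.
pose t := Num.min 1 (r / (2 * (1 + enorm (y - x)))).
have t0 : 0 < t by rewrite lt_min ltr01 divr_gt0// mulr_gt0.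
have t1 : t <= 1 by rewrite ge_min lexx.
have tr : t * enorm (y - x) < r.
  apply: (@le_lt_trans _ _ (r / (2 * (1 + enorm (y - x))) * enorm (y - x))).
    by rewrite ler_wpM2r ?enorm_ge0// ge_min lexx orbT.
  rewrite mulrAC ltr_pdivrMr ?mulr_gt0// ltr_pM2l//; have := enorm_ge0 (y - x); lra.
pose z := x + t *: (y - x).
have zx : z - x = t *: (y - x) by rewrite /z addrAC subrr add0r.
have Xz : XX z by apply: convex_combination => //; rewrite (ltW t0) t1.
have bz : ball x r z.
  rewrite -ball_normE /ball_ /= -normrN opprB zx; apply: le_lt_trans tr.
  by apply: (le_trans (norm_le_enorm _)); rewrite enormZ ger0_norm// ltW.
have := Hr z bz Xz; rewrite zx dotZr enormZ (gtr0_norm t0) ler_norml => /andP[h1 _].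
have h2 : f z <= f x + t * (f y - f x) by apply: convex_function_le => //; rewrite (ltW t0) t1.
have h3 : e' * enorm (y - x) <= e.
  by rewrite /e' mulrAC ler_pdivrMr// ler_pM2l//; lra.
have h4 : t * (dot g (y - x)) <= t * (f y - f x + e' * enorm (y - x)).
  by rewrite mulrDr; lra.
by rewrite ler_pM2l// in h4; lra.
Qed.

Lemma uniform_continuity_compact R p (XX : set 'rV[R]_p)
    (g : 'rV[R]_p -> 'rV[R]_p) (eta : R) :
  compact XX -> {within XX, continuous g} -> 0 < eta ->
  exists2 delta, 0 < delta & forall x y, XX x -> XX y -> enorm (y - x) <= delta ->
    enorm (g y - g x) <= eta.
Proof.
move=> /compact_near_coveringP cX /subspace_continuousP cg eta0.
pose Q (delta : R) x := XX x -> forall y, XX y -> enorm (y - x) <= delta -> enorm (g y - g x) <= eta.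
have : \forall delta \near 0^'+, XX `<=` Q delta.
  apply: (cX R (0^'+) Q) => x Xx.
  pose e := eta / (2 * (1 + p%:R)).
  have p0 : 0 < 1 + p%:R :> R by rewrite ltr_pwDl.
  have e0 : 0 < e by rewrite divr_gt0// mulr_gt0.
  have /cvgrPdist_lt/(_ e e0)/nbhs_ballP[r /= r0 Hr] := cg x Xx.
  have close z : XX z -> ball x r z -> enorm (g z - g x) <= eta / 2.
    move=> Xz bz; apply: (le_trans (enorm_le_norm _)); rewrite -normrN opprB.
    apply: (@le_trans _ _ (p%:R * e)); first by rewrite ler_wpM2l// ltW// Hr.
    rewrite /e mulrA ler_pdivrMr ?mulr_gt0//.
    have -> : eta / 2 * (2 * (1 + p%:R)) = eta * (1 + p%:R) by field.
    by rewrite mulrDr mulr1 [p%:R * _]mulrC lerDr ltW.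
  exists (ball x (r / 2), [set d | d < r / 2]).
    split; first by apply: nbhsx_ballx; rewrite divr_gt0.
    by apply: nbhs_right_lt; rewrite divr_gt0.
  move=> [x' d] /= [bx' dr] Xx' y Xy yx'.
  have bx'r : ball x r x' by apply: le_ball bx'; lra.
  have byr : ball x r y.
    move: bx'; rewrite -!ball_normE /ball_ /= => bx'.
    have := ler_distD x' x y; have := norm_le_enorm (y - x').
    rewrite -[`|y - x'|]normrN opprB; lra.
  apply: (le_trans (enorm_dist_triangle (g x) _ _)).
  by rewrite (enormB (g x)); have := close y Xy byr; have := close x' Xx' bx'r; lra.
move=> near0; near (0 : R)^'+ => delta.
exists delta => // x y Xx Xy yx; suff : Q delta x by apply.
by have /(_ x Xx) : XX `<=` Q delta by near: delta.
Unshelve. all: by end_near. Qed.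

(** Differentiability is only pointwise. By the subgradient inequalities at both ends, the remainder
    lies between 0 and the inner product of [grad y - grad x] with [y - x], so uniform continuity of
    the gradient on the compact set makes it uniform. *)
Lemma convex_uniform_taylor R p (XX : set 'rV[R]_p) (f : 'rV[R]_p -> R) :
  convex_set XX -> convex_function XX f -> compact XX -> continuously_differentiable_on XX f ->
  exists grad : 'rV[R]_p -> 'rV[R]_p,
    (forall x y, XX x -> XX y -> f x + dot (grad x) (y - x) <= f y) /\
    forall eta, 0 < eta -> exists2 delta, 0 < delta &
      forall x y, XX x -> XX y -> enorm (y - x) <= delta ->
        `|f y - f x - dot (grad x) (y - x)| <= eta * enorm (y - x).
Proof.
move=> cX cf kX [grad [cg dg]]; exists grad.
have sub x y : XX x -> XX y -> f x + dot (grad x) (y - x) <= f y.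
  by move=> Xx Xy; apply: (first_order_convex cX cf Xx Xy) => e; exact: dg.
split=> // eta eta0.
have [delta d0 Hd] := uniform_continuity_compact kX cg eta0.
exists delta => // x y Xx Xy yx.
have h1 := sub x y Xx Xy; have h2 := sub y x Xy Xx.
rewrite ger0_norm; last lra.
apply: (@le_trans _ _ (dot (grad y - grad x) (y - x))).
  by rewrite dotBl; move: h2; rewrite -[x - y]opprB dotNr; lra.
apply: le_trans (ler_norm _) _; apply: (le_trans (cauchy_schwarz _ _)).
by rewrite ler_wpM2r ?enorm_ge0// Hd.
Qed.

(** * Geometry of the partition *)

Definition axis_cut R p (A B : set 'rV[R]_p) : Prop :=
  exists (q : 'I_p) (b : R),
    (forall v, A v -> v 0 q <= b) /\ (forall v, B v -> b < v 0 q) \/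
    (forall v, B v -> v 0 q <= b) /\ (forall v, A v -> b < v 0 q).

Lemma axis_cut_sub R p (A B A' B' : set 'rV[R]_p) :
  A' `<=` A -> B' `<=` B -> axis_cut A B -> axis_cut A' B'.
Proof.
move=> sA sB [q [b [[hA hB]|[hB hA]]]]; exists q, b; [left|right].
  by split=> v ?; [apply/hA/sA|apply/hB/sB].
by split=> v ?; [apply/hB/sB|apply/hA/sA].
Qed.

Lemma axis_cut_sym R p (A B : set 'rV[R]_p) :
  axis_cut A B -> axis_cut B A.
Proof. by move=> [q [b [|]]]; exists q, b; tauto. Qed.

(* Refitting makes the cells the regions where each plane of [g] attains the
   maximum; later splits only cut these regions along coordinate directions. *)
Definition refines_induced R p (XX : set 'rV[R]_p)
    tie (J : Type) (A : J -> set 'rV[R]_p)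
    (g : model R p) (lab : J -> 'I_(msize g).+1) : Prop :=
  [/\ forall k v, A k v -> XX v /\ tie _ (maximizers g v) = lab k,
      forall v, XX v -> exists k, A k v,
      forall k k', k <> k' -> lab k = lab k' -> axis_cut (A k) (A k')
    & forall l, exists k, lab k = l].

Lemma refines_induced_split R (p K : nat) (XX : set 'rV[R]_p)
    tie (A : 'I_K.+1 -> set 'rV[R]_p)
    (g : model R p) (lab : 'I_K.+1 -> 'I_(msize g).+1) (k : 'I_K.+1) (j : 'I_p) (b : R) :
  refines_induced XX tie A lab ->
  exists lab' : 'I_K.+2 -> 'I_(msize g).+1,
    refines_induced XX tie (split_cells A k j b) lab'.
Proof.
move=> [inA covA cutA surA].
pose o (i : 'I_K.+2) := if unlift ord_max i is Some i' then i' else k.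
have sub i : split_cells A k j b i `<=` A (o i).
  rewrite /split_cells /o; case: unliftP => [i' _|_] v; last by case.
  by case: eqP => [->|_] // [].
exists (fun i => lab (o i)); split.
- by move=> i v /sub /inA.
- move=> v /covA[i Aiv]; have [ik|nik] := eqVneq i k; last first.
    by exists (lift ord_max i); rewrite /split_cells liftK (negbTE nik).
  rewrite {}ik in Aiv; have [vb|vb] := leP (v 0 j) b.
    by exists (lift ord_max k); rewrite /split_cells liftK eqxx.
  by exists ord_max; rewrite /split_cells unlift_none.
- have key i : o (lift ord_max i) = i by rewrite /o liftK.
  have keyN : o ord_max = k by rewrite /o unlift_none.
  have new i : lab i = lab k ->
      axis_cut (split_cells A k j b (lift ord_max i)) (split_cells A k j b ord_max).
    move=> li; have [->|/eqP nik] := eqVneq i k.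
      exists j, b; left; rewrite /split_cells liftK eqxx unlift_none.
      by split=> v [].
    apply: axis_cut_sub (cutA _ _ nik li); first by have := sub (lift ord_max i); rewrite key.
    by have := sub ord_max; rewrite keyN.
  move=> i i' ii' ll; move: ii' ll.
  case: (unliftP ord_max i) => [i1|] ->; case: (unliftP ord_max i') => [i2|] ->.
  + rewrite !key => ne ll; apply: axis_cut_sub (cutA i1 i2 _ ll).
    * by have := sub (lift ord_max i1); rewrite key.
    * by have := sub (lift ord_max i2); rewrite key.
    * by move=> e; apply: ne; rewrite e.
  + by rewrite key keyN => _ /new.
  + by rewrite key keyN => _ /esym /new /axis_cut_sym.
  + by [].
by move=> l; have [i <-] := surA l; exists (lift ord_max i); rewrite /o liftK.
Qed.

(** These invariants are all that is retained of the algorithm. A rejected refit keeps the split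
    model, which refines the previous induced partition; an accepted one starts afresh, with [g] the
    model before refitting and the identity as labels. The initial model may violate the minimal
    size, but then its cell holds all the data. *)
Lemma cap_run_model R (p n L : nat) (XX : set 'rV[R]_p) (D : R)
    (a : 'I_L -> R) tie
    (x : 'I_n -> 'rV[R]_p) (y : 'I_n -> R) (Ms : nat -> model R p) (N K : nat) :
  (forall i, XX (x i)) -> cap_run XX D a tie x y Ms N -> (K <= N)%N ->
  [/\ fitted x y (Ms K),
      exists (g : model R p) (lab : 'I_(msize (Ms K)).+1 -> 'I_(msize g).+1),
        refines_induced XX tie (@cell R p (Ms K)) lab
    & admissible D x (Ms K) \/
      forall k : 'I_(msize (Ms K)).+1, obs_in x (cell k) = finset.setT].
Proof.
move=> xX [ini step _]; elim: K => [_|K IH KN].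
  case: ini => -[alpha [beta e]] fit; rewrite e in fit *; split => //.
    exists (Model (fun _ : 'I_1 => XX) alpha beta), id; split => //.
    - move=> k v /= Xv; split => //; rewrite [RHS]ord1; exact: ord1.
    - by move=> v Xv; exists ord0.
    - by move=> l; exists l.
  by right=> k; apply/finset.setP => i; rewrite !inE; apply/mem_set/xX.
have [_ [M' [[cand [candP [k [j [l eM']]] admM' _]] [M'' [indM'' refit]]]]] := step K KN.
have [_ [g [lab ref]] _] := IH (ltnW KN).
have [[al [be eM]] fitM'] := candP k j l; rewrite -eM' in eM fitM'.
case: refit => [[adm ->]|[_ ->]]; last first.
  split=> //; last by left.
  have [lab' ref'] := refines_induced_split k j (split_point x (cell k) j (a l)) ref.
  by clear -eM ref'; rewrite {M'}eM; exists g, lab'.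
case: indM'' => -[al' [be' e'']] fit; split=> //; last by left.
clear -e'' tie; rewrite {M''}e''; exists M', id; split => //.
- by move=> v Xv; exists (tie _ (maximizers M' v)).
- by move=> l; exists l.
Qed.

Lemma cap_output_model R (p n L : nat) (XX : set 'rV[R]_p) (D : R)
    (a : 'I_L -> R) tie
    (crit : ('I_n -> 'rV[R]_p) -> ('I_n -> R) -> model R p -> R)
    (x : 'I_n -> 'rV[R]_p) (y : 'I_n -> R) (M : model R p) :
  (forall i, XX (x i)) -> cap_output XX D a tie crit x y M ->
  [/\ fitted x y M,
      exists (g : model R p) (lab : 'I_(msize M).+1 -> 'I_(msize g).+1),
        refines_induced XX tie (@cell R p M) lab
    & admissible D x M \/
      forall k : 'I_(msize M).+1, obs_in x (cell k) = finset.setT].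
Proof. by move=> xX [Ms [N [K [run KN -> _]]]]; exact: cap_run_model run KN. Qed.

(** The last clause bounds from below the support function of [A] seen from [c]. It makes sense for
    cells that are neither open nor closed, and for a center, such as an empirical mean, that may
    lie outside [A]. *)
Definition fat_body R p (kap : R) (A : set 'rV[R]_p)
    (c : 'rV[R]_p) (d : R) : Prop :=
  [/\ 0 < d,
      forall v w, A v -> A w -> enorm (v - w) <= d,
      forall v, A v -> enorm (v - c) <= d
    & forall u, exists2 v, A v & kap * d * enorm u <= dot u (v - c)].

(** * Separation and packing of fat bodies *)

Definition weakly_separated R p (A B : set 'rV[R]_p) : Prop :=
  exists (u : 'rV[R]_p) (b : R), [/\ u != 0,
    forall v, A v -> dot u v <= b & forall v, B v -> b <= dot u v].

Lemma weakly_separated_sym R p (A B : set 'rV[R]_p) :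
  weakly_separated A B -> weakly_separated B A.
Proof.
move=> [u [b [u0 hA hB]]]; exists (- u), (- b); rewrite oppr_eq0; split=> // v ?.
  by rewrite dotNl lerN2 hB.
by rewrite dotNl lerN2 hA.
Qed.

Lemma dot_delta R p (q : 'I_p) (v : 'rV[R]_p) :
  dot (delta_mx 0 q) v = v 0 q.
Proof.
rewrite /dot (bigD1 q)//= mxE !eqxx mul1r big1 ?addr0// => j jq.
by rewrite mxE (negbTE jq) andbF mul0r.
Qed.

Lemma axis_cut_separated R p (A B : set 'rV[R]_p) :
  axis_cut A B -> weakly_separated A B.
Proof.
suff main q b (A' B' : set 'rV[R]_p) : (forall v, A' v -> v 0 q <= b) ->
    (forall v, B' v -> b < v 0 q) -> weakly_separated A' B'.
  by move=> [q [b [[hA hB]|[hB hA]]]]; [|apply: weakly_separated_sym]; apply: main; eassumption.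
move=> hA hB; exists (delta_mx 0 q), b; split.
- by apply/eqP => /(congr1 (fun M : 'rV[R]_p => M 0 q)) /eqP; rewrite !mxE !eqxx oner_eq0.
- by move=> v ?; rewrite dot_delta hA.
- by move=> v ?; rewrite dot_delta ltW// hB.
Qed.

(* Moving from a point of a fat body towards its center goes away from any
   hyperplane bounding the body. *)
Lemma separated_points R p (kap s t t' d d' : R) (A B : set 'rV[R]_p)
    (c c' w w' : 'rV[R]_p) :
  0 < kap -> fat_body kap A c d -> fat_body kap B c' d' -> weakly_separated A B ->
  A w -> B w' -> 0 <= t <= 1 -> 0 <= t' <= 1 -> s <= t * d -> s <= t' * d' ->
  2 * kap * s <= enorm ((w' + t' *: (c' - w')) - (w + t *: (c - w))).
Proof.
move=> kap0 [d0 _ _ fA] [d'0 _ _ fB] [u [b [u0 hA hB]]] Aw Bw /andP[t0 t1] /andP[t'0 t'1] st st'.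
have up := enorm_gt0 u0; set z := w + _; set z' := w' + _.
have key (r e f : R) : 0 <= r <= 1 -> 0 <= f -> s <= r * e -> kap * s * f <= r * (kap * e * f).
  move=> r01 f0 se; have -> : r * (kap * e * f) = kap * (r * e) * f by ring.
  by rewrite ler_wpM2r// ler_wpM2l// ltW.
have zb : dot u z <= b - kap * s * enorm u.
  have [v Av fv] := fA u; rewrite dotBr in fv.
  have ks := key t d _ (introT andP (conj t0 t1)) (enorm_ge0 u) st.
  rewrite /z dotDr dotZr dotBr.
  have := hA _ Av; have := hA _ Aw => h1 h2.
  have : (1 - t) * dot u w <= (1 - t) * b by rewrite ler_wpM2l// subr_ge0.
  have : t * dot u c <= t * (b - kap * d * enorm u) by rewrite ler_wpM2l//; lra.
  rewrite !(mulrBr t) !(mulrBl _ 1) !mul1r; lra.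
have zb' : b + kap * s * enorm u <= dot u z'.
  have [v Bv fv] := fB (- u); rewrite !dotNl enormN dotBr in fv.
  have ks := key t' d' _ (introT andP (conj t'0 t'1)) (enorm_ge0 u) st'.
  rewrite /z' dotDr dotZr dotBr.
  have := hB _ Bv; have := hB _ Bw => h1 h2.
  have : (1 - t') * b <= (1 - t') * dot u w' by rewrite ler_wpM2l// subr_ge0.
  have : t' * (b + kap * d' * enorm u) <= t' * dot u c' by rewrite ler_wpM2l//; lra.
  rewrite !(mulrBr t') !(mulrBl _ 1) !(mulrDr t') !mul1r; lra.
rewrite -(ler_pM2l up); apply: le_trans (le_trans (ler_norm _) (cauchy_schwarz u (z' - z))).
rewrite dotBr; have -> : enorm u * (2 * kap * s) = 2 * (kap * s * enorm u) by ring.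
lra.
Qed.

(** Pigeonhole on a grid of mesh [e / (p + 1)]: two points of the same cube are at distance at most
    [p e / (p + 1) < e]. *)
Lemma separated_net R p (I : finType) (J : {set I}) (z : I -> 'rV[R]_p)
    (r e : R) : 0 < e -> 0 <= r ->
  (forall j, j \in J -> enorm (z j) <= r) ->
  (forall j j', j \in J -> j' \in J -> j != j' -> e <= enorm (z j' - z j)) ->
  #|J|%:R <= (2 * r * p.+1%:R / e + 1) ^+ p.
Proof.
move=> e0 r0 zr ze; pose h := e / p.+1%:R.
have h0 : 0 < h by rewrite divr_gt0.
pose code j q := Num.truncn ((z j 0 q + r) / h).
pose N := Num.truncn (2 * r / h).
have zq j q : j \in J -> 0 <= (z j 0 q + r) / h <= 2 * r / h.
  move=> /zr /(le_trans (coord_le_enorm _ q)); rewrite ler_norml => /andP[a b].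
  apply/andP; split; first by rewrite divr_ge0// ?(ltW h0)//; lra.
  by rewrite ler_pM2r ?invr_gt0//; lra.
pose f j : {ffun 'I_p -> 'I_N.+1} := [ffun q => inord (code j q)].
have fin : {in J &, injective f}.
  move=> j j' jJ j'J ff; apply/eqP; apply: contraT => /(ze _ _ jJ j'J).
  rewrite leNgt => /negP[]; apply: (@le_lt_trans _ _ (p%:R * h)); last first.
    by rewrite /h mulrCA gtr_pMr// ltr_pdivrMr// mul1r ltr_nat.
  apply: enorm_le_coord => [|q]; first exact: ltW.
  have : code j q = code j' q.
    have := congr1 (fun g : {ffun 'I_p -> 'I_N.+1} => g q : nat) ff.
    by rewrite !ffunE !inordK// ltnS le_truncn//; case/andP: (zq _ q jJ); case/andP: (zq _ q j'J).
  have /andP[a0 _] := zq _ q jJ; have /andP[b0 _] := zq _ q j'J.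
  have := truncn_itv a0; have := truncn_itv b0; rewrite -/(code _ _) -/(code _ _).
  rewrite !(ler_pdivlMr _ _ h0) !(ltr_pdivrMr _ _ h0) => /andP[a1 a2] /andP[b1 b2] cc.
  rewrite {}cc in b1 b2; move: a2 b2; rewrite -natr1 mulrDl mul1r !mxE ler_norml; lra.
have := @leq_card_in _ _ f (mem J) fin; rewrite card_ffun !card_ord => cJ.
apply: (@le_trans _ _ ((N.+1 ^ p)%:R)); first by rewrite ler_nat.
rewrite natrX lerXn2r ?nnegrE//; first by rewrite addr_ge0// divr_ge0 ?(ltW e0)//; apply: mulr_ge0 => //; lra.
rewrite -addn1 natrD lerD2r.
have -> : 2 * r * p.+1%:R / e = 2 * r / h by rewrite /h invf_div mulrA mulrAC.
by have /andP[] : N%:R <= 2 * r / h < N.+1%:R by apply: truncn_itv; rewrite divr_ge0 ?(ltW h0)//; lra.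
Qed.

(** Comes from [separated_net] with radius [2 r] and separation [2 kap s], the additive 1 being
    absorbed by [r / s >= 1]. *)
Definition packing_const R p (kap : R) : R := 2 * p.+1%:R / kap + 1.

Lemma packing_const_ge1 R p (kap : R) : 0 < kap -> 1 <= packing_const p kap.
Proof. by move=> k0; rewrite lerDr divr_ge0// ?(ltW k0)// mulr_ge0. Qed.

(** From its point near [z], each body is entered towards its center by a fraction [t] with
    [s <= t d <= r], which for a large body is only part of the way. The points reached stay within
    [2 r] of [z] and are [2 kap s] apart. *)
Lemma packing R p (kap : R) (I : finType) (J : {set I})
    (A : I -> set 'rV[R]_p) (c w : I -> 'rV[R]_p) (d : I -> R) (z : 'rV[R]_p) (r s : R) :
  0 < kap -> 0 < s <= r ->
  (forall j, j \in J -> [/\ fat_body kap (A j) (c j) (d j), A j (w j), enorm (w j - z) <= r & s <= d j]) ->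
  (forall j j', j \in J -> j' \in J -> j != j' -> weakly_separated (A j) (A j')) ->
  #|J|%:R <= (packing_const p kap * (r / s)) ^+ p.
Proof.
move=> kap0 /andP[s0 sr] HJ sepJ; have r0 := lt_le_trans s0 sr.
pose t j := Num.min 1 (r / d j).
have tP j : j \in J -> [/\ 0 <= t j <= 1, s <= t j * d j & t j * d j <= r].
  move=> /HJ[[dj0 _ _ _] _ _ sd]; split.
  - by rewrite /t ge_min lexx/= andbT le_min ler01 divr_ge0 ?ltW.
  - rewrite /t; case: (leP 1 (r / d j)) => // _; first by rewrite mul1r.
    by rewrite divfK// gt_eqF.
  - rewrite /t; case: (leP 1 (r / d j)) => [|_]; last by rewrite divfK// gt_eqF.
    by rewrite ler_pdivlMr// => ?.
pose zz j := w j + t j *: (c j - w j) - z.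
have -> : packing_const p kap * (r / s) = 2 * p.+1%:R / kap * (r / s) + r / s.
  by rewrite mulrDl mul1r.
apply: (@le_trans _ _ ((2 * (2 * r) * p.+1%:R / (2 * kap * s) + 1) ^+ p)).
  apply: (@separated_net _ _ _ _ zz); rewrite ?mulr_gt0//; first lra.
  - move=> j jJ; have [/andP[t0 t1] _ tr] := tP j jJ.
    have [[dj0 _ hc _] Aw wz _] := HJ j jJ.
    rewrite /zz addrAC; apply: le_trans (enormD _ _) _.
    rewrite enormZ ger0_norm// enormB.
    have := ler_wpM2l t0 (hc _ Aw); lra.
  - move=> j j' jJ j'J ne; have [t01 st _] := tP j jJ; have [t01' st' _] := tP j' j'J.
    have [fj Aj _ _] := HJ j jJ; have [fj' Aj' _ _] := HJ j' j'J.
    rewrite /zz (_ : _ - _ - _ = w j' + t j' *: (c j' - w j') - (w j + t j *: (c j - w j))); last first.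
      by rewrite opprB addrA subrK.
    exact: separated_points (sepJ _ _ jJ j'J ne) Aj Aj' t01 t01' st st'.
have rs : 1 <= r / s by rewrite ler_pdivlMr// mul1r.
have p0 : 0 <= 2 * p.+1%:R / kap * (r / s).
  by rewrite mulr_ge0// ?divr_ge0// ?mulr_ge0// ltW.
have -> : 2 * (2 * r) * p.+1%:R / (2 * kap * s) = 2 * p.+1%:R / kap * (r / s).
  by field; rewrite !gt_eqF.
by apply: lerXn2r; rewrite ?nnegrE ?addr_ge0//; lra.
Qed.

(** * Maximal planes, ties and labels *)

Lemma max_ord_ge R (K : nat) (F : 'I_K.+1 -> R) k : F k <= max_ord F.
Proof. exact: le_bigmax_cond. Qed.

Lemma max_ord_le R (K : nat) (F : 'I_K.+1 -> R) b :
  (forall k, F k <= b) -> max_ord F <= b.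
Proof. by move=> Fb; apply: bigmax_le. Qed.

Lemma min_ord_le R (K : nat) (F : 'I_K.+1 -> R) k : min_ord F <= F k.
Proof. exact: bigmin_le_cond. Qed.

Lemma maximizersP R p (g : model R p) (v : 'rV[R]_p) k :
  reflect (forall m, hyperplane (M := g) m v <= hyperplane k v) (k \in maximizers g v).
Proof.
rewrite inE; apply: (iffP idP) => [/eqP -> m|kmax].
  exact: (max_ord_ge (fun k => hyperplane k v) m).
apply/eqP; apply: le_anti; apply/andP; split; last exact: max_ord_le.
exact: (max_ord_ge (fun k => hyperplane k v) k).
Qed.

Lemma maximizers_neq0 R p (g : model R p) (v : 'rV[R]_p) :
  exists k, k \in maximizers g v.
Proof.
have [k _ kmax] := @arg_maxP _ _ _ ord0 xpredT (fun k => hyperplane (M := g) k v) isT.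
by exists k; apply/maximizersP => m; exact: kmax.
Qed.

Lemma hyperplane_segment R p (g : model R p) k (v c : 'rV[R]_p) (t : R) :
  hyperplane k (v + t *: (c - v)) = (1 - t) * hyperplane (M := g) k v + t * hyperplane k c.
Proof. rewrite /hyperplane dotDr dotZr dotBr; ring. Qed.

Lemma hyperplaneB R p (g : model R p) (k m : 'I_(msize g).+1) (v w : 'rV[R]_p) :
  hyperplane (M := g) m v - hyperplane k v =
    hyperplane m w - hyperplane k w + dot (slope m - slope k) (v - w).
Proof. rewrite /hyperplane dotBr !dotBl; ring. Qed.

(* Distinct indices may carry the same plane, in which case they always tie
   together; [principal] is the one that wins when they are the only ones. *)
Definition plane_class R p (g : model R p) (l : 'I_(msize g).+1) :
  {set 'I_(msize g).+1} := [set m | (icpt m == icpt l) && (slope m == slope l)]%SET.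

Definition principal R p tie
    (g : model R p) (l : 'I_(msize g).+1) : 'I_(msize g).+1 := tie _ (plane_class l).

Lemma plane_classP R p (g : model R p) (l m : 'I_(msize g).+1) :
  m \in plane_class l -> plane_class m = plane_class l /\ forall v, hyperplane (M := g) m v = hyperplane l v.
Proof.
rewrite inE => /andP[/eqP ei /eqP es]; split; last by move=> v; rewrite /hyperplane ei es.
by apply/finset.setP => k; rewrite !inE ei es.
Qed.

Lemma principal_class R p tie
    (g : model R p) (l : 'I_(msize g).+1) : tie_rule tie -> principal tie l \in plane_class l.
Proof.
by move=> tieP; apply: tieP; apply/finset.set0Pn; exists l; rewrite inE !eqxx.
Qed.

Lemma principalK R p tie
    (g : model R p) (l : 'I_(msize g).+1) : tie_rule tie ->
  principal tie (principal tie l) = principal tie l.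
Proof.
by move=> tieP; have [e _] := plane_classP (principal_class l tieP); rewrite {1}/principal e.
Qed.

Lemma principal_hyperplane R p tie
    (g : model R p) (l : 'I_(msize g).+1) v : tie_rule tie ->
  hyperplane (M := g) (principal tie l) v = hyperplane l v.
Proof. by move=> tieP; have [_] := plane_classP (principal_class l tieP); apply. Qed.

(** Membership in the closure: on a boundary, the tie-breaking rule may give an observation to
    another cell although the plane of this cell is maximal there. *)
Definition touches R p (A : set 'rV[R]_p) (v : 'rV[R]_p) : Prop :=
  forall e, 0 < e -> exists2 w, A w & enorm (w - v) <= e.

Lemma label_maximal R p (XX : set 'rV[R]_p)
    tie (J : Type) (A : J -> set 'rV[R]_p)
    (g : model R p) (lab : J -> 'I_(msize g).+1) j v m :
  tie_rule tie -> refines_induced XX tie A lab -> A j v ->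
  hyperplane (M := g) m v <= hyperplane (lab j) v.
Proof.
move=> tieP [inA _ _ _] /inA[_ <-].
have : tie _ (maximizers g v) \in maximizers g v.
  by apply: tieP; apply/finset.set0Pn; exact: maximizers_neq0.
by move/maximizersP.
Qed.

Lemma touching_label_maximal R p (XX : set 'rV[R]_p)
    tie (J : Type) (A : J -> set 'rV[R]_p)
    (g : model R p) (lab : J -> 'I_(msize g).+1) j v m :
  tie_rule tie -> refines_induced XX tie A lab -> touches (A j) v ->
  hyperplane (M := g) m v <= hyperplane (lab j) v.
Proof.
move=> tieP ref tv; rewrite -subr_le0; apply/ler_addgt0Pr => e e0; rewrite add0r.
set u := slope m - slope (lab j).
have e'0 : 0 < e / (1 + enorm u) by rewrite divr_gt0// ltr_pwDl// enorm_ge0.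
have [w Aw wv] := tv _ e'0.
rewrite (hyperplaneB _ _ v w) -/u.
have := label_maximal m tieP ref Aw; rewrite -subr_le0.
have := le_trans (ler_norm _) (cauchy_schwarz u (v - w)).
have u0 := enorm_ge0 u; rewrite (enormB v w).
have : enorm u * enorm (w - v) <= e.
  apply: le_trans (ler_wpM2l u0 wv) _; rewrite mulrCA ger_pMr//.
  by rewrite ler_pdivrMr ?mul1r; lra.
lra.
Qed.

(** If the slopes differ, fatness gives a point of the cell beyond the center in the direction where
    plane [m] gains on plane [lab j], and plane [m] is still not above it there. If they agree, the
    intercepts differ. *)
Lemma fat_center_maximal R p (XX : set 'rV[R]_p)
    tie (J : Type) (A : J -> set 'rV[R]_p)
    (g : model R p) (lab : J -> 'I_(msize g).+1) (kap : R) j c d m :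
  tie_rule tie -> refines_induced XX tie A lab -> 0 < kap -> fat_body kap (A j) c d ->
  m \notin plane_class (lab j) -> hyperplane (M := g) m c < hyperplane (lab j) c.
Proof.
move=> tieP ref kap0 [d0 _ _ fA]; rewrite inE => nm.
have [v Av fv] := fA (slope m - slope (lab j)).
have := label_maximal m tieP ref Av; rewrite -subr_le0 (hyperplaneB _ _ v c) => hv.
rewrite -subr_lt0; have [e|ne] := eqVneq (slope m - slope (lab j)) 0.
  rewrite e dot0l addr0 in hv; rewrite lt_neqAle hv andbT.
  apply: contra nm => /eqP; rewrite /hyperplane; move/eqP: e; rewrite subr_eq0 => /eqP ->.
  by rewrite eqxx andbT opprD addrACA subrr addr0 => /eqP; rewrite subr_eq0.
have : 0 < kap * d * enorm (slope m - slope (lab j)) by rewrite mulr_gt0 ?mulr_gt0 ?enorm_gt0.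
lra.
Qed.

(* On the segment from [v] to the center of a cell labeled [l], only the planes
   equal to plane [l] attain the maximum. *)
Lemma touching_cell R p (XX : set 'rV[R]_p)
    tie (J : finType) (A : J -> set 'rV[R]_p)
    (g : model R p) (lab : J -> 'I_(msize g).+1) (kap : R) (c : J -> 'rV[R]_p) (d : J -> R) l v :
  tie_rule tie -> convex_set XX -> refines_induced XX tie A lab -> 0 < kap ->
  (forall j, fat_body kap (A j) (c j) (d j) /\ XX (c j)) -> XX v -> l \in maximizers g v ->
  exists2 j, lab j = principal tie l & touches (A j) v.
Proof.
move=> tieP cX ref kap0 fA Xv /maximizersP lmax; have [inA covA _ surA] := ref.
apply: contrapT => no.
(* Otherwise the finitely many cells with that label stay at a positive distance from [v], and a
   point of the segment closer than all these distances yields a contradiction. *)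
have far j : exists2 e : R, 0 < e &
    lab j = principal tie l -> forall w, A j w -> e < enorm (w - v).
  have [lj|nlj] := eqVneq (lab j) (principal tie l); last first.
    by exists 1 => // lj; rewrite lj eqxx in nlj.
  apply: contrapT => nj; apply: no; exists j => // e e0.
  apply: contrapT => ne; apply: nj; exists e => // _ w Aw.
  by rewrite ltNge; apply/negP => we; apply: ne; exists w.
have [e eP] := @boolp.choice J R (fun j e => 0 < e /\
    (lab j = principal tie l -> forall w, A j w -> e < enorm (w - v)))
    (fun j => let: ex_intro2 e e0 ej := far j in ex_intro _ e (conj e0 ej)).
have [j0 lj0] := surA l; have [fj0 Xc] := fA j0.
pose e0 := \big[Order.min/1]_j e j.
have e0_gt0 : 0 < e0 by apply: lt_bigmin => // j _; case: (eP j).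
pose t := Num.min 1 (e0 / (1 + enorm (c j0 - v))).
have n0 := enorm_ge0 (c j0 - v).
have t0 : 0 < t by rewrite lt_min ltr01 divr_gt0//; lra.
have t1 : t <= 1 by rewrite /t ge_min lexx.
have Xt : XX (v + t *: (c j0 - v)) by apply: convex_combination => //; rewrite (ltW t0).
have [j Aj] := covA _ Xt.
suff mx : maximizers g (v + t *: (c j0 - v)) = plane_class l.
  have [_ lj] := inA _ _ Aj; rewrite mx in lj.
  have [ej0 /(_ (esym lj) _ Aj)] := eP j.
  rewrite addrC addrA addNr add0r enormZ gtr0_norm// ltNge => /negP[].
  apply: (@le_trans _ _ e0); last exact: bigmin_le_cond.
  apply: (@le_trans _ _ (e0 / (1 + enorm (c j0 - v)) * enorm (c j0 - v))).
    by rewrite ler_wpM2r// /t ge_min lexx orbT.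
  by rewrite -mulrA ger_pMr// mulrC ler_pdivrMr ?mul1r; lra.
apply/finset.setP => m; apply/maximizersP/idP => [/(_ l)|ml k].
  rewrite !hyperplane_segment; apply: contraTT => nm; rewrite -ltNge.
  rewrite -lj0 in nm; have := fat_center_maximal tieP ref kap0 fj0 nm; rewrite lj0.
  have := ler_wpM2l (_ : 0 <= 1 - t) (lmax m); rewrite subr_ge0 => /(_ t1) h1.
  by rewrite -(ltr_pM2l t0) => h2; rewrite ler_ltD.
have [_ ->] := plane_classP ml; rewrite !hyperplane_segment lerD//.
  by rewrite ler_wpM2l// subr_ge0.
rewrite ler_wpM2l//; first exact: ltW.
have [kl|nk] := boolP (k \in plane_class l); first by have [_ ->] := plane_classP kl.
rewrite -lj0 in nk; have := fat_center_maximal tieP ref kap0 fj0 nk; rewrite lj0; exact: ltW.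
Qed.

(** Distinct principal labels carry distinct planes, whose difference has opposite signs on the two
    cells; equal labels are separated by an axis cut. Principality matters because the cells of two
    copies of one plane may interleave under an arbitrary tie-breaking rule. *)
Lemma principal_cells_separated R p (XX : set 'rV[R]_p)
    tie (J : eqType) (A : J -> set 'rV[R]_p)
    (g : model R p) (lab : J -> 'I_(msize g).+1) (j j' : J) :
  tie_rule tie -> refines_induced XX tie A lab -> j != j' ->
  lab j = principal tie (lab j) -> lab j' = principal tie (lab j') ->
  A j !=set0 -> A j' !=set0 -> weakly_separated (A j) (A j').
Proof.
move=> tieP ref /eqP ne pj pj' [v0 Av0] [w0 Aw0]; have [_ _ cutA _] := ref.
have [ll|/eqP nl] := eqVneq (lab j) (lab j'); first exact/axis_cut_separated/cutA.
pose u := slope (lab j') - slope (lab j).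
have hv v : A j v -> hyperplane (lab j') v - hyperplane (lab j) v <= 0.
  by move=> Av; rewrite subr_le0; exact: (label_maximal (lab j') tieP ref Av).
have hw w : A j' w -> 0 <= hyperplane (lab j') w - hyperplane (lab j) w.
  by move=> Aw; rewrite subr_ge0; exact: (label_maximal (lab j) tieP ref Aw).
have hE v : hyperplane (lab j') v - hyperplane (lab j) v = icpt (lab j') - icpt (lab j) + dot u v.
  by rewrite /hyperplane /u dotBl; ring.
exists u, (icpt (lab j) - icpt (lab j')); split.
- apply/eqP => u0; apply: nl; rewrite pj pj' /principal.
  suff cl : lab j' \in plane_class (lab j) by have [-> _] := plane_classP cl.
  have := hv _ Av0; have := hw _ Aw0; rewrite !hE u0 !dot0l !addr0 => h1 h2.
  rewrite inE; apply/andP; split; first by rewrite eq_le; apply/andP; split; lra.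
  by rewrite -subr_eq0 -/u u0.
- by move=> v /hv; rewrite hE; lra.
- by move=> v /hw; rewrite hE; lra.
Qed.

Lemma card_bigcup_le (I T : finType) (J : {set I}) (F : I -> {set T}) :
  (#|\bigcup_(j in J) F j|%SET <= \sum_(j in J) #|F j|)%N.
Proof.
elim/big_ind2: _ => [|A a B b Aa Bb|//]; first by rewrite cards0.
by apply: leq_trans (leq_card_setU _ _) _; exact: leq_add.
Qed.

(** The packing bound at ratio [r / s = 2], for cells at least as large as a given one and within
    twice its diameter of its center. *)
Definition overlap_const R p (kap : R) : nat :=
  Num.truncn ((packing_const p kap * 2) ^+ p).

(* All the cells of a pattern are near the smallest one and at least as large,
   so that packing leaves boundedly many patterns per smallest cell. *)
Lemma card_touching_patterns R p n (J : finType) (A : J -> set 'rV[R]_p)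
    (c : J -> 'rV[R]_p) (d : J -> R) (kap : R) (JP : {set J}) (x : 'I_n -> 'rV[R]_p)
    (C : {set 'I_n}) :
  0 < kap -> (forall j, j \in JP -> fat_body kap (A j) (c j) (d j)) ->
  (forall j j', j \in JP -> j' \in JP -> j != j' -> weakly_separated (A j) (A j')) ->
  (forall i, i \in C -> exists2 j, j \in JP & touches (A j) (x i)) ->
  (#|[set [set j in JP | `[< touches (A j) (x i) >]] | i in C]%SET|
     <= #|JP| * 2 ^ overlap_const p kap)%N.
Proof.
move=> kap0 fA sepJ tC.
(* A cell touching an observation that cell [j] touches has a point within [d / 2 + d / 2 + d] of
   [c j], whence the radius [2 d]. *)
pose N j := [set j' in JP | (d j <= d j') && `[< exists2 w, A j' w & enorm (w - c j) <= d j *+ 2 >]]%SET.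
have cN j : j \in JP -> (#|N j| <= overlap_const p kap)%N.
  move=> jJ; have [d0 _ _ _] := fA j jJ.
  pose w j' := xget 0 [set w | A j' w /\ enorm (w - c j) <= d j *+ 2].
  have wP j' : j' \in N j -> A j' (w j') /\ enorm (w j' - c j) <= d j *+ 2.
    rewrite inE => /andP[_ /andP[_ /asboolP[v Av vc]]].
    by apply: (@xgetPex _ 0 [set w | A j' w /\ enorm (w - c j) <= d j *+ 2]); exists v.
  have pc := packing_const_ge1 p kap0.
  rewrite /overlap_const truncn_ge_nat; last by rewrite exprn_ge0// mulr_ge0//; lra.
  have -> : (packing_const p kap * 2) ^+ p = (packing_const p kap * (d j *+ 2 / d j)) ^+ p.
    by congr (_ ^+ p); rewrite -[d j *+ 2]mulr_natr [d j * 2]mulrC mulfK// gt_eqF.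
  apply: (packing (J := N j) (A := A) (c := c) (w := w) (d := d) (z := c j)) => //.
  - by rewrite d0/= mulr2n lerDl ltW.
  - move=> j' j'N; have [Aw wc] := wP _ j'N; move: j'N; rewrite inE => /andP[j'J /andP[dd _]].
    by split => //; exact: fA.
  - by move=> j1 j2; rewrite !inE => /andP[j1J _] /andP[j2J _]; exact: sepJ.
have sub : [set [set j in JP | `[< touches (A j) (x i) >]] | i in C]%SET \subset
    (\bigcup_(j in JP) powerset (N j))%SET.
  apply/fintype.subsetP => _ /imsetP[i iC ->].
  have [j0 j0J tj0] := tC i iC.
  have [j /andP[jJ /asboolP tj] jmin] := @arg_minP _ _ _ j0
    (fun j => (j \in JP) && `[< touches (A j) (x i) >]) d (introT andP (conj j0J (asboolT tj0))).
  apply/bigcupP; exists j => //; rewrite powersetE; apply/fintype.subsetP => j'.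
  rewrite !inE => /andP[j'J /asboolP tj']; rewrite j'J/= jmin ?j'J ?asboolT//=.
  have [d0 _ hc _] := fA j jJ; have d20 : 0 < d j / 2 by rewrite divr_gt0.
  have [w Aw wx] := tj' _ d20; have [v Av vx] := tj _ d20.
  exists w => //.
  apply: le_trans (enorm_dist_triangle (x i) _ _) _.
  have := enorm_dist_triangle v (x i) (c j); have := hc _ Av; rewrite (enormB (x i) v) mulr2n; lra.
apply: leq_trans (subset_leq_card sub) _; apply: leq_trans (card_bigcup_le _ _) _.
rewrite -sum_nat_const; apply: leq_sum => j jJ; rewrite card_powerset.
by rewrite leq_exp2l ?cN.
Qed.

(** * Description of a cell by its neighbours *)

Definition meets_ball R p (A : set 'rV[R]_p) (z : 'rV[R]_p) (r : R) : bool :=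
  `[< exists2 w, A w & enorm (w - z) <= r >].

Definition near_principal R p tie
    (J : finType) (A : J -> set 'rV[R]_p) (g : model R p) (lab : J -> 'I_(msize g).+1)
    (z : 'rV[R]_p) (r : R) : {set J} :=
  [set j | (lab j == principal tie (lab j)) && meets_ball (A j) z r]%SET.

Definition near_siblings R p (J : finType) (A : J -> set 'rV[R]_p)
    (L : eqType) (lab : J -> L) (k : J) (z : 'rV[R]_p) (r : R) : {set J} :=
  [set j | [&& j != k, lab j == lab k & meets_ball (A j) z r]]%SET.

(* Near the cell, a plane attaining the maximum is that of some principal cell
   touching the point. Half-spaces decide whether plane [lab k] is maximal, the
   reference points whether it wins the tie, and axis cuts discard the other
   cells with the same label. *)
Lemma cell_describable R p n (XX : set 'rV[R]_p)
    tie (J : finType) (A : J -> set 'rV[R]_p)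
    (g : model R p) (lab : J -> 'I_(msize g).+1) (kap : R) (c : J -> 'rV[R]_p) (d : J -> R)
    (x : 'I_n -> 'rV[R]_p) (k : J) (i0 : 'I_n) :
  let JP := near_principal tie A lab (x i0) (p.+1%:R * d k) in
  let JS := near_siblings A lab k (x i0) (p.+1%:R * d k) in
  tie_rule tie -> convex_set XX -> refines_induced XX tie A lab -> 0 < kap ->
  (forall j, fat_body kap (A j) (c j) (d j) /\ XX (c j)) -> (forall i, XX (x i)) ->
  A k (x i0) ->
  obs_in x (A k) \in describable (halfspaces x)
    (2 * p + (1 + 2 ^ overlap_const p kap) * (#|JP| + #|JS|)).
Proof.
move=> JP JS tieP cX ref kap0 fA xX Ak0; have [inA covA cutA surA] := ref.
have dk0 : 0 < d k by case: (fA k) => -[].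
set C := obs_in x (A k); pose lk := lab k.
have inC i : i \in C -> A k (x i) by rewrite inE => /set_mem.
(* The box costs [2 p] half-spaces and localizes the description: an observation in it is within
   [p d] of [x i0], and a cell touching the observation has a point within another [d], whence the
   radius [(p + 1) d]. *)
pose box (i : 'I_n) := forall q, `|x i 0 q - x i0 0 q| <= d k.
have boxC i : i \in C -> box i.
  move=> /inC Ai q; have [[_ dA _ _] _] := fA k.
  have := coord_le_enorm (x i - x i0) q; rewrite !mxE => /le_trans; apply; exact: dA.
have near_touch i j : box i -> touches (A j) (x i) -> meets_ball (A j) (x i0) (p.+1%:R * d k).
  move=> bi /(_ _ dk0)[w Aw wx]; apply/asboolP; exists w => //.
  apply: le_trans (enorm_dist_triangle (x i) _ _) _.
  have : enorm (x i - x i0) <= p%:R * d k.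
    by apply: enorm_le_coord => [|q]; [exact: ltW|rewrite !mxE].
  by rewrite -natr1 mulrDl mul1r; lra.
pose Q i := [set j in JP | `[< touches (A j) (x i) >]]%SET.
have touch i l : box i -> l \in maximizers g (x i) ->
    exists j, [/\ j \in Q i, lab j = principal tie l & j \in JP].
  move=> bi /(touching_cell tieP cX ref kap0 fA (xX i))[j lj tj].
  have jJP : j \in JP by rewrite inE lj principalK ?eqxx//=; exact: near_touch tj.
  by exists j; split; rewrite // inE jJP asboolT.
pose above (m l : 'I_(msize g).+1) : {set 'I_n} :=
  [set i | 0 <= icpt l - icpt m + dot (slope l - slope m) (x i)]%SET.
have aboveE m l i : (i \in above m l) = (hyperplane (M := g) m (x i) <= hyperplane l (x i)).
  by rewrite inE -[RHS]subr_ge0 /hyperplane dotBl opprD addrACA.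
have sibE j : exists S : {set 'I_n}, S \in halfspaces x /\
    (j \in JS -> (C \subset S) /\ forall i, A j (x i) -> i \notin S).
  have [jS|_] := boolP (j \in JS); last by exists finset.setT; rewrite setT_halfspaces.
  move: jS; rewrite inE => /and3P[/eqP jk /eqP ljk _].
  have [q [b [[hj hk]|[hk hj]]]] := cutA _ _ jk ljk.
    exists [set i | 0 < - b + dot (delta_mx 0 q) (x i)]%SET; split; first exact: open_halfspace.
    move=> _; split; first by apply/fintype.subsetP => i /inC /hk; rewrite inE dot_delta; lra.
    by move=> i /hj; rewrite inE dot_delta -leNgt; lra.
  exists [set i | 0 <= b + dot (- delta_mx 0 q) (x i)]%SET; split; first exact: closed_halfspace.
  move=> _; split.
    by apply/fintype.subsetP => i /inC /hk; rewrite inE dotNl dot_delta; lra.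
  by move=> i /hj; rewrite inE dotNl dot_delta -ltNge; lra.
have [sib sibP] := boolp.choice sibE.
pose lo q : {set 'I_n} := [set i | 0 <= d k - x i0 0 q + dot (delta_mx 0 q) (x i)]%SET.
pose hi q : {set 'I_n} := [set i | 0 <= d k + x i0 0 q + dot (- delta_mx 0 q) (x i)]%SET.
pose h1 := [seq lo q | q <- enum 'I_p] ++ [seq hi q | q <- enum 'I_p] ++
  [seq above (lab j) lk | j <- enum JP] ++ [seq sib j | j <- enum JS].
pose h2 := [seq above lk (lab j) | j <- enum JP].
(* One reference point for each pattern of touching principal cells that occurs in [C];
   [card_touching_patterns] bounds their number. *)
pose t := pmap (fun q : {set J} => [pick i in C | Q i == q]) (enum [set Q i | i in C]%SET).
have h1P i : all (fun h : {set 'I_n} => i \in h) h1 <->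
    [/\ box i, forall j, j \in JP -> hyperplane (M := g) (lab j) (x i) <= hyperplane lk (x i)
      & forall j, j \in JS -> i \in sib j].
  rewrite !all_cat !all_map; split.
    move=> /and4P[/allP lP /allP hP /allP aP /allP sP]; split.
    - move=> q; have qI : q \in Finite.enum 'I_p by rewrite -enumT mem_enum.
      have := lP q qI; have := hP q qI.
      by rewrite /= !inE dotNl !dot_delta ler_norml; lra.
    - by move=> j jJ; rewrite -aboveE; apply: aP; rewrite mem_enum.
    - by move=> j jJ; apply: sP; rewrite mem_enum.
  move=> [bi aP sP]; apply/and4P; split; apply/allP => j.
  - by move=> _; have := bi j; rewrite /= !inE dot_delta ler_norml; lra.
  - by move=> _; have := bi j; rewrite /= !inE dotNl dot_delta ler_norml; lra.
  - by rewrite mem_enum /= aboveE => /aP.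
  - by rewrite mem_enum => /sP.
have h2P i i' : all (fun h : {set 'I_n} => (i \in h) == (i' \in h)) h2 <->
    forall j, j \in JP -> (hyperplane (M := g) lk (x i) <= hyperplane (lab j) (x i)) =
                          (hyperplane lk (x i') <= hyperplane (lab j) (x i')).
  rewrite all_map; split=> [/allP aP j jJ|aP].
    by rewrite -!aboveE; apply/eqP/aP; rewrite mem_enum.
  by apply/allP => j; rewrite mem_enum /= !aboveE => /aP ->.
have tC i : i \in t -> i \in C.
  by rewrite mem_pmap => /mapP[q _]; case: pickP => [i' /andP[i'C _] [->]|].
have maxC i : i \in C -> lk \in maximizers g (x i).
  by move=> /inC Ai; apply/maximizersP => m; exact: label_maximal ref Ai.
(* In the cell, plane [lk] is maximal, so it is at most plane [lab j] exactly when the latter is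
   maximal too, that is, when a principal cell carrying that plane touches the point. The pattern
   [Q] thus decides all the tests of [h2]. *)
have QC i i' : i \in C -> i' \in C -> Q i = Q i' ->
    all (fun h : {set 'I_n} => (i \in h) == (i' \in h)) h2.
  have half a b : a \in C -> b \in C -> Q a = Q b -> forall j, j \in JP ->
      hyperplane (M := g) lk (x a) <= hyperplane (lab j) (x a) ->
      hyperplane lk (x b) <= hyperplane (lab j) (x b).
    move=> aC bC qq j jJ la; have : lab j \in maximizers g (x a).
      apply/maximizersP => m; apply: le_trans la.
      by have /maximizersP := maxC a aC; apply.
    move=> /(touch _ _ (boxC _ aC))[j' [jQ lj' _]].
    move: jQ; rewrite qq inE => /andP[_ /asboolP tj'].
    have := touching_label_maximal lk tieP ref tj'.
    by rewrite lj' principal_hyperplane.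
  move=> iC i'C qq; apply/h2P => j jJ; apply/idP/idP; exact: half.
apply/describableP; exists h1, h2, t; split.
- move=> h; rewrite !mem_cat => /or4P[] /mapP[j _ ->]; try exact: closed_halfspace.
  by case: (sibP j).
- by move=> h /mapP[j _ ->]; exact: closed_halfspace.
- rewrite !size_cat !size_map -?enumT ?size_enum_ord -!cardE; split; nia.
- have st : (size t <= #|[set Q i | i in C]%SET|)%N.
    by rewrite size_pmap (leq_trans (count_size _ _))// -cardE.
  apply: leq_trans st _.
  apply: (@leq_trans (#|JP| * 2 ^ overlap_const p kap)); last by nia.
  apply: (@card_touching_patterns _ _ _ _ _ c d) => //.
  + by move=> j _; case: (fA j).
  + move=> j j'; rewrite !inE => /andP[/eqP pj _] /andP[/eqP pj' _] jj'.
    have ne l : A l !=set0 by have [[_ _ _ /(_ 0)[v Av _]] _] := fA l; exists v.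
    exact: (principal_cells_separated tieP ref jj').
  + move=> i iC; have [j [jQ _ jJ]] := touch i _ (boxC i iC) (maxC i iC).
    by exists j => //; move: jQ; rewrite inE => /andP[_ /asboolP].
apply/finset.setP => i; rewrite [RHS]inE; apply/idP/andP => [iC|[/h1P[bi aP sP] /hasP[i' i't /h2P hh]]].
  split.
    apply/h1P; split; [exact: boxC| |].
      by move=> j _; have /maximizersP := maxC i iC; apply.
    by move=> j jJ; have [_ /(_ jJ)[/fintype.subsetP sC _]] := sibP j; exact: sC.
  pose r := [pick i' in C | Q i' == Q i].
  have : exists2 i', r = Some i' & (i' \in C) && (Q i' == Q i).
    by rewrite /r; case: pickP => [i' i'P|/(_ i)]; [exists i'|rewrite iC eqxx].
  move=> [i' ri /andP[i'C /eqP qi]]; apply/hasP; exists i'; last exact: QC.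
  rewrite mem_pmap; apply/mapP; exists (Q i); last exact: esym.
  by rewrite mem_enum; exact: imset_f.
have i'C := tC _ i't.
have maxi : lk \in maximizers g (x i).
  have [l lmax] := maximizers_neq0 g (x i); apply/maximizersP => m.
  have [j [_ lj /aP]] := touch i l bi lmax; rewrite lj principal_hyperplane// => h.
  by apply: le_trans h; have /maximizersP := lmax; apply.
have half a b : box a -> lk \in maximizers g (x b) ->
    (forall j, j \in JP -> (hyperplane (M := g) lk (x a) <= hyperplane (lab j) (x a)) =
       (hyperplane lk (x b) <= hyperplane (lab j) (x b))) ->
    maximizers g (x a) \subset maximizers g (x b).
  move=> ba /maximizersP bmax hab; apply/fintype.subsetP => m ma.
  have [j [_ lj jJ]] := touch a m ba ma; have := hab j jJ.
  rewrite lj !principal_hyperplane//; move/maximizersP: ma => ma; rewrite ma => /esym h.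
  by apply/maximizersP => m'; apply: le_trans h.
(* The tie-breaking rule sees only the set of maximal planes, so [x i] gets the label of its
   reference point, which lies in cell [k]. Only siblings of [k] remain to be excluded. *)
have mx : maximizers g (x i) = maximizers g (x i').
  apply/eqP; rewrite finset.eqEsubset half ?maxC//= half//; first exact: boxC.
  by move=> j /hh.
have [j Aj] := covA _ (xX i); have [_ lj] := inA _ _ Aj; have [_ lk'] := inA _ _ (inC _ i'C).
have ljk : lab j = lab k by rewrite -lj -lk' mx.
have [jk|jk] := eqVneq j k; first by rewrite /C -jk inE; exact/mem_set.
have jJ : j \in JS.
  rewrite inE jk ljk eqxx; apply: (near_touch i j bi) => e e0.
  by exists (x i) => //; rewrite subrr -(scale0r 0) enormZ normr0 mul0r ltW.
by have [_ /(_ jJ)[_ /(_ i Aj)]] := sibP j; rewrite sP.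
Qed.

(** Markov's inequality: at most half of the members of [N] weigh more than [2 n / #|N|]. *)
Lemma light_half R (J : finType) (N : {set J}) (w : J -> R) (n : R) :
  0 < n -> (forall j, 0 <= w j) -> \sum_j w j <= n ->
  #|N|%:R <= 2 * #|[set j in N | w j * #|N|%:R <= 2 * n]%SET|%:R :> R.
Proof.
move=> n0 w0 wn; set m := #|N|%:R; set N' := [set j in N | _]%SET.
have [N0|Npos] := posnP #|N|; first by rewrite /m N0 mulr_ge0.
have m0 : 0 < m by rewrite ltr0n.
have NN' : N' \subset N by apply/fintype.subsetP => j; rewrite inE => /andP[].
have cN : m = #|N'|%:R + #|N :\: N'|%SET%:R.
  by rewrite -natrD /m -(cardsID N' N) (finset.setIidPr NN').
have : #|N :\: N'|%SET%:R * (2 * n / m) <= n.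
  apply: le_trans wn; rewrite mulr_natl -sumr_const.
  rewrite [leRHS](bigID (fun j => j \in N :\: N')%SET)/= -[leLHS]addr0; apply: lerD.
    apply: ler_sum => j; rewrite !inE => /andP[nj jN]; rewrite jN/= -ltNge in nj.
    by rewrite ler_pdivrMr// ltW.
  by apply: sumr_ge0.
rewrite mulrA ler_pdivrMr// mulrA -[leRHS]mulrC ler_pM2r//; lra.
Qed.

(** The factor 2 is the loss in [light_half]; the rest is the packing bound at radius [p.+1 * d k],
    with the ratio of [d k] to the packing scale kept apart. *)
Definition crowding_const R p (kap : R) : R :=
  2 * (packing_const p kap * p.+1%:R) ^+ p.

(* Half of the cells of [N] hold at most [2 n / #|N|] points each, which bounds
   their diameters from below; by packing, a large [N] then forces [d k] to be
   large too. *)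
Lemma crowding_bound R p n (J : finType) (A : J -> set 'rV[R]_p)
    (c : J -> 'rV[R]_p) (d w : J -> R) (kap om eps D Ln ll : R) (N : {set J}) (k : J) (z : 'rV[R]_p) :
  0 < kap -> 0 < om -> 0 < eps -> 0 < D -> 0 < Ln -> 1 <= ll -> (0 < n)%N ->
  (forall j, fat_body kap (A j) (c j) (d j)) ->
  (forall j, n%:R / (D * Ln) <= w j) -> (forall j, om * Ln <= d j ^+ 2 * w j) ->
  \sum_j w j <= n%:R ->
  (forall j j', j \in N -> j' \in N -> j != j' -> weakly_separated (A j) (A j')) ->
  (forall j, j \in N -> meets_ball (A j) z (p.+1%:R * d k)) ->
  crowding_const p kap * (1 + 2 * D / (eps * om)) ^+ p * ll ^+ p.+1 <= eps * om * Ln ->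
  #|N|%:R * ll <= eps * (d k ^+ 2 * w k).
Proof.
move=> kap0 om0 eps0 D0 Ln0 ll1 n0 fA wn dw sw sepN nearN num.
have d0 j : 0 < d j by case: (fA j).
have nR : 0 < n%:R :> R by rewrite ltr0n.
have w0 j : 0 < w j by apply: lt_le_trans (wn j); rewrite divr_gt0// mulr_gt0.
set m : R := #|N|%:R.
have V0 : 0 < d k ^+ 2 * w k by rewrite mulr_gt0// exprn_gt0.
have [N0|Npos] := posnP #|N|; first by rewrite /m N0 mul0r mulr_ge0 ?ltW.
have m0 : 0 < m by rewrite ltr0n.
(* A light cell holds at most [2 n / m] points, so the lower bound on [d j ^+ 2 * w j] gives
   [d j ^+ 2 >= s1]. The minimum with [d k ^+ 2] keeps the packing scale below the radius. *)
pose s1 := om * Ln * m / (2 * n%:R); pose s2 := Num.min (d k ^+ 2) s1.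
have s1_gt0 : 0 < s1 by rewrite divr_gt0 ?mulr_gt0.
have s2_gt0 : 0 < s2 by rewrite lt_min s1_gt0 exprn_gt0.
pose s := Num.sqrt s2; have s0 : 0 < s by rewrite sqrtr_gt0.
have ss : s ^+ 2 = s2 by rewrite sqr_sqrtr// ltW.
have sle a : 0 < a -> s2 <= a ^+ 2 -> s <= a.
  by move=> a0; rewrite -ss ler_sqr// nnegrE ltW.
have sd : s <= d k by apply: sle => //; rewrite ge_min lexx.
pose q := d k ^+ 2 / s2.
have q1 : 1 <= q by rewrite ler_pdivlMr// mul1r ge_min lexx.
have mq : m <= crowding_const p kap * q ^+ p.
  have half := light_half N nR (fun j => ltW (w0 j)) sw.
  set N' := [set j in N | _]%SET in half.
  have NN' j : j \in N' -> j \in N by rewrite inE => /andP[].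
  pose v j := xget 0 [set v | A j v /\ enorm (v - z) <= p.+1%:R * d k].
  have vP j : j \in N' -> A j (v j) /\ enorm (v j - z) <= p.+1%:R * d k.
    move=> /NN' /nearN /asboolP[u Au uz].
    by apply: (@xgetPex _ 0 [set v | A j v /\ enorm (v - z) <= p.+1%:R * d k]); exists u.
  have pc := packing_const_ge1 p kap0.
  have sr : 0 < s <= p.+1%:R * d k.
    by rewrite s0/=; apply: le_trans sd _; rewrite ler_peMl ?ler1n// ltW.
  have P : #|N'|%:R <= (packing_const p kap * (p.+1%:R * d k / s)) ^+ p.
    apply: (packing (A := A) (c := c) (w := v) (d := d) (z := z)) => // [j jN'|j j' /NN' jN /NN'].
      have [Av vz] := vP j jN'; split=> //; apply: sle => //.
      move: jN'; rewrite inE => /andP[_ light]; apply: (@le_trans _ _ s1).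
        by rewrite /s2 ge_min lexx orbT.
      rewrite /s1 ler_pdivrMr ?mulr_gt0//.
      apply: (@le_trans _ _ (d j ^+ 2 * w j * m)); first by rewrite ler_pM2r.
      by rewrite -mulrA ler_wpM2l// exprn_ge0// ltW.
    exact: sepN.
  apply: le_trans half _; rewrite /crowding_const -mulrA ler_pM2l//; apply: le_trans P _.
  rewrite -exprMn lerXn2r// ?nnegrE.
  - by rewrite mulr_ge0 ?divr_ge0 ?mulr_ge0 ?(ltW (d0 k)) ?(ltW s0)// (le_trans ler01).
  - by apply: mulr_ge0; [apply: mulr_ge0 => //|]; apply: le_trans ler01 _.
  rewrite -[leRHS]mulrA ler_wpM2l ?(le_trans ler01 pc)// -[leLHS]mulrA ler_wpM2l//.
  have r1 : 1 <= d k / s by rewrite ler_pdivlMr// mul1r.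
  by rewrite /q -ss -expr_div_n expr2 ler_peMl// (le_trans ler01).
have cc0 : 0 <= crowding_const p kap.
  by rewrite mulr_ge0// exprn_ge0// mulr_ge0//; have := packing_const_ge1 p kap0; lra.
pose B := 1 + 2 * D / (eps * om).
have B1 : 1 <= B by rewrite lerDl divr_ge0// ?mulr_ge0// ltW.
(* If [q] is at most of order [ll], packing bounds [m] by a multiple of [ll ^+ p], which [num]
   absorbs. If it is larger, [d k ^+ 2 = q * s1] is proportional to [q m], and the minimal size of
   cell [k] makes [d k ^+ 2 * w k] large enough. *)
have small : q <= B * ll -> m * ll <= eps * (d k ^+ 2 * w k).
  move=> qB; apply: (@le_trans _ _ (eps * om * Ln)); last first.
    by rewrite -mulrA ler_pM2l.
  apply: le_trans num; rewrite -/B exprSr !mulrA ler_pM2r; last lra.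
  apply: le_trans mq _; rewrite -mulrA -exprMn ler_wpM2l// lerXn2r ?nnegrE//; last by rewrite mulr_ge0//; lra.
  by lra.
have Bll : 1 <= B * ll by rewrite -[1]mulr1 ler_pM//; lra.
have [ds|sd1] := leP (d k ^+ 2) s1.
  by apply: small; rewrite /q /s2 (min_idPl ds) divff// gt_eqF// exprn_gt0.
have qE : d k ^+ 2 = q * s1.
  by rewrite /q /s2 (min_idPr (ltW sd1)) divfK// gt_eqF.
have Vq : q * om * m / (2 * D) <= d k ^+ 2 * w k.
  apply: (@le_trans _ _ (d k ^+ 2 * (n%:R / (D * Ln)))); last first.
    by rewrite ler_pM2l ?exprn_gt0.
  rewrite qE /s1 le_eqVlt; apply/orP; left; apply/eqP; field.
  by rewrite !gt_eqF.
have [le|lt] := leP ll (eps * q * om / (2 * D)).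
  apply: (@le_trans _ _ (eps * (q * om * m / (2 * D)))); last by rewrite ler_pM2l.
  have -> : eps * (q * om * m / (2 * D)) = m * (eps * q * om / (2 * D)) by ring.
  by rewrite ler_pM2l.
apply: small; move: lt; rewrite ltr_pdivrMr ?mulr_gt0// => lt.
have qq : q < 2 * D / (eps * om) * ll.
  rewrite mulrAC ltr_pdivlMr ?mulr_gt0//; apply: le_lt_trans _ (lt_le_trans lt _).
    by rewrite le_eqVlt; apply/orP; left; apply/eqP; ring.
  by rewrite mulrC.
by rewrite /B mulrDl mul1r; lra.
Qed.

Lemma near_ln_pow_le R (q : nat) (a : R) : 0 <= a ->
  exists Lam : R, forall L, Lam <= L -> 1 <= ln L /\ a * ln L ^+ q <= L.
Proof.
move=> a0; pose b := Num.max 1 (a * q.+1%:R ^+ q.+1).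
exists (expR b) => L bL; have L0 : 0 < L by apply: lt_le_trans bL; exact: expR_gt0.
have : b <= ln L by rewrite -[b]expRK ler_ln// posrE expR_gt0.
rewrite ge_max => /andP[l1 la]; split=> //.
have l0 : 0 <= ln L by lra.
have := expR_ge_pow q l0; rewrite lnK ?posrE//; apply: le_trans.
rewrite expr_div_n ler_pdivlMr ?exprn_gt0// [leRHS]exprS mulrAC.
by rewrite ler_wpM2r// exprn_ge0.
Qed.

Lemma emp_mean_convex R p n (XX : set 'rV[R]_p) (x : 'I_n -> 'rV[R]_p)
    (C : {set 'I_n}) :
  convex_set XX -> (forall i, i \in C -> XX (x i)) -> (0 < #|C|)%N -> XX (emp_mean x C).
Proof.
move=> cX; have [k] := ubnP #|C|; elim: k C => // k IH C /ltnSE ck XC C0.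
have /card_gt0P[i iC] := C0; have cD := finset.cardsD1 i C; rewrite iC add1n in cD.
have sumD : \sum_(j in C) x j = x i + \sum_(j in (C :\ i)%SET) x j by rewrite (big_setD1 i).
have XD j : j \in (C :\ i)%SET -> XX (x j) by rewrite !inE => /andP[_]; exact: XC.
have [C'0|C'0] := posnP #|C :\ i|%SET.
  rewrite /emp_mean sumD cD C'0 invr1 scale1r big1 ?addr0; first exact: XC.
  by move=> j; rewrite (cards0_eq C'0) inE.
have -> : emp_mean x C = emp_mean x (C :\ i)%SET +
    (#|C :\ i|%SET.+1)%:R^-1 *: (x i - emp_mean x (C :\ i)%SET).
  rewrite {1}/emp_mean sumD cD.
  have -> : \sum_(j in (C :\ i)%SET) x j = #|C :\ i|%SET%:R *: emp_mean x (C :\ i)%SET.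
    by rewrite /emp_mean scalerA divff ?scale1r// pnatr_eq0 -lt0n.
  apply/matrixP => a b; rewrite !mxE -natr1; field.
  by rewrite natr1 !pnatr_eq0 -lt0n C'0.
apply: convex_combination => //; [|exact: XC|].
  by apply: IH => //; apply: leq_trans ck; rewrite [leqRHS]cD.
by rewrite invr_ge0 ler0n/= invf_le1 ?ler1n.
Qed.

Lemma refines_induced_disjoint R p (XX : set 'rV[R]_p)
    tie (J : Type) (A : J -> set 'rV[R]_p)
    (g : model R p) (lab : J -> 'I_(msize g).+1) j j' v :
  refines_induced XX tie A lab -> A j v -> A j' v -> j = j'.
Proof.
move=> [inA _ cutA _] Aj Aj'; have [_ lj] := inA _ _ Aj; have [_ lj'] := inA _ _ Aj'.
apply: contrapT => ne; have := cutA _ _ ne (etrans (esym lj) lj').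
by move=> [q [b [[/(_ _ Aj) h1 /(_ _ Aj')]|[/(_ _ Aj') h1 /(_ _ Aj)]]]]; rewrite ltNge h1.
Qed.

Lemma sum_card_cells R p n (XX : set 'rV[R]_p)
    tie (J : finType) (A : J -> set 'rV[R]_p)
    (g : model R p) (lab : J -> 'I_(msize g).+1) (x : 'I_n -> 'rV[R]_p) :
  refines_induced XX tie A lab -> (\sum_j #|obs_in x (A j)| <= n)%N.
Proof.
move=> ref; under eq_bigr do rewrite -sum1_card big_mkcond.
rewrite exchange_big/= -[leqRHS]card_ord -sum1_card; apply: leq_sum => i _.
have [[j Aj]|no] := pselect (exists j, A j (x i)).
  rewrite (bigD1 j)//= big1 ?addn0; first by case: ifP.
  move=> j' /eqP jj'; case: ifP => //; rewrite inE => /set_mem Aj'.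
  by case: (jj' (refines_induced_disjoint ref Aj' Aj)).
rewrite big1// => j _; case: ifP => //; rewrite inE => /set_mem Aj.
by case: no; exists j.
Qed.

Definition complexity_factor R p (kap : R) : nat :=
  1 + 2 ^ overlap_const p kap.

(** The last inequality is the one that makes the noise negligible against [d N]. Apart from the
    box, the complexity counts nearby principal cells and nearby siblings, each a pairwise separated
    family to which [crowding_bound] applies. *)
Lemma cell_complexity R p (kap eps D : R) :
  0 < kap -> 0 < eps -> 0 < D -> exists om Lam : R, 0 < om /\
  forall (n : nat) (XX : set 'rV[R]_p) tie
    (J : finType) (A : J -> set 'rV[R]_p) (g : model R p) (lab : J -> 'I_(msize g).+1)
    (c : J -> 'rV[R]_p) (d : J -> R) (x : 'I_n -> 'rV[R]_p) (k : J),
  let L := ln n%:R in let w j := #|obs_in x (A j)|%:R in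
  tie_rule tie -> convex_set XX -> refines_induced XX tie A lab ->
  (forall j, fat_body kap (A j) (c j) (d j) /\ XX (c j)) -> (forall i, XX (x i)) ->
  Lam <= L -> (forall j, n%:R / (D * L) <= w j) -> (forall j, om * L <= d j ^+ 2 * w j) ->
  exists G, [/\ obs_in x (A k) \in describable (halfspaces x) G,
    G.+1%:R <= (2 * p.+1%:R + 2 * (complexity_factor p kap)%:R * D) * L
    & L + G.+1%:R * ln L <= eps * (d k ^+ 2 * w k)].
Proof.
move=> kap0 eps0 D0; set f := complexity_factor p kap.
(* Budget: [L], [(2 p + 1) ln L] and the crowding terms receive a quarter, a quarter and a half of
   [eps * (d k ^+ 2 * w k)], whence the two constants below. *)
have f0 : 0 < f%:R :> R by rewrite ltr0n.
pose eps' := eps / (4 * f%:R); pose om := 4 / eps.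
have eps'0 : 0 < eps' by rewrite divr_gt0// mulr_gt0.
have om0 : 0 < om by rewrite divr_gt0.
pose a0 := crowding_const p kap * (1 + 2 * D / (eps' * om)) ^+ p / (eps' * om).
have a00 : 0 <= a0.
  have pc := le_trans ler01 (packing_const_ge1 p kap0).
  have b0 : 0 <= 1 + 2 * D / (eps' * om).
    by rewrite addr_ge0// divr_ge0// mulr_ge0// ltW.
  apply: divr_ge0; last by rewrite mulr_ge0 ?ltW.
  apply: mulr_ge0; last exact: exprn_ge0.
  by apply: mulr_ge0 => //; apply: exprn_ge0; exact: mulr_ge0.
have [Lam1 HL] := @near_ln_pow_le R p.+1 (a0 + 2 * p.+1%:R) (addr_ge0 a00 (mulr_ge0 (ler0n _ _) (ler0n _ _))).
exists om, (Num.max 1 Lam1); split=> // n XX tie J A g lab c d x k L w tieP cX ref fA xX.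
rewrite ge_max => /andP[L1 /HL[ll1 llL]] wn dw; set ll := ln L in ll1 llL *.
have L0 : 0 < L by lra.
have n0 : (0 < n)%N by rewrite lt0n; apply: contraTneq L0 => n0; rewrite /L n0 ln0// ltxx.
have nR : 0 < n%:R :> R by rewrite ltr0n.
have sw : \sum_j w j <= n%:R by rewrite -natr_sum ler_nat; exact: sum_card_cells ref.
have w0 j : 0 < w j by apply: lt_le_trans (wn j); rewrite divr_gt0// mulr_gt0.
have : (0 < #|obs_in x (A k)|)%N by rewrite -(ltr0n R); exact: w0.
move=> /card_gt0P[i0]; rewrite inE => /set_mem Ak0.
have := cell_describable tieP cX ref kap0 fA xX Ak0; cbv zeta.
set JP := near_principal _ _ _ _ _; set JS := near_siblings _ _ _ _ _ => desc.
set G := (_ + _)%N in desc; exists G.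
have ne j : A j !=set0 by have [[_ _ _ /(_ 0)[v Av _]] _] := fA j; exists v.
have llp : 0 <= ll ^+ p.+1 by rewrite exprn_ge0//; lra.
have num : crowding_const p kap * (1 + 2 * D / (eps' * om)) ^+ p * ll ^+ p.+1 <= eps' * om * L.
  rewrite [leRHS]mulrC -ler_pdivrMr; last exact: mulr_gt0.
  by rewrite mulrAC; apply: le_trans llL; rewrite ler_wpM2r// lerDl mulr_ge0.
have crowd (N : {set J}) : (forall j j', j \in N -> j' \in N -> j != j' -> weakly_separated (A j) (A j')) ->
    (forall j, j \in N -> meets_ball (A j) (x i0) (p.+1%:R * d k)) ->
    #|N|%:R * ll <= eps' * (d k ^+ 2 * w k).
  move=> sepN nearN.
  exact: (crowding_bound (A := A) (c := c) kap0 om0 eps'0 D0 L0 ll1 n0 (fun j => proj1 (fA j)) wn dw sw sepN nearN num).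
have PJP : #|JP|%:R * ll <= eps' * (d k ^+ 2 * w k).
  apply: crowd => [j j'|j]; last by rewrite inE => /andP[].
  rewrite inE => /andP[/eqP pj _]; rewrite inE => /andP[/eqP pj' _] jj'.
  exact: (principal_cells_separated tieP ref jj').
have PJS : #|JS|%:R * ll <= eps' * (d k ^+ 2 * w k).
  apply: crowd => [j j'|j]; last by rewrite inE => /and3P[].
  rewrite inE => /and3P[_ /eqP lj _]; rewrite inE => /and3P[_ /eqP lj' _] /eqP jj'; apply: axis_cut_separated.
  by have [_ _ cutA _] := ref; apply: cutA => //; rewrite lj lj'.
have GE : G.+1%:R = 2 * p%:R + 1 + f%:R * (#|JP|%:R + #|JS|%:R) :> R.
  rewrite (_ : G = (2 * p + f * (#|JP| + #|JS|))%N)// -natr1 natrD !natrM.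
  by rewrite [(#|JP| + _)%:R]natrD addrAC.
(* Each cell holds at least [n / (D L)] of the [n] observations, so there are at most [D L] cells;
   the complexity is therefore [O(ln n)], the range covered by the noise event. *)
have cJ (N : {set J}) : #|N|%:R <= D * L.
  apply: (@le_trans _ _ #|J|%:R); first by rewrite ler_nat max_card.
  have : #|J|%:R * (n%:R / (D * L)) <= n%:R.
    by apply: le_trans sw; rewrite mulr_natl -sumr_const; apply: ler_sum.
  by rewrite mulrA ler_pdivrMr ?mulr_gt0// [_ * n%:R]mulrC ler_pM2l.
split => //.
  rewrite GE; have := cJ JP; have := cJ JS => h1 h2.
  have : f%:R * (#|JP|%:R + #|JS|%:R) <= f%:R * (2 * (D * L)) by rewrite ler_pM2l//; lra.
  have : (2 * p%:R + 1) * 1 <= (2 * p.+1%:R) * L :> R.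
    by rewrite ler_pM//; rewrite -?natr1; have := ler0n R p; lra.
  by rewrite mulrDl; lra.
have Vom : 4 * L <= eps * (d k ^+ 2 * w k).
  have := dw k; rewrite -(ler_pM2l eps0) /om; apply: le_trans.
  by rewrite mulrA mulrCA divff ?mulr1// gt_eqF.
have fF : f%:R * (#|JP|%:R + #|JS|%:R) * ll <= eps / 2 * (d k ^+ 2 * w k).
  apply: (@le_trans _ _ (f%:R * (2 * (eps' * (d k ^+ 2 * w k))))).
    by rewrite -mulrA ler_pM2l//; lra.
  by rewrite /eps' le_eqVlt; apply/orP; left; apply/eqP; field; rewrite gt_eqF.
have : (2 * p%:R + 1) * ll <= L.
  apply: le_trans llL; apply: ler_pM; [by have := ler0n R p; lra|lra| |].
    by rewrite -natr1; lra.
  by rewrite exprS ler_peMr ?exprn_ege1//; lra.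
by rewrite GE mulrDl; lra.
Qed.

(** * Consistency *)

Lemma enorm_bounded R p (XX : set 'rV[R]_p) : compact XX ->
  exists2 B, 0 <= B & forall u v, XX u -> XX v -> enorm (u - v) <= B.
Proof.
move=> /compact_bounded[N [_ /(_ (N + 1))]]; rewrite ltrDl ltr01 => /(_ isT) XN.
exists (`|p%:R * (2 * (N + 1))|) => // u v Xu Xv.
apply: le_trans (ler_norm _); apply: le_trans (enorm_le_norm _) _.
rewrite ler_wpM2l//; apply: le_trans (ler_normB _ _) _.
by have := XN _ Xu; have := XN _ Xv; rewrite /=; lra.
Qed.

Lemma le_diam R p (A : set 'rV[R]_p) (B : R) u v :
  (forall u v, A u -> A v -> enorm (u - v) <= B) -> A u -> A v -> enorm (u - v) <= diam A.
Proof.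
move=> AB Au Av; apply: ub_le_sup; last by exists u => //; exists v.
by exists B => _ [u' Au' [v' Av' <-]]; exact: AB.
Qed.

Lemma fat_body_cell R p n (x : 'I_n -> 'rV[R]_p) (A : set 'rV[R]_p)
    (lam B : R) :
  let C := obs_in x A in
  0 < lam -> lam <= min_eigenvalue (#|C|%:R^-1 *: gram x A) -> (0 < #|C|)%N -> 0 < diam A ->
  (forall u v, A u -> A v -> enorm (u - v) <= B) ->
  fat_body (lam / 2) A (emp_mean x C) (diam A).
Proof.
move=> C lam0 le_lam C0 d0 AB.
have inC i : i \in C -> A (x i) by rewrite inE => /set_mem.
have dA v w := @le_diam _ _ A B v w AB.
have hc v : A v -> enorm (v - emp_mean x C) <= diam A.
  by move=> Av; rewrite enormB; apply: emp_mean_dist => // i /inC Ai; exact: dA.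
split=> // u; have [i iC fi] := fat_cell u lam0 le_lam C0 d0 (fun i iC => hc _ (inC i iC)).
by exists (x i) => //; exact: inC.
Qed.

Lemma max_affine_error R p n (XX : set 'rV[R]_p) (f : 'rV[R]_p -> R)
    (grad : 'rV[R]_p -> 'rV[R]_p) (M : model R p) (x : 'I_n -> 'rV[R]_p) (y : 'I_n -> R)
    (lam eta delta B kappa : R) :
  let d (k : 'I_(msize M).+1) := diam (cell k) in
  let C (k : 'I_(msize M).+1) := obs_in x (cell k) in
  let e i := y i - f (x i) in
  convex_set XX -> (forall u v, XX u -> XX v -> enorm (u - v) <= B) ->
  (forall u v, XX u -> XX v -> f u + dot (grad u) (v - u) <= f v) ->
  (forall u v, XX u -> XX v -> enorm (v - u) <= delta ->
    `|f v - f u - dot (grad u) (v - u)| <= eta * enorm (v - u)) ->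
  0 < lam -> 0 <= eta -> 0 <= kappa -> delta <= 1 ->
  (forall k : 'I_(msize M).+1, cell k `<=` XX) -> (forall v, XX v -> exists k : 'I_(msize M).+1, cell k v) ->
  fitted x y M ->
  (forall k, [/\ (0 < #|C k|)%N, 0 < d k <= delta & lam <= min_eigenvalue (#|C k|%:R^-1 *: gram x (cell k))]) ->
  (forall k, `|\sum_(i in C k) e i| <= kappa * d k * #|C k|%:R) ->
  (forall k j t, `|\sum_(i in C k | t < x i 0 j) e i| <= kappa * d k * #|C k|%:R) ->
  forall v, XX v ->
  `|max_affine M v - f v| <= eta + (2 * eta + (1 + 3 * p%:R) * kappa) / lam * (1 + B).
Proof.
move=> d C e cX XB sub tay lam0 eta0 kap0 del1 cellX cov fit good es et v Xv.
set th := (2 * eta + (1 + 3 * p%:R) * kappa) / lam.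
have th0 : 0 <= th.
  apply: divr_ge0; last exact: ltW.
  by apply: addr_ge0; apply: mulr_ge0; rewrite ?addr_ge0 ?mulr_ge0.
have cB (k : 'I_(msize M).+1) u w : cell k u -> cell k w -> enorm (u - w) <= B.
  by move=> cu cw; apply: XB; [exact: cellX cu|exact: cellX cw].
have plane k : exists2 i0, i0 \in C k &
    forall v, XX v -> `|hyperplane k v - (f (x i0) + dot (grad (x i0)) (v - x i0))| <= th * (1 + B).
  have [C0 /andP[d0 dd] le_lam] := good k.
  have [_ dA hc _] := fat_body_cell lam0 le_lam C0 d0 (@cB k).
  have inC i : i \in C k -> cell k (x i) by rewrite inE => /set_mem.
  have /card_gt0P[i0 i0C] := C0; exists i0 => // u Xu; have Ai0 := inC _ i0C.
  have bias i : i \in C k -> `|y i - e i - (f (x i0) - dot (grad (x i0)) (x i0) +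
      dot (grad (x i0)) (x i))| <= eta * diam (cell k).
    move=> /inC Ai; have dist := dA _ _ Ai Ai0.
    have := tay _ _ (cellX _ _ Ai0) (cellX _ _ Ai) (le_trans dist dd).
    rewrite dotBr /e; have -> : y i - (y i - f (x i)) -
      (f (x i0) - dot (grad (x i0)) (x i0) + dot (grad (x i0)) (x i)) =
      f (x i) - f (x i0) - (dot (grad (x i0)) (x i) - dot (grad (x i0)) (x i0)) by ring.
    by move=> /le_trans; apply; rewrite ler_wpM2l.
  have := @least_squares_error _ _ _ x y e (cell k) lam eta _ _ _ _ _ lam0 le_lam C0 d0
    (fun i iC => hc _ (inC i iC)) (fit k) bias (es k) (et k) u.
  have -> : (2 * eta * diam (cell k) + (1 + 3 * p%:R) * (kappa * d k * #|C k|%:R) / #|C k|%:R) / lam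
    = th * d k by rewrite /th /d; field; rewrite pnatr_eq0 -lt0n C0 gt_eqF.
  rewrite mulfK ?gt_eqF// => err.
  have -> : hyperplane k u - (f (x i0) + dot (grad (x i0)) (u - x i0)) =
      icpt k + dot (slope k) u - (f (x i0) - dot (grad (x i0)) (x i0) + dot (grad (x i0)) u).
    by rewrite /hyperplane dotBr; ring.
  apply: le_trans err _; rewrite -mulrDr ler_wpM2l// lerD//; first exact: le_trans dd del1.
  apply: (XB _ _ Xu); apply: emp_mean_convex => // i /inC; exact: cellX.
rewrite ler_norml; apply/andP; split; last first.
  rewrite lerBlDl; apply: max_ord_le => k; have [i0 i0C /(_ v Xv)] := plane k.
  have Xi0 : XX (x i0) by move: i0C; rewrite inE => /set_mem; exact: cellX.
  have := sub _ _ Xi0 Xv; rewrite ler_norml; lra.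
have [k kv] := cov v Xv; have [i0 i0C /(_ v Xv)] := plane k.
have [C0 /andP[d0 dd] le_lam] := good k.
have [_ dA _ _] := fat_body_cell lam0 le_lam C0 d0 (@cB k).
have Ai0 : cell k (x i0) by move: i0C; rewrite inE => /set_mem.
have dist := le_trans (dA _ _ kv Ai0) dd.
have := tay _ _ (cellX _ _ Ai0) Xv dist.
have : eta * enorm (v - x i0) <= eta by rewrite ler_piMr// (le_trans dist).
have : hyperplane k v <= max_affine M v := max_ord_ge (fun k => hyperplane k v) k.
rewrite !ler_norml; lra.
Qed.

Definition noise_bounded R p (d : measure_display) (T : measurableType d)
    (P : probability T R) (X : nat -> T -> 'rV[R]_p) (e : nat -> T -> R) (D : R) : Prop :=
  forall g0, 0 <= g0 -> exists2 K, 0 <= K & with_prob_to_one P (noise_event X e g0 D K).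

Lemma cell_noise_bound R p n (x : 'I_n -> 'rV[R]_p) (e : 'I_n -> R)
    (C : {set 'I_n}) (G : nat) (g0 D K : R) (V : R) :
  (forall G C (N : R), G%:R <= g0 * ln n%:R -> C \in describable (halfspaces x) G ->
    #|C|%:R <= N -> n%:R / (D * ln n%:R) <= N ->
    `|\sum_(i in C) e i| <= K * Num.sqrt (N * (ln n%:R + G%:R * ln (ln n%:R)))) ->
  0 <= K -> C \in describable (halfspaces x) G -> G.+1%:R <= g0 * ln n%:R ->
  n%:R / (D * ln n%:R) <= #|C|%:R ->
  ln n%:R + G.+1%:R * ln (ln n%:R) <= V -> 0 <= ln (ln n%:R) :> R ->
  `|\sum_(i in C) e i| <= K * Num.sqrt (#|C|%:R * V) /\
  forall j t, `|\sum_(i in C | t < x i 0 j) e i| <= K * Num.sqrt (#|C|%:R * V).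
Proof.
move=> noise K0 desc GL CN VL ll0.
have bound C' : C' \in describable (halfspaces x) G.+1 -> C' \subset C ->
    `|\sum_(i in C') e i| <= K * Num.sqrt (#|C|%:R * V).
  move=> desc' sub; apply: le_trans (noise G.+1 C' _ GL desc' _ CN) _.
    by rewrite ler_nat subset_leq_card.
  by rewrite ler_wpM2l// ler_wsqrtr// ler_wpM2l.
split; first by apply: bound => //; exact: describable_le desc.
move=> j t; pose h := [set i | 0 < - t + dot (delta_mx 0 j) (x i)]%SET.
have hC : (C :&: h)%SET \in describable (halfspaces x) G.+1.
  by apply: describableI => //; exact: open_halfspace.
have -> : \sum_(i in C | t < x i 0 j) e i = \sum_(i in (C :&: h)%SET) e i.
  by apply: eq_bigl => i; rewrite !inE dot_delta addrC subr_gt0.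
by apply: bound => //; exact: finset.subsetIl.
Qed.

(** The response noise and the added Gaussian noise are controlled on two separate events, which are
    intersected; their constants add up. *)
Lemma max_affine_consistent R p (d : measure_display) (T : measurableType d)
    (P : probability T R) (XX : set 'rV[R]_p) (f : 'rV[R]_p -> R) (X : nat -> T -> 'rV[R]_p)
    (e1 e2 : nat -> T -> R) (D : R) tie
    (M : nat -> T -> model R p) :
  let x n w (i : 'I_n) := X i w in
  convex_set XX -> convex_function XX f -> compact XX -> continuously_differentiable_on XX f ->
  (forall i w, XX (X i w)) -> 0 < D -> tie_rule tie ->
  noise_bounded P X e1 D -> noise_bounded P X e2 D ->
  (forall n w, fitted (x n w) (fun i => f (X i w) + (e1 i w + e2 i w)) (M n w)) ->
  (forall n w, exists (g : model R p) (lab : 'I_(msize (M n w)).+1 -> 'I_(msize g).+1),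
     refines_induced XX tie (@cell R p (M n w)) lab) ->
  (forall n w, admissible D (x n w) (M n w) \/
     forall k : 'I_(msize (M n w)).+1, obs_in (x n w) (cell k) = finset.setT) ->
  cvg0_in_prob P (fun n w => max_diam (M n w)) ->
  bounded_away0_in_prob P (fun n w => lambda_min (x n w) (M n w)) ->
  cvg_infty_in_prob P (fun n w => min_cell_information (x n w) (M n w)) ->
  forall e, 0 < e -> with_prob_to_one P (fun n =>
    [set w | forall v, XX v -> `|max_affine (M n w) v - f v| <= e]).
Proof.
move=> x cX cf kX dX X_in D0 tieP N1 N2 fit ref adm A3 [lam lam0 A4] A5 e e0.
have [grad [sub tay]] := convex_uniform_taylor cX cf kX dX.
have [B B0 XB] := enorm_bounded kX.
have kap0 : 0 < lam / 2 by rewrite divr_gt0.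
set g0 := 2 * p.+1%:R + 2 * (complexity_factor p (lam / 2))%:R * D.
have g00 : 0 <= g0 by rewrite addr_ge0 ?mulr_ge0// ltW.
have [K1 K10 E1] := N1 g0 g00; have [K2 K20 E2] := N2 g0 g00.
(* With noise level [kappa = eta], the bound of [max_affine_error] is [eta * S], and [eta] is chosen
   to make this [e]. *)
pose S := 1 + (2 + (1 + 3 * p%:R)) / lam * (1 + B).
have S0 : 0 < S.
  rewrite ltr_pwDl//; apply: mulr_ge0; last exact: addr_ge0.
  by apply: divr_ge0; [rewrite !addr_ge0 ?mulr_ge0|exact: ltW].
pose eta := e / S; have eta0 : 0 < eta by rewrite divr_gt0.
have [delta0 delta00 tay0] := tay eta eta0.
pose delta := Num.min delta0 1; have delta_gt0 : 0 < delta by rewrite lt_min delta00 ltr01.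
have Kp : 0 < K1 + K2 + 1 by rewrite ltr_wpDl// addr_ge0.
(* Then [sqrt(N * (eps * d^2 N)) = eta / (K1 + K2 + 1) * d * N], so that both noises together amount
   to at most [eta * d * N]. The [+ 1] avoids a division by 0. *)
pose eps := (eta / (K1 + K2 + 1)) ^+ 2.
have eps0 : 0 < eps by rewrite exprn_gt0// divr_gt0.
have [om [Lam [om0 cplx]]] := cell_complexity p kap0 eps0 D0.
have E := with_prob_to_oneI (A3 delta delta_gt0) (with_prob_to_oneI A4
  (with_prob_to_oneI (A5 om) (with_prob_to_oneI E1 E2))).
apply: with_prob_to_one_sub E; near=> n => w [/= diamM [lamM [infM [nz1 nz2]]]].
have big : Num.max Lam (Num.max (D^-1) (expR 1)) <= ln n%:R by near: n; exact: near_ln_ge.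
move: big; rewrite !ge_max => /and3P[LamL DL eL].
have L1 : 1 <= ln n%:R :> R by apply: le_trans eL; have := expR_ge1Dx (1 : R); lra.
have L0 : 0 < ln n%:R :> R by lra.
have ll0 : 0 <= ln (ln n%:R) :> R by rewrite ln_ge0.
have n0 : (0 < n)%N by rewrite lt0n; apply: contraTneq L0 => ->; rewrite ln0// ltxx.
have DL0 : 0 < D * ln n%:R by rewrite mulr_gt0.
have [g [lab refM]] := ref n w; have [inA covA _ _] := refM.
set Mw := M n w in diamM lamM infM g lab refM inA covA *.
have cellX (k : 'I_(msize Mw).+1) : cell k `<=` XX by move=> v /inA[].
(* An inadmissible model has cells containing all [n] observations, and [n / (D ln n) <= n] once
   [ln n >= 1 / D]. *)
have nk (k : 'I_(msize Mw).+1) : n%:R / (D * ln n%:R) <= #|obs_in (x n w) (cell k)|%:R.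
  case: (adm n w) => [/(_ k)|/(_ k) ->].
    by apply: le_trans; rewrite /n_min le_max lexx.
  rewrite cardsT card_ord ler_pdivrMr// ler_peMr// -ler_pdivrMl// mulr1.
  exact: DL.
have nk0 (k : 'I_(msize Mw).+1) : (0 < #|obs_in (x n w) (cell k)|)%N.
  by rewrite -(ltr0n R); apply: lt_le_trans (nk k); rewrite divr_gt0// ltr0n.
have cB (k : 'I_(msize Mw).+1) u v : cell k u -> cell k v -> enorm (u - v) <= B.
  by move=> cu cv; apply: XB; [exact: cellX cu|exact: cellX cv].
have info (k : 'I_(msize Mw).+1) : om * ln n%:R <= diam (cell k) ^+ 2 * #|obs_in (x n w) (cell k)|%:R.
  rewrite -ler_pdivlMr//; apply: ltW; apply: lt_le_trans infM _.
  exact: (min_ord_le (fun k => diam (cell k) ^+ 2 * #|obs_in (x n w) (cell k)|%:R / ln n%:R) k).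
have d0 (k : 'I_(msize Mw).+1) : 0 < diam (cell k).
  rewrite lt_neqAle; apply/andP; split.
    apply: contraTneq (info k) => <-; rewrite expr0n/= mul0r -ltNge mulr_gt0//.
  have /card_gt0P[i] := nk0 k; rewrite inE => /set_mem Ai.
  by apply: le_trans (le_diam (@cB k) Ai Ai); exact: enorm_ge0.
have dd (k : 'I_(msize Mw).+1) : diam (cell k) <= delta.
  apply: le_trans (le_trans (ler_norm _) diamM).
  exact: (max_ord_ge (fun k => diam (cell k)) k).
have lamk (k : 'I_(msize Mw).+1) :
    lam <= min_eigenvalue (#|obs_in (x n w) (cell k)|%:R^-1 *: gram (x n w) (cell k)).
  apply: le_trans lamM _.
  exact: (min_ord_le (fun k => min_eigenvalue (#|obs_in (x n w) (cell k)|%:R^-1 *: gram (x n w) (cell k))) k).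
have fat (k : 'I_(msize Mw).+1) :
    fat_body (lam / 2) (cell k) (emp_mean (x n w) (obs_in (x n w) (cell k))) (diam (cell k)) /\
    XX (emp_mean (x n w) (obs_in (x n w) (cell k))).
  split; first exact: (fat_body_cell lam0 (lamk k) (nk0 k) (d0 k) (@cB k)).
  by apply: emp_mean_convex => // i _; exact: X_in.
have noise (k : 'I_(msize Mw).+1) :
    `|\sum_(i in obs_in (x n w) (cell k)) (e1 i w + e2 i w)|
       <= eta * diam (cell k) * #|obs_in (x n w) (cell k)|%:R /\
    forall j t, `|\sum_(i in obs_in (x n w) (cell k) | t < x n w i 0 j) (e1 i w + e2 i w)|
       <= eta * diam (cell k) * #|obs_in (x n w) (cell k)|%:R.
  have [G [desc GL GV]] := cplx n XX tie _ _ g lab _ _ (x n w) k tieP cX refM fat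
    (fun i => X_in i w) LamL nk info.
  have [b1 b1t] := cell_noise_bound nz1 K10 desc GL (nk k) GV ll0.
  have [b2 b2t] := cell_noise_bound nz2 K20 desc GL (nk k) GV ll0.
  set U := Num.sqrt _ in b1 b1t b2 b2t.
  have UE : (K1 + K2) * U <= eta * diam (cell k) * #|obs_in (x n w) (cell k)|%:R.
    have -> : U = eta / (K1 + K2 + 1) * diam (cell k) * #|obs_in (x n w) (cell k)|%:R.
      rewrite -[RHS]ger0_norm; last first.
        apply: mulr_ge0 => //; apply: mulr_ge0; last exact/ltW/d0.
        by apply: divr_ge0; exact: ltW.
      by rewrite -sqrtr_sqr /U /eps; congr (Num.sqrt _); ring.
    rewrite 2!mulrA ler_wpM2r// ler_wpM2r ?(ltW (d0 k))//.
    by rewrite mulrCA ger_pMr// ler_pdivrMr// mul1r lerDl.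
  split=> [|j t]; rewrite big_split/=; apply: le_trans (ler_normD _ _) _; apply: le_trans UE.
    by rewrite mulrDl lerD.
  by rewrite mulrDl lerD// ?b1t ?b2t.
move=> v Xv.
have taydelta u z : XX u -> XX z -> enorm (z - u) <= delta ->
    `|f z - f u - dot (grad u) (z - u)| <= eta * enorm (z - u).
  by move=> Xu Xz zu; apply: tay0 => //; apply: le_trans zu _; rewrite /delta ge_min lexx.
apply: le_trans (max_affine_error cX XB sub taydelta lam0 (ltW eta0) (ltW eta0) _ cellX covA (fit n w)
  (fun k => And3 (nk0 k) (introT andP (conj (d0 k) (dd k))) (lamk k)) _ _ Xv) _.
- by rewrite /delta ge_min lexx orbT.
- by move=> k; under eq_bigr do rewrite addrC addKr; have [] := noise k.
- by move=> k j t; under eq_bigr do rewrite addrC addKr; have [_] := noise k; apply.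
have -> : eta + (2 * eta + (1 + 3 * p%:R) * eta) / lam * (1 + B) = eta * S by rewrite /S; ring.
by rewrite /eta divfK// gt_eqF.
Unshelve. all: by end_near. Qed.

Theorem theorem3p3 (R : realType) (p : nat)
    (d : measure_display) (T : measurableType d) (P : probability T R)
    (XX : set 'rV[R]_p) (f0 : 'rV[R]_p -> R)
    (X : nat -> {RV P >-> borelV R p}) (Y : nat -> {RV P >-> R})
    (X_in : forall i w, XX (X i w))
    (XY_iid : iid P (fun (i : nat) (w : T) =>
       (X i w, Y i w) : (borelV R p * R)%type))
    (XX_convex : convex_set XX)
    (f0_convex : convex_function XX f0)
    (f0_regression : is_cond_expectation P XX (X 0%N) (Y 0%N) f0)
    (M : nat) (M_ge1 : (1 <= M)%N) (B : R) (B_ge0 : 0 <= B)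
    (xi : nat -> 'I_M -> {RV P >-> R})
    (xi_iid : iid P (fun (im : nat * 'I_M) (w : T) => xi im.1 im.2 w))
    (xi_normal : forall i m (S : set R), measurable S ->
       P (xi i m @^-1` S) = normal_law B S)
    (xi_indep : independent_families P
       (fun (im : nat * 'I_M) (w : T) => xi im.1 im.2 w)
       (fun (i : nat) (w : T) => (X i w, Y i w) : (borelV R p * R)%type))
    (L : nat) (L_ge1 : (1 <= L)%N) (a : 'I_L -> R)
    (a_knots : evenly_spaced_knots a) (D : R) (D_gt0 : 0 < D)
    (tie : forall K, {set 'I_K.+1} -> 'I_K.+1) (tieP : tie_rule tie)
    (crit : forall n, ('I_n -> 'rV[R]_p) -> ('I_n -> R) -> model R p -> R)
    (cap : forall n, ('I_n -> 'rV[R]_p) -> ('I_n -> R) -> model R p)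
    (capP : cap_estimator XX D a tie crit cap) :
  let x (n : nat) (w : T) (i : 'I_n) : 'rV[R]_p := X i w in
  let y (n : nat) (m : 'I_M) (w : T) (i : 'I_n) : R := Y i w + xi i m w in
  let CAP (n : nat) (m : 'I_M) (w : T) : model R p :=
    cap n (x n w) (y n m w) in
  (* A1 *)
  compact XX ->
  (exists zeta, elipschitz_on zeta XX f0) ->
  continuously_differentiable_on XX f0 ->
  (* A2 *)
  (exists (b : R) (h : 'rV[R]_p -> R) (c : R), [/\ 0 < b,
     is_cond_expectation P XX (X 0%N)
       (fun w => expR (b * `|Y 0%N w - f0 (X 0%N w)|)) h
     & forall v, XX v -> h v <= c]) ->
  (* A3 *)
  (forall m, cvg0_in_prob P (fun n w => max_diam (CAP n m w))) ->
  (* A4 *)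
  (forall m, bounded_away0_in_prob P
     (fun n w => lambda_min (x n w) (CAP n m w))) ->
  (* A5 *)
  (forall m, cvg_infty_in_prob P
     (fun n w => min_cell_information (x n w) (CAP n m w))) ->
  cvg0_in_prob P (fun n w =>
    sup [set `|M%:R^-1 * \sum_(m < M) max_affine (CAP n m w) v - f0 v|
        | v in XX]).
Proof.
move=> x y CAP kX _ dX [b [h [c [b0 hce hc]]]] A3 A4 A5 e e0.
have mX i : measurable_fun setT (X i : T -> borelV R p) by [].
have N1 : noise_bounded P X (fun i w => Y i w - f0 (X i w)) D.
  have [s0 [v [s00 v0 mgf]]] := data_noise_mgf X_in XY_iid kX f0_regression b0 hce hc.
  move=> g0 g00; apply: (uniform_noise mX _ s00 v0 mgf g00 D_gt0) => // i.
  have [_ mf0 _ _] := f0_regression.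
  have mf := proj1 (measurable_restrictT _ (compact_measurable_borelV kX)) mf0.
  apply: measurable_funB => //.
  (* Measurability of [f0] is only given on [XX], hence the passage through its extension by 0. *)
  rewrite (_ : (fun w => f0 (X i w)) = (f0 \_ XX) \o X i); first exact: measurableT_comp mf (mX i).
  by apply: funext => w; rewrite /= patchE mem_set.
have N2 m : noise_bounded P X (fun i w => xi i m w) D.
  have mgf := gaussian_noise_mgf m mX B_ge0 xi_iid xi_normal xi_indep.
  move=> g0 g00; apply: (uniform_noise mX _ ltr01 _ mgf g00 D_gt0) => //.
  by rewrite divr_ge0.
have out m n w := cap_output_model (fun i => X_in i w) (capP n (x n w) (y n m w) (fun i => X_in i w)).
have close m : with_prob_to_one P (fun n =>
    [set w | forall v, XX v -> `|max_affine (CAP n m w) v - f0 v| <= e]).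
  apply: (max_affine_consistent (X := X) XX_convex f0_convex kX dX X_in D_gt0 tieP N1 (N2 m)
    _ _ _ (A3 m) (A4 m) (A5 m) e0) => n w.
  - have [+ _ _] := out m n w; rewrite /CAP (_ : y n m w = fun i : 'I_n => f0 (X i w) +
      (Y i w - f0 (X i w) + xi i m w))//.
    by apply: funext => i; rewrite /y addrA [f0 _ + _]addrC subrK.
  - by have [_ + _] := out m n w.
  - by have [_ _] := out m n w.
apply: with_prob_to_one_sub (with_prob_to_one_forall close).
apply: nearW => n w /= all_close.
have M0 : 0 < M%:R :> R by rewrite ltr0n.
have le_e v : XX v -> `|M%:R^-1 * \sum_(m < M) max_affine (CAP n m w) v - f0 v| <= e.
  move=> Xv; have -> : M%:R^-1 * \sum_(m < M) max_affine (CAP n m w) v - f0 v =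
      M%:R^-1 * \sum_(m < M) (max_affine (CAP n m w) v - f0 v).
    rewrite sumrB mulrBr sumr_const card_ord -[f0 v *+ M]mulr_natl mulKf ?gt_eqF//.
  rewrite normrM gtr0_norm ?invr_gt0// mulrC ler_pdivrMr// mulr_natr.
  apply: le_trans (ler_norm_sum _ _ _) _.
  by rewrite -[M in leRHS]card_ord -sumr_const; apply: ler_sum => m _; exact: all_close.
set E := [set _ | _ in _].
have ubE : ubound E e by move=> _ [v Xv <-]; exact: le_e.
(* A supremum is meaningful only for a nonempty bounded set; the covariate at the current [w]
   provides a member, which also makes the supremum nonnegative. *)
have E0 : E (`|M%:R^-1 * \sum_(m < M) max_affine (CAP n m w) (X 0%N w) - f0 (X 0%N w)|).
  by exists (X 0%N w).
rewrite ger0_norm; first by apply: ge_sup => //; eexists; exact: E0.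
by apply: le_trans (ub_le_sup (ex_intro _ e ubE) E0).
Qed.
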